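(* Fix a point sphere complex $\mathfrak{p}\in\mathbb{R}^{4,2}$, $\langle\mathfrak{p},\mathfrak{p}\rangle=-1$. Let $\Delta=D_1\oplus_\perp D_2$ be a Dupin cyclide and let $\sigma_a$ be a Lie inversion with $a=\mathrm{span}\{\mathfrak{a}\}\neq p=\mathrm{span}\{\mathfrak{p}\}$. Put $$\mathcal{C}_a:=\{\mathrm{span}\{\mathfrak{b}\}\ |\ \mathfrak{b}\in\mathrm{span}\{\mathfrak{a},\mathfrak{p}\},\ \langle\mathfrak{b},\mathfrak{b}\rangle\neq 0\}.$$ Then the 1-parameter family $\mathcal{C}_a\ni b\mapsto\sigma_b(\Delta)$ of Dupin cyclides provides a Lamé family of a DC-system. If there exists a sphere in $\mathrm{span}\{\mathfrak{a},\mathfrak{p}\}$ (i.e. a nonzero lightlike vector), then this sphere, considered as a totally umbilic Legendre map, is also part of the Lamé family. Moreover, any Lamé family of Dupin cyclides that provides a DC-system is obtained in this way.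
   Context: Lie sphere geometry: $\mathbb{R}^{4,2}$ is $\mathbb{R}^6$ with a symmetric bilinear form $\langle\cdot,\cdot\rangle$ of signature $(4,2)$. Points $s=\mathrm{span}\{\mathfrak{s}\}$ of the Lie quadric $\mathbb{P}(\mathcal{L})=\{\mathrm{span}\{\mathfrak{s}\}\,|\,\langle\mathfrak{s},\mathfrak{s}\rangle=0,\ \mathfrak{s}\ne0\}$ are oriented 2-spheres (including points and planes); $s_1,s_2$ are in oriented contact iff $\langle\mathfrak{s}_1,\mathfrak{s}_2\rangle=0$. A contact element is a projective line contained in $\mathbb{P}(\mathcal{L})$; $\mathcal{Z}$ is the set of contact elements. A surface is a Legendre map $f:M^2\to\mathcal{Z}$, i.e. a 2-parameter family of contact elements with $\langle\mathfrak{s}_1,d\mathfrak{s}_2\rangle=0$ for all sections $s_1,s_2\in f$. A totally umbilic Legendre map is one all of whose contact elements contain one fixed sphere. Möbius subgeometry: fixing a point sphere complex $\mathfrak{p}$ with $\langle\mathfrak{p},\mathfrak{p}\rangle=-1$, the point spheres (points) are the $v\in\mathbb{P}(\mathcal{L})$ with $\langle\mathfrak{v},\mathfrak{p}\rangle=0$. Each contact element contains a point sphere; this gives the point sphere map of a Legendre map. Spheres $s_1,s_2$ are orthogonal iff $\langle\mathfrak{s}_1,\mathfrak{s}_2+\langle\mathfrak{s}_2,\mathfrak{p}\rangle\mathfrak{p}\rangle=0$. Orthogonality of surfaces and circles is meant in this Möbius geometry. Lie inversion: for $a=\mathrm{span}\{\mathfrak{a}\}$ with $\langle\mathfrak{a},\mathfrak{a}\rangle\ne0$,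 $\sigma_a(\mathfrak{r})=\mathfrak{r}-\frac{2\langle\mathfrak{r},\mathfrak{a}\rangle}{\langle\mathfrak{a},\mathfrak{a}\rangle}\mathfrak{a}$; it acts on spheres, contact elements, Legendre maps and subspaces. Dupin cyclide: an orthogonal splitting $\mathbb{R}^{4,2}=D_1\oplus_\perp D_2$ into two 3-dimensional subspaces of signature $(2,1)$. Its curvature spheres are the elements of $\mathbb{P}(D_1\cap\mathcal{L})$ and $\mathbb{P}(D_2\cap\mathcal{L})$; its Legendre map is $(u,v)\mapsto\mathrm{span}\{\mathfrak{s}^1(u),\mathfrak{s}^2(v)\}$, where $s^1,s^2$ parametrize these two families. $\sigma_b(\Delta)=\sigma_b(D_1)\oplus_\perp\sigma_b(D_2)$. Triply orthogonal system: three 1-parameter families of surfaces (coordinate surfaces) such that surfaces of different families intersect orthogonally; a Lamé family is a 1-parameter family of surfaces which is one of the three families of a triply orthogonal system. The orthogonal trajectories are the curves of intersection of coordinate surfaces of two different families. A Dupin cyclidic system (DC-system) is a triply orthogonal system where all orthogonal trajectories are circles and at least one Lamé family contains Dupin cyclides. Statements are local, away from singularities of the point sphere maps. *)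

(* Defs.v *)
From HB Require Import structures.
From mathcomp Require Import all_boot all_order all_algebra.
From mathcomp Require Import all_classical all_reals all_analysis.

Set Implicit Arguments.
Unset Strict Implicit.
Unset Printing Implicit Defensive.

Import Order.TTheory GRing.Theory Num.Theory.
Import numFieldNormedType.Exports.

Local Open Scope classical_set_scope.
Local Open Scope ring_scope.

Section Smooth.
Variable R : realType.

Definition iter_derive (V W : normedModType R) (vs : seq V) (f : V -> W) : V -> W :=
  foldr (fun v g => 'D_v g) f vs.

(* C^infinity on the open set U of a finite-dimensional V: all iterated
   directional derivatives exist and are continuous. *)
Definition smooth_on (V W : normedModType R) (U : set V) (f : V -> W) : Prop :=
  forall (vs : seq V) (t : V), U t ->
    {for t, continuous (iter_derive vs f)} /\
    forall v : V, derivable (iter_derive vs f) t v.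

Definition box (lo hi : 'rV[R]_3) : set 'rV[R]_3 :=
  [set t | forall i, lo 0 i < t 0 i < hi 0 i].

Definition partial (W : normedModType R) (i : 'I_3) (f : 'rV[R]_3 -> W) :
    'rV[R]_3 -> W :=
  'D_(delta_mx 0 i) f.

End Smooth.

Section LieSphereGeometry.
Variable R : realType.
Local Notation vec := 'rV[R]_6.
Local Notation par := 'rV[R]_3.

(* The form of R^{4,2} in an orthonormal basis. *)
Definition lform (x y : vec) : R :=
  \sum_(i < 6) (if (i < 4)%N then 1 else -1) * x 0 i * y 0 i.

Definition lie_inversion (a r : vec) : vec :=
  r - (2 * lform r a / lform a a) *: a.

Fact lie_inversion_is_linear (a : vec) : linear (lie_inversion a).
Proof.
move=> c u v; rewrite /lie_inversion.
have -> : lform (c *: u + v) a = c * lform u a + lform v a.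
  rewrite /lform mulr_sumr -big_split; apply: eq_bigr => i _ /=.
  rewrite !mxE mulrDr mulrDl; congr (_ + _).
  by rewrite !mulrA [_ * c]mulrC.
rewrite scalerBr scalerA addrACA -opprD -scalerDl; congr (_ - _ *: _).
by rewrite mulrDr mulrDl !mulrA [2 * c]mulrC.
Qed.

HB.instance Definition _ (a : vec) :=
  GRing.isLinear.Build R vec vec _ (lie_inversion a) (lie_inversion_is_linear a).

Definition lie_inversion_image (a : vec) (E : {vspace vec}) : {vspace vec} :=
  (linfun (lie_inversion a) @: E)%VS.

Definition contact_element (E : {vspace vec}) : Prop :=
  \dim E = 2%N /\ forall x, x \in E -> lform x x = 0.

Definition signature21 (D : {vspace vec}) : Prop :=
  exists e1 e2 e3 : vec,
    [/\ D = <<[:: e1; e2; e3]>>%VS,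
        [/\ lform e1 e1 = 1, lform e2 e2 = 1 & lform e3 e3 = -1] &
        [/\ lform e1 e2 = 0, lform e1 e3 = 0 & lform e2 e3 = 0]].

Definition dupin_cyclide (D1 D2 : {vspace vec}) : Prop :=
  [/\ signature21 D1, signature21 D2,
      forall x y, x \in D1 -> y \in D2 -> lform x y = 0 &
      (D1 + D2)%VS = fullv].

Definition cyclide_contact_element (D1 D2 E : {vspace vec}) : Prop :=
  exists s1 s2 : vec,
    [/\ s1 \in D1, s2 \in D2, (s1 != 0) && (s2 != 0),
        lform s1 s1 = 0 /\ lform s2 s2 = 0 & E = <<[:: s1; s2]>>%VS].

(* In a system of coordinate surfaces on a box, the i-th family consists of the
   surfaces t_i = const; it is encoded by one map f giving the contact element
   f t of the surface through the parameter t. *)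

(* A box is contractible, so a smooth family of contact elements over it has a
   global smooth frame. *)
Definition contact_family (lo hi : par) (f : par -> {vspace vec}) : Prop :=
  (forall t, box lo hi t -> contact_element (f t)) /\
  exists s1 s2 : par -> vec,
    [/\ smooth_on (box lo hi) s1, smooth_on (box lo hi) s2 &
        forall t, box lo hi t -> f t = <<[:: s1 t; s2 t]>>%VS].

Definition section_of (lo hi : par) (f : par -> {vspace vec}) (s : par -> vec) : Prop :=
  smooth_on (box lo hi) s /\ forall t, box lo hi t -> s t \in f t.

(* Every surface t_i = const is a Legendre map: only derivatives tangential to
   it (j != i) are constrained. *)
Definition legendre_family (lo hi : par) (i : 'I_3) (f : par -> {vspace vec}) : Prop :=
  contact_family lo hi f /\
  forall s1 s2, section_of lo hi f s1 -> section_of lo hi f s2 ->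
    forall j t, j != i -> box lo hi t -> lform (s1 t) (partial j s2 t) = 0.

(* The surface t_i = c of the family f is a piece of the Dupin cyclide, in an
   arbitrary parametrization. *)
Definition dupin_surface (D1 D2 : {vspace vec}) (lo hi : par) (i : 'I_3) (c : R)
    (f : par -> {vspace vec}) : Prop :=
  forall t, box lo hi t -> t 0 i = c -> cyclide_contact_element D1 D2 (f t).

(* x is a lift to R^{4,2} of a map into the point spheres; linear independence
   says that the map itself is an immersion. *)
Definition point_immersion (p : vec) (lo hi : par) (x : par -> vec) : Prop :=
  smooth_on (box lo hi) x /\
  forall t, box lo hi t ->
    [/\ lform (x t) (x t) = 0, lform (x t) p = 0 &
        free [:: x t; partial 0 x t; partial 1 x t; partial 2 x t]].

Definition orthogonal_spheres (p s1 s2 : vec) : Prop :=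
  lform s1 (s2 + lform s2 p *: p) = 0.

Definition triply_orthogonal_system (p : vec) (lo hi : par)
    (F : 'I_3 -> par -> {vspace vec}) : Prop :=
  [/\ forall i, lo 0 i < hi 0 i,
      forall i, legendre_family lo hi i (F i),
      exists2 x, point_immersion p lo hi x &
        forall i t, box lo hi t -> x t \in F i t &
      forall i j t, i != j -> box lo hi t ->
        forall s1 s2, s1 \in F i t -> s2 \in F j t -> orthogonal_spheres p s1 s2].

(* Circles are the (2,1)-planes in the orthogonal complement of p. *)
Definition circle (p : vec) (C : {vspace vec}) : Prop :=
  signature21 C /\ forall x, x \in C -> lform x p = 0.

(* The trajectory through t with parameter t_k is the intersection of the
   coordinate surfaces of the two families i != k. *)
Definition circular_trajectories (p : vec) (lo hi : par)
    (F : 'I_3 -> par -> {vspace vec}) : Prop :=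
  forall (k : 'I_3) (t : par), box lo hi t ->
    exists2 C, circle p C &
      forall t', box lo hi t' -> (forall i, i != k -> t' 0 i = t 0 i) ->
        forall i x, x \in F i t' -> lform x p = 0 -> x \in C.

Definition dc_system (p : vec) (lo hi : par) (F : 'I_3 -> par -> {vspace vec}) : Prop :=
  [/\ triply_orthogonal_system p lo hi F,
      circular_trajectories p lo hi F &
      exists i c D1 D2,
        [/\ lo 0 i < c < hi 0 i, dupin_cyclide D1 D2 & dupin_surface D1 D2 lo hi i c (F i)]].

(* A regular curve in the projective space of D, given by a smooth lift on an
   open interval. *)
Definition regular_curve (D : {vspace vec}) (l h : R) (c : R -> vec) : Prop :=
  smooth_on `]l, h[ c /\
  forall u, l < u < h -> c u \in D /\ free [:: c u; 'D_1 c u].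

Definition regular_null_curve (D : {vspace vec}) (l h : R) (c : R -> vec) : Prop :=
  regular_curve D l h c /\ forall u, l < u < h -> lform (c u) (c u) = 0.

(* Regular local parametrizations b of the line P(span{a,p}) and s1, s2 of the
   two families of curvature spheres, together with an immersion x which gives
   the point sphere maps of the cyclides sigma_b(D1 + D2).  Where b is lightlike,
   sigma_b is undefined and x is only required to extend as an immersion. *)
Definition regular_pencil (p : vec) (D1 D2 : {vspace vec}) (a : vec) (lo hi : par)
    (b s1 s2 : R -> vec) (x : par -> vec) : Prop :=
  [/\ forall i, lo 0 i < hi 0 i,
      regular_curve <<[:: a; p]>>%VS (lo 0 0) (hi 0 0) b,
      regular_null_curve D1 (lo 0 1) (hi 0 1) s1 /\
        regular_null_curve D2 (lo 0 2) (hi 0 2) s2,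
      point_immersion p lo hi x &
      forall t, box lo hi t -> lform (b (t 0 0)) (b (t 0 0)) != 0 ->
        x t \in lie_inversion_image (b (t 0 0)) <<[:: s1 (t 0 1)%R; s2 (t 0 2)%R]>>%VS].

End LieSphereGeometry.

(* Main.v *)
(* For null s1 in D1 and s2 in D2 the point sphere of sigma_b <s1, s2> has a lift
   X(b, s1, s2) to p^perp which is polynomial in b, s1, s2 and remains meaningful at
   lightlike b.  When b runs in span{a, p} and s1, s2 run in the two families of
   curvature spheres, the three partial derivatives of X are pairwise orthogonal;
   hence each of them spans, together with X and p, a contact element of a coordinate
   surface of a triply orthogonal system.  Each trajectory stays in a 3-dimensional
   subspace of p^perp, so it is a circle.

   Conversely, by Dupin's theorem the slice t_i = c of a system is locally
   F(c, y, z) = <s1^c(y), s2^c(z)> with s1^c, s2^c curves of curvature spheres.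
   Circularity of the trajectory through (y, z) puts all F(c, y, z) in one ruling of
   isotropic planes of a (2,2)-space K(y, z) containing p, and sigma_p exchanges the
   two rulings.  Therefore sigma_p F(c, y, z) meets F(c', y, z), so every line joining
   sigma_p s1^c(y) to s1^c'(y) meets every line joining sigma_p s2^c(z) to s2^c'(z).
   All these lines pass through one point b, and sigma_b sigma_p maps the cyclide of c
   to that of c'.  Since b lies in all the K(y, z), the points b belonging to
   different pairs c, c' lie on one line with p, and a product of three reflections
   in vectors of a plane is again such a reflection. *)

Require Import Defs.
From HB Require Import structures.
From mathcomp Require Import all_boot all_order all_algebra.
From mathcomp Require Import all_classical all_reals all_analysis.
From mathcomp Require Import ring lra zify.

Set Implicit Arguments.
Unset Strict Implicit.
Unset Printing Implicit Defensive.

Import Order.TTheory GRing.Theory Num.Theory.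
Import numFieldNormedType.Exports.

Local Open Scope classical_set_scope.
Local Open Scope ring_scope.

(** * The Lie form *)

(** In the converse two degeneracies shape the proof. Curvature line parametrizations of a slice
    exist only on a small rectangle depending on [c], so all slices are never treated on one
    rectangle. And the line joining sigma_p s1^c to s1^c' collapses when the two spheres agree.
    Three reference slices with pairwise distinct points on each trajectory settle both: in each
    family at most one of them is degenerate against a given slice, so some reference is good for
    both families, and each [c] is compared with it on a rectangle shrunk for that [c]. Only the
    references must be close together; the given slice may lie anywhere. The pencil is spanned by
    [p] and a link between references; such a link is not parallel to [p], because sigma_p sigma_p
    is the identity and two slices with distinct points would then share contact elements. In the
    direct part the obstacle is a lightlike member: there [x] is tied to no contact element, so
    everything is shown for the polynomial lift and reaches [x] by density of the non-null
    members. *)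

Section Spans.
Variables (F : fieldType) (V : vectType F).
Implicit Types (u v w x y : V) (U W : {vspace V}).

Lemma mem_span2P u v x :
  reflect (exists c d, x = c *: u + d *: v) (x \in <<[:: u; v]>>%VS).
Proof.
rewrite span_cons span_seq1; apply: (iffP memv_addP) => [|[c [d ->]]].
  by move=> [_ /vlineP[c ->] [_ /vlineP[d ->] ->]]; exists c, d.
by exists (c *: u); rewrite ?memvZ ?memv_line//; exists (d *: v);
  rewrite ?memvZ ?memv_line.
Qed.

Lemma mem_span3P u v w x :
  reflect (exists c d e, x = c *: u + d *: v + e *: w) (x \in <<[:: u; v; w]>>%VS).
Proof.
rewrite span_cons; apply: (iffP memv_addP) => [|[c [d [e ->]]]].
  move=> [_ /vlineP[c ->] [_ /mem_span2P[d [e ->]] ->]].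
  by exists c, d, e; rewrite addrA.
exists (c *: u); rewrite ?memvZ ?memv_line//; exists (d *: v + e *: w).
  by apply/mem_span2P; exists d, e.
by rewrite addrA.
Qed.

Lemma mem_span4P u v w y x :
  reflect (exists c d e f, x = c *: u + d *: v + e *: w + f *: y)
          (x \in <<[:: u; v; w; y]>>%VS).
Proof.
rewrite span_cons; apply: (iffP memv_addP) => [|[c [d [e [f ->]]]]].
  move=> [_ /vlineP[c ->] [_ /mem_span3P[d [e [f ->]]] ->]].
  by exists c, d, e, f; rewrite !addrA.
exists (c *: u); rewrite ?memvZ ?memv_line//; exists (d *: v + e *: w + f *: y).
  by apply/mem_span3P; exists d, e, f.
by rewrite !addrA.
Qed.

Lemma span2_subv u v U :
  (<<[:: u; v]>> <= U)%VS = (u \in U) && (v \in U).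
Proof.
apply/span_subvP/andP => [h|[hu hv] x]; first by split; apply: h; rewrite !inE eqxx ?orbT.
by rewrite !inE => /orP[] /eqP->.
Qed.

Lemma span3_subv u v w U :
  (<<[:: u; v; w]>> <= U)%VS = [&& u \in U, v \in U & w \in U].
Proof.
apply/span_subvP/and3P => [h|[hu hv hw] x].
  by split; apply: h; rewrite !inE eqxx ?orbT.
by rewrite !inE => /or3P[] /eqP->.
Qed.

Lemma memv_span2l u v : u \in <<[:: u; v]>>%VS.
Proof. by apply: memv_span; rewrite !inE eqxx. Qed.

Lemma memv_span2r u v : v \in <<[:: u; v]>>%VS.
Proof. by apply: memv_span; rewrite !inE eqxx orbT. Qed.

Lemma span2C u v : <<[:: u; v]>>%VS = <<[:: v; u]>>%VS.
Proof. by apply: eq_span => x; rewrite !inE orbC. Qed.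

Lemma free2P u v : u != 0 -> free [:: v; u] = (v \notin <[u]>%VS).
Proof. by move=> u0; rewrite free_cons span_seq1 seq1_free u0 andbT. Qed.

Lemma free_dim2 u v : u != 0 -> v \notin <[u]>%VS -> \dim <<[:: v; u]>> = 2%N.
Proof. by move=> u0; rewrite -free2P// => /eqP. Qed.

Lemma dim_span_size (X : seq V) n : (size X <= n)%N -> (\dim <<X>> <= n)%N.
Proof. by apply: leq_trans; exact: dim_span. Qed.

Lemma memv_lineC u v : u != 0 -> u \in <[v]>%VS -> v \in <[u]>%VS.
Proof.
move=> u0 /vlineP[k uk]; have k0 : k != 0.
  by apply: contraNneq u0 => k0; rewrite uk k0 scale0r.
by apply/vlineP; exists k^-1; rewrite uk scalerA mulVf// scale1r.
Qed.

Lemma span2_eq u v x y : free [:: x; y] ->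
  x \in <<[:: u; v]>>%VS -> y \in <<[:: u; v]>>%VS ->
  <<[:: u; v]>>%VS = <<[:: x; y]>>%VS.
Proof.
move=> fxy hx hy; apply/esym/eqP; rewrite eqEdim span2_subv hx hy/=.
by rewrite (eqP fxy); exact: dim_span.
Qed.
End Spans.

Section LorentzForm.
Variable R : realType.
Local Notation vec := 'rV[R]_6.
Implicit Types (u v w x y p : vec) (U D E : {vspace vec}).

Lemma lformC x y : lform x y = lform y x.
Proof. by apply: eq_bigr => i _; rewrite mulrAC. Qed.

Lemma lformDl u v w : lform (u + v) w = lform u w + lform v w.
Proof.
by rewrite /lform -big_split; apply: eq_bigr => i _; rewrite /= !mxE mulrDr mulrDl.
Qed.

Lemma lformZl c u v : lform (c *: u) v = c * lform u v.
Proof.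
rewrite /lform mulr_sumr; apply: eq_bigr => i _; rewrite !mxE.
by rewrite !mulrA [_ * c]mulrC.
Qed.

Lemma lformDr u v w : lform w (u + v) = lform w u + lform w v.
Proof. by rewrite lformC lformDl !(lformC w). Qed.

Lemma lformZr c u v : lform v (c *: u) = c * lform v u.
Proof. by rewrite lformC lformZl lformC. Qed.

Lemma lformNl u v : lform (- u) v = - lform u v.
Proof. by rewrite -scaleN1r lformZl mulN1r. Qed.

Lemma lformNr u v : lform v (- u) = - lform v u.
Proof. by rewrite lformC lformNl lformC. Qed.

Lemma lformBl u v w : lform (u - v) w = lform u w - lform v w.
Proof. by rewrite lformDl lformNl. Qed.

Lemma lformBr u v w : lform w (u - v) = lform w u - lform w v.
Proof. by rewrite lformDr lformNr. Qed.

Lemma lform0l u : lform 0 u = 0.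
Proof. by rewrite -(scale0r 0) lformZl mul0r. Qed.

Lemma lform0r u : lform u 0 = 0.
Proof. by rewrite lformC lform0l. Qed.

Definition lformE := (lformDl, lformDr, lformBl, lformBr, lformNl, lformNr,
  lformZl, lformZr, lform0l, lform0r).

Lemma lform_spanr x u v y : lform x u = 0 -> lform x v = 0 ->
  y \in <<[:: u; v]>>%VS -> lform x y = 0.
Proof. by move=> xu xv /mem_span2P[c [d ->]]; rewrite !lformE xu xv !mulr0 addr0. Qed.

Lemma lform_split x : lform x x =
  \sum_(i < 4) (lsubmx (x : 'rV_(4 + 2)) 0 i) ^+ 2
  - \sum_(i < 2) (rsubmx (x : 'rV_(4 + 2)) 0 i) ^+ 2.
Proof.
rewrite /lform (@big_split_ord _ _ _ 4 2)/= -sumrN; congr (_ + _).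
  by apply: eq_bigr => i _; rewrite mxE ltn_ord mul1r.
by apply: eq_bigr => i _; rewrite !mxE /= mulN1r mulNr.
Qed.

Lemma sqsum_eq0 n (a : 'rV[R]_n) : \sum_i (a 0 i) ^+ 2 <= 0 -> a = 0.
Proof.
move=> h; apply/rowP => i; rewrite mxE; apply/eqP; rewrite -sqrf_eq0.
have /eqP : \sum_i (a 0 i) ^+ 2 = 0.
  by apply/le_anti; rewrite h sumr_ge0// => j _; rewrite sqr_ge0.
by rewrite psumr_eq0 => [/allP/(_ i)|j _]; rewrite ?sqr_ge0// mem_index_enum => /(_ isT).
Qed.

(* A subspace on which the form is nonpositive projects injectively to the two
   timelike coordinates. *)
Lemma nonpos_dim U : (forall x, x \in U -> lform x x <= 0) -> (\dim U <= 2)%N.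
Proof.
move=> U0; pose f := linfun (@rsubmx R 1 4 2).
have fE y : f y = rsubmx (y : 'rV_(4 + 2)) by exact: lfunE.
have Uf : (U :&: lker f)%VS = 0%VS.
  apply/eqP; rewrite -subv0; apply/subvP => x; rewrite memv_cap => /andP[xU].
  rewrite memv_ker fE => /eqP x2; rewrite memv0; apply/eqP.
  have := U0 _ xU; rewrite lform_split x2 [X in _ - X]big1 => [|i _]; last first.
    by rewrite mxE expr0n.
  rewrite subr0 => /sqsum_eq0 x1.
  by rewrite -[x](@hsubmxK _ _ 4 2) x1 x2 row_mx0.
by rewrite -(limg_dim_eq Uf) (leq_trans (dimvS (subvf _)))// dimvf /dim/= mul1n.
Qed.

Lemma nonneg_dim U : (forall x, x \in U -> 0 <= lform x x) -> (\dim U <= 4)%N.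
Proof.
move=> U0; pose f := linfun (@lsubmx R 1 4 2).
have fE y : f y = lsubmx (y : 'rV_(4 + 2)) by exact: lfunE.
have Uf : (U :&: lker f)%VS = 0%VS.
  apply/eqP; rewrite -subv0; apply/subvP => x; rewrite memv_cap => /andP[xU].
  rewrite memv_ker fE => /eqP x1; rewrite memv0; apply/eqP.
  have := U0 _ xU; rewrite lform_split x1 [X in X - _]big1 => [|i _]; last first.
    by rewrite mxE expr0n.
  rewrite sub0r oppr_ge0 => /sqsum_eq0 x2.
  by rewrite -[x](@hsubmxK _ _ 4 2) x1 x2 row_mx0.
by rewrite -(limg_dim_eq Uf) (leq_trans (dimvS (subvf _)))// dimvf /dim/= mul1n.
Qed.

Lemma contact_element_orth E x y : contact_element E -> x \in E -> y \in E ->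
  lform x y = 0.
Proof.
move=> [_ E0] xE yE; have := E0 _ (rpredD xE yE).
rewrite !lformE !E0// add0r addr0 (lformC y) => h;
lra.
Qed.

(** Contact elements are maximal isotropic: the form vanishes on [E + <[v]>], and signature (4,2)
    admits no isotropic space of dimension three. *)
Lemma contact_element_max E v : contact_element E -> lform v v = 0 ->
  (forall x, x \in E -> lform v x = 0) -> v \in E.
Proof.
move=> [Ed E0] vv vE.
have : (\dim (E + <[v]>) <= 2)%N.
  apply: nonpos_dim => _ /memv_addP[x xE [_ /vlineP[c ->] ->]].
  by rewrite !lformE E0// vv (lformC x) vE// !mulr0 !addr0.
move=> h; have /eqP -> : E == (E + <[v]>)%VS by rewrite eqEdim addvSl Ed.
by apply: subvP (addvSr _ _) _ (memv_line v).
Qed.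

(** The complement of [p] is Lorentzian, so inside it a null vector has only its own multiples as
    non-spacelike orthogonal vectors: otherwise [y], [p], [x] would span three dimensions on which
    the form is nonpositive. This is what makes point spheres of contact elements unique. *)
Lemma timelike_perp_line p x y : lform p p < 0 -> x != 0 -> lform x x = 0 ->
  lform x p = 0 -> lform y p = 0 -> lform x y = 0 -> lform y y <= 0 ->
  y \in <[x]>%VS.
Proof.
move=> pp x0 xx xp yp xy yy.
have px : p \notin <[x]>%VS.
  apply/negP => /vlineP[c pc]; move: pp; rewrite pc !lformE xx !mulr0.
  by rewrite ltxx.
have : (\dim <<[:: y; p; x]>> <= 2)%N.
  apply: nonpos_dim => _ /mem_span3P[a [b [c ->]]]; rewrite !lformE.
  rewrite !(lformC p) !(lformC y x) xx xp yp xy !mulr0 !add0r !addr0 !mulrA -!expr2.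
  have := mulr_ge0_le0 (sqr_ge0 a) yy; have := mulr_ge0_le0 (sqr_ge0 b) (ltW pp).
  lra.
have : ~~ free [:: y; p; x] -> y \in <[x]>%VS.
  rewrite free_cons free2P// px andbT negbK => /mem_span2P[a [b yab]].
  have := yp; rewrite yab !lformE xp mulr0 addr0 => /eqP.
  by rewrite mulf_eq0 (lt_eqF pp) orbF => /eqP ->; rewrite scale0r add0r memvZ ?memv_line.
by move=> h d2; apply: h; apply/negP => /eqP d3; rewrite d3 in d2.
Qed.

(** [x] lifts a point of conformal 3-space. Inside the complement of [p], the vectors orthogonal to
    [x] form, modulo [x], the Euclidean tangent space, and the [d i] are an orthogonal basis of
    it. *)
Definition orth_frame p x (d : 'I_3 -> vec) :=
  [/\ x != 0, lform x x = 0 /\ lform x p = 0,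
      forall i, lform x (d i) = 0 /\ lform (d i) p = 0,
      forall i j, i != j -> lform (d i) (d j) = 0 &
      forall i, 0 < lform (d i) (d i)].

Lemma ord3_split (P : 'I_3 -> Prop) : P 0 -> P 1 -> P 2 -> forall i, P i.
Proof.
move=> P0 P1 P2 [[|[|[|//]]] h].
- by rewrite (_ : Ordinal _ = 0)//; exact/val_inj.
- by rewrite (_ : Ordinal _ = 1)//; exact/val_inj.
- by rewrite (_ : Ordinal _ = 2)//; exact/val_inj.
Qed.

Lemma orth_frame_coef p x d a c : orth_frame p x d ->
  a *: x + \sum_i c i *: d i = 0 -> a = 0 /\ forall i, c i = 0.
Proof.
move=> [x0 [xx xp] xd dd dp] h; have c0 i : c i = 0.
  have := congr1 (fun v => lform v (d i)) h.
  rewrite /= lform0l lformDl lformZl (proj1 (xd i)) mulr0 add0r (bigD1 i)//= lformDl.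
  rewrite lformZl (_ : lform (\sum_(j < 3 | j != i) _) _ = 0); last first.
    apply: (big_ind (fun u => lform u (d i) = 0)) => [|u v hu hv|j ji].
    - by rewrite lform0l.
    - by rewrite lformDl hu hv addr0.
    - by rewrite lformZl dd ?mulr0.
  by move=> /eqP; rewrite addr0 mulf_eq0 (gt_eqF (dp i)) orbF => /eqP.
split=> //; move: h; rewrite big1 => [/eqP|i _]; last by rewrite c0 scale0r.
by rewrite addr0 scaler_eq0 (negbTE x0) orbF => /eqP.
Qed.

Lemma big_ord3 (A : nmodType) (f : 'I_3 -> A) : \sum_i f i = f 0 + f 1 + f 2.
Proof.
rewrite !big_ord_recl big_ord0 addr0 addrA.
by congr (f _ + f _ + f _); exact/val_inj.
Qed.

Lemma orth_frame_free p x d : orth_frame p x d -> free [:: x; d 0; d 1; d 2].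
Proof.
move=> h; have [x0 _ _ _ dp] := h.
have H a c0 c1 c2 : a *: x + (c0 *: d 0 + c1 *: d 1 + c2 *: d 2) = 0 ->
    [/\ a = 0, c0 = 0, c1 = 0 & c2 = 0].
  move=> e; pose c (i : 'I_3) := if i == 0 then c0 else if i == 1 then c1 else c2.
  have := @orth_frame_coef p x d a c h; rewrite big_ord3 => /(_ e)[-> ci].
  by split=> //; [apply: (ci 0) | apply: (ci 1) | apply: (ci 2)].
have H' a c0 c1 c2 : - (a *: x + (c0 *: d 0 + c1 *: d 1 + c2 *: d 2)) = 0 ->
    [/\ a = 0, c0 = 0, c1 = 0 & c2 = 0].
  by move/eqP; rewrite oppr_eq0 => /eqP/H.
rewrite !free_cons nil_free andbT span_nil; apply/and4P; split.
- apply/negP => /mem_span3P[c [e [f xE]]]; have := H (-1) c e f.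
  rewrite scaleN1r {1}xE addNr => /(_ erefl)[/eqP]; by rewrite oppr_eq0 oner_eq0.
- apply/negP => /mem_span2P[e [f xE]]; have := H 0 (-1) e f.
  rewrite scale0r scaleN1r add0r -addrA {1}xE addNr => /(_ erefl)[_ /eqP].
  by rewrite oppr_eq0 oner_eq0.
- rewrite span_seq1; apply/negP => /vlineP[f xE]; have := H 0 0 (-1) f.
  rewrite !scale0r scaleN1r !add0r {1}xE addNr => /(_ erefl)[_ _ /eqP].
  by rewrite oppr_eq0 oner_eq0.
- rewrite memv0; apply/eqP => d0; have := dp 2; by rewrite d0 lform0l ltxx.
Qed.

(** A spacelike [v] would extend the frame to five independent vectors with nonnegative form, one
    more than the signature allows; a non-spacelike [v] falls under [timelike_perp_line]. *)
Lemma orth_frame_perp p x d v : lform p p < 0 -> orth_frame p x d ->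
  lform x v = 0 -> lform v p = 0 -> (forall i, lform v (d i) = 0) -> v \in <[x]>%VS.
Proof.
move=> pp h xv vp vd; have [x0 [xx xp] xd dd dp] := h.
have [v0|v0] := lerP (lform v v) 0; first exact: (timelike_perp_line pp x0).
have vn : v \notin <<[:: x; d 0; d 1; d 2]%R>>%VS.
  apply/negP => /mem_span4P[a [b [c [e vE]]]]; move: v0; rewrite {2}vE.
  by rewrite !lformE !vd (lformC v) xv !mulr0 !addr0 ltxx.
have f5 : free [:: v; x; d 0; d 1; d 2] by rewrite free_cons vn (orth_frame_free h).
have : (\dim <<[:: v; x; d 0; d 1; d 2]%R>> <= 4)%N.
  apply: nonneg_dim => z; rewrite span_cons => /memv_addP[_ /vlineP[k ->]].
  move=> [_ /mem_span4P[a [b [c [e ->]]]] ->]; rewrite !lformE.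
  have e10 : lform (d 1) (d 0) = 0 by rewrite dd.
  have e20 : lform (d 2) (d 0) = 0 by rewrite dd.
  have e12 : lform (d 1) (d 2) = 0 by rewrite dd.
  rewrite !(lformC _ v) !(lformC _ x) !(lformC (d 0) (d 1)) !(lformC (d 0) (d 2)).
  rewrite !(lformC (d 2) (d 1)) e10 e20 e12 !vd xv.
  rewrite !(proj1 (xd _)) xx !mulr0 !add0r !addr0 !mulrA -!expr2.
  by rewrite !addr_ge0// mulr_ge0 ?sqr_ge0// ltW.
by rewrite (eqP f5).
Qed.

(** After removing the components along [p] and [d i], the rest is orthogonal to the whole frame and
    to [p], hence a multiple of [x]. *)
Lemma orth_frame_normal p x d i v : lform p p = -1 -> orth_frame p x d ->
  lform x v = 0 -> (forall j, j != i -> lform v (d j) = 0) ->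
  exists a b c, v = a *: x + b *: d i + c *: p.
Proof.
move=> pp h xv vd; have [x0 [xx xp] xd dd dp] := h.
pose b := lform v (d i) / lform (d i) (d i).
pose v' := v + lform v p *: p - b *: d i.
have : v' \in <[x]>%VS.
  apply: (orth_frame_perp (d := d) (p := p)) => //; first by rewrite pp ltrN10.
  - by rewrite /v' !lformE xv xp (proj1 (xd i)) !mulr0 !subr0 addr0.
  - by rewrite /v' !lformE pp (proj2 (xd i)) mulr0 subr0 mulrN1 subrr.
  - move=> j; rewrite /v' !lformE (lformC p) (proj2 (xd j)) mulr0 addr0.
    have [->|ji] := eqVneq j i; last by rewrite vd// (dd i j) 1?eq_sym// mulr0 subrr.
    by rewrite /b divfK ?subrr// gt_eqF.
move=> /vlineP[a av]; exists a, b, (- lform v p); rewrite -av /v' scaleNr.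
by rewrite subrK addrK.
Qed.
End LorentzForm.

(** * Dupin cyclides and Lie inversions *)

Section Cyclides.
Variable R : realType.
Local Notation vec := 'rV[R]_6.
Implicit Types (a b u v w x y p e f : vec) (U D E : {vspace vec}).

Lemma onb_coord e1 e2 e3 v :
  lform e1 e1 = 1 -> lform e2 e2 = 1 -> lform e3 e3 = -1 ->
  lform e1 e2 = 0 -> lform e1 e3 = 0 -> lform e2 e3 = 0 ->
  v \in <<[:: e1; e2; e3]>>%VS ->
  v = lform v e1 *: e1 + lform v e2 *: e2 - lform v e3 *: e3.
Proof.
move=> h1 h2 h3 h12 h13 h23 /mem_span3P[a [b [c ->]]]; rewrite !lformE.
rewrite !(lformC e2 e1) !(lformC e3 e1) !(lformC e3 e2) h1 h2 h3 h12 h13 h23.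
by rewrite !mulr0 !mulr1 !addr0 !add0r mulrN1 scaleNr opprK.
Qed.

Lemma signature21_dim D : signature21 D -> \dim D = 3%N.
Proof.
move=> [e1 [e2 [e3 [-> [h1 h2 h3] [h12 h13 h23]]]]].
suff /eqP -> : free [:: e1; e2; e3] by [].
rewrite !free_cons nil_free span_nil andbT span_seq1; apply/and3P; split.
- apply/negP => /mem_span2P[a [b eE]]; move: h1; rewrite {1}eE !lformE.
  by rewrite !(lformC _ e1) h12 h13 !mulr0 addr0 => /eqP; rewrite eq_sym oner_eq0.
- apply/negP => /vlineP[a eE]; move: h2; rewrite {1}eE !lformE (lformC _ e2) h23.
  by rewrite mulr0 => /eqP; rewrite eq_sym oner_eq0.
- rewrite memv0; apply/eqP => eE; move: h3; rewrite eE lform0l => /eqP.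
  by rewrite eq_sym oppr_eq0 oner_eq0.
Qed.

Lemma signature21_nondeg D v : signature21 D -> v \in D ->
  (forall w, w \in D -> lform v w = 0) -> v = 0.
Proof.
move=> [e1 [e2 [e3 [-> [h1 h2 h3] [h12 h13 h23]]]]] vD h.
rewrite (onb_coord h1 h2 h3 h12 h13 h23 vD) !h ?memv_span ?inE ?eqxx ?orbT//.
by rewrite !scale0r addr0 subr0.
Qed.

(** The tangent line, at [f], of the conic of null lines of [D]: modulo [f] it is spanned by one
    spacelike vector. Derivatives of curves of curvature spheres are therefore spacelike or parallel
    to the curve. *)
Lemma null_tangent D f : signature21 D -> f \in D -> f != 0 -> lform f f = 0 ->
  exists m, 0 < lform m m /\
    forall u, u \in D -> lform u f = 0 -> exists c k, u = c *: f + k *: m.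
Proof.
move=> [e1 [e2 [e3 [-> [h1 h2 h3] [h12 h13 h23]]]]] fD f0 ff.
have fE := onb_coord h1 h2 h3 h12 h13 h23 fD.
move: (lform f e1) (lform f e2) (lform f e3) fE => a b c fE.
have G (x1 x2 x3 y1 y2 y3 : R) :
    lform (x1 *: e1 + x2 *: e2 - x3 *: e3) (y1 *: e1 + y2 *: e2 - y3 *: e3) =
    x1 * y1 + x2 * y2 - x3 * y3.
  rewrite !lformE !(lformC e2 e1) !(lformC e3 e1) !(lformC e3 e2) h1 h2 h3 h12 h13 h23.
  by ring.
have abc : a * a + b * b = c * c by move: ff; rewrite fE G => /eqP; rewrite subr_eq0 => /eqP.
have c0 : c != 0.
  apply: contraNneq f0 => c0; rewrite fE c0 scale0r subr0.
  have : a * a + b * b == 0 by rewrite abc c0 mulr0.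
  rewrite paddr_eq0 -?expr2 ?sqr_ge0// !sqrf_eq0 => /andP[/eqP-> /eqP->].
  by rewrite !scale0r addr0.
(* The null cone is the cone over the circle a^2 + b^2 = c^2; this vector is tangent to that circle
   at the direction of [f]. *)
exists ((- b) *: e1 + a *: e2 - 0 *: e3); split.
  by rewrite G mulrNN mulr0 subr0 addrC abc -expr2 exprn_even_gt0.
move=> u uD uf; rewrite (onb_coord h1 h2 h3 h12 h13 h23 uD).
have := uf; rewrite {1}(onb_coord h1 h2 h3 h12 h13 h23 uD) {1}fE G.
move: (lform u e1) (lform u e2) (lform u e3) => u1 u2 u3 uabc.
exists (u3 / c), ((a * u2 - b * u1) / (c * c)); rewrite fE.
have cc : c * c != 0 by rewrite mulf_neq0.
have u3c : u3 * c = u1 * a + u2 * b by lra.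
have e1' : u1 = u3 / c * a + (a * u2 - b * u1) / (c * c) * (- b).
  apply: (mulIf cc); transitivity (u3 * c * a - (a * u2 - b * u1) * b); last by field.
  by rewrite u3c -abc; ring.
have e2' : u2 = u3 / c * b + (a * u2 - b * u1) / (c * c) * a.
  apply: (mulIf cc); transitivity (u3 * c * b + (a * u2 - b * u1) * a); last by field.
  by rewrite u3c -abc; ring.
have e3' : u3 = u3 / c * c by rewrite divfK.
rewrite [X in X *: e1]e1' [X in _ + X *: e2]e2' [X in - (X *: e3)]e3'.
by apply/rowP => l; rewrite !mxE; ring.
Qed.

Lemma dupin_cyclideC D1 D2 : dupin_cyclide D1 D2 -> dupin_cyclide D2 D1.
Proof.
by move=> [h1 h2 h12 D12]; split=> // [x y xD yD|]; [rewrite lformC h12|rewrite addvC].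
Qed.

Lemma cyclide_perp D1 D2 v : dupin_cyclide D1 D2 ->
  (forall w, w \in D1 -> lform v w = 0) -> v \in D2.
Proof.
move=> [h1 h2 h12 D12] h; have : v \in (D1 + D2)%VS by rewrite D12 memvf.
move=> /memv_addP[x xD [y yD vE]]; rewrite vE.
rewrite (signature21_nondeg h1 xD) ?add0r// => w wD.
by have := h _ wD; rewrite vE lformE (lformC y) (h12 w y)// addr0.
Qed.

Lemma cyclide_disjoint D1 D2 v : dupin_cyclide D1 D2 -> v \in D1 -> v \in D2 -> v = 0.
Proof.
by move=> [h1 _ h12 _] v1 v2; apply: (signature21_nondeg h1) => // w wD; rewrite lformC h12.
Qed.

Lemma cyclide_cap D1 D2 : dupin_cyclide D1 D2 -> (D1 :&: D2)%VS = 0%VS.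
Proof.
move=> h; apply/eqP; rewrite -subv0; apply/subvP => v; rewrite memv_cap => /andP[v1 v2].
by rewrite memv0 (cyclide_disjoint h v1 v2).
Qed.

Lemma cyclide_contact_elementC D1 D2 E : cyclide_contact_element D1 D2 E ->
  cyclide_contact_element D2 D1 E.
Proof.
by move=> [s1 [s2 [? ? /andP[? ?] [? ?] ->]]]; exists s2, s1; split=> //;
  [apply/andP | rewrite span2C].
Qed.

Lemma null_pair_isotropic u v x y : lform u u = 0 -> lform v v = 0 -> lform u v = 0 ->
  x \in <<[:: u; v]>>%VS -> y \in <<[:: u; v]>>%VS -> lform x y = 0.
Proof.
move=> uu vv uv /mem_span2P[a [b ->]] /mem_span2P[c [d ->]].
by rewrite !lformE (lformC v) uu vv uv !mulr0 !addr0.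
Qed.

Lemma null_pair_contact u v : u != 0 -> v \notin <[u]>%VS ->
  lform u u = 0 -> lform v v = 0 -> lform u v = 0 -> contact_element <<[:: u; v]>>%VS.
Proof.
move=> u0 vu uu vv uv; split; first by rewrite span2C free_dim2.
by move=> x xE; apply: (null_pair_isotropic uu vv uv).
Qed.

Section Inversion.
Variable b : vec.
Hypothesis bb : lform b b != 0.
Local Notation s_ := (lie_inversion b).

Lemma lform_inversion x y : lform (s_ x) (s_ y) = lform x y.
Proof. by rewrite /lie_inversion !lformE (lformC b y); field. Qed.

Lemma lie_inversionK x : s_ (s_ x) = x.
Proof.
by rewrite /lie_inversion; apply/rowP => l; rewrite !mxE !lformE; field.
Qed.

Lemma mem_lie_inversion_image x E : (x \in lie_inversion_image b E) = ((s_ x) \in E).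
Proof.
apply/idP/idP => [/memv_imgP[y yE ->]|h]; first by rewrite lfunE/= lie_inversionK.
by apply/memv_imgP; exists (s_ x) => //; rewrite lfunE/= lie_inversionK.
Qed.

Lemma mem_lie_inversion_image2 x E : ((s_ x) \in lie_inversion_image b E) = (x \in E).
Proof. by rewrite mem_lie_inversion_image lie_inversionK. Qed.

Lemma lie_inversion_span (X : seq vec) :
  lie_inversion_image b <<X>>%VS = <<[seq (s_ x) | x <- X]>>%VS.
Proof.
by rewrite /lie_inversion_image limg_span; congr (span _); apply: eq_map => x; rewrite lfunE.
Qed.

Lemma lie_inversion_dim E : \dim (lie_inversion_image b E) = \dim E.
Proof.
apply: limg_dim_eq; apply/eqP; rewrite -subv0; apply/subvP => x; rewrite memv_cap memv0.
by rewrite memv_ker lfunE/= => /andP[_ /eqP x0]; rewrite -(lie_inversionK x) x0 linear0.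
Qed.

Lemma lie_inversion_image_eq D D' : \dim D = \dim D' ->
  (forall x, x \in D -> (s_ x) \in D') -> lie_inversion_image b D = D'.
Proof.
move=> dD h; apply/eqP; rewrite eqEdim lie_inversion_dim dD leqnn andbT.
by apply/subvP => x; rewrite mem_lie_inversion_image => /h; rewrite lie_inversionK.
Qed.

Lemma lie_inversion_signature21 D : signature21 D -> signature21 (lie_inversion_image b D).
Proof.
move=> [e1 [e2 [e3 [-> [? ? ?] [? ? ?]]]]]; exists (s_ e1), (s_ e2), (s_ e3).
by rewrite lie_inversion_span !lform_inversion.
Qed.

Lemma lie_inversion_cyclide D1 D2 : dupin_cyclide D1 D2 ->
  dupin_cyclide (lie_inversion_image b D1) (lie_inversion_image b D2).
Proof.
move=> [h1 h2 h12 D12]; split; try exact: lie_inversion_signature21.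
  move=> x y; rewrite !mem_lie_inversion_image => xD yD.
  by rewrite -lform_inversion h12.
apply/eqP; rewrite eqEsubv subvf/=; apply/subvP => x _.
have : (s_ x) \in (D1 + D2)%VS by rewrite D12 memvf.
move=> /memv_addP[u uD [v vD xE]]; apply/memv_addP.
exists (s_ u); first by rewrite mem_lie_inversion_image2.
exists (s_ v); first by rewrite mem_lie_inversion_image2.
by rewrite -linearD/= -xE lie_inversionK.
Qed.
End Inversion.

(* A product of three reflections in vectors of a plane is again a reflection;
   its vector is the Clifford product [b * p * c], which has degree one. *)
Lemma lie_inversion3 a p b c : lform p p = -1 ->
  lform b b != 0 -> lform c c != 0 ->
  b \in <<[:: a; p]>>%VS -> c \in <<[:: a; p]>>%VS ->
  exists d, [/\ d \in <<[:: a; p]>>%VS, lform d d != 0 &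
    forall x, lie_inversion b (lie_inversion p (lie_inversion c x)) = lie_inversion d x].
Proof.
move=> pp bb cc /mem_span2P[b1 [b2 bE]] /mem_span2P[c1 [c2 cE]].
pose d := lform p c *: b + lform b p *: c - lform b c *: p.
(* Multiplicativity of the Clifford norm, the factor [lform p p] being -1. *)
have dd : lform d d = - (lform b b * lform c c).
  rewrite /d bE cE !lformE !(lformC p a) pp; ring.
exists d; split; last 1 first.
- move=> x; have dd0 : lform d d != 0 by rewrite dd oppr_eq0 mulf_neq0.
  have bb' := bb; have cc' := cc.
  move: dd0; rewrite /lie_inversion dd pp; rewrite /d bE cE in bb cc *.
  move: bb cc; rewrite !lformE !(lformC p a) pp => bb cc dd0.
  apply/rowP => l; rewrite !mxE.
  move: (lform x a) (lform x p) (lform a a) (lform a p) bb cc dd0 => xa xp aa ap bb cc dd0.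
  by field; rewrite bb cc.
- rewrite /d memvB ?memvD// memvZ// ?memv_span2r//.
  + by apply/mem_span2P; exists b1, b2.
  + by apply/mem_span2P; exists c1, c2.
- by rewrite dd oppr_eq0 mulf_neq0.
Qed.
End Cyclides.

(** * Smooth maps *)

Section DirectionalDerivatives.
Variable R : realType.
Implicit Types V W : normedModType R.

Section Line.
Variables (V W : normedModType R) (f : V -> W) (x v : V).

Let line_quot (s : R) :
  (fun h : R => h^-1 *: ((f \o shift (x + s *: v)) (h *: v) - f (x + s *: v))) =
  (fun h : R => h^-1 *: (((fun s => f (x + s *: v)) \o shift s) (h *: (1 : R))
     - f (x + s *: v))).
Proof.
apply/funext => h /=; congr (_ *: (f _ - _)).
by rewrite scalerDl [h *: (1 : R)]mulr1 addrCA.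
Qed.

Lemma derivable_line s : derivable f (x + s *: v) v <->
  derivable (fun s : R => f (x + s *: v)) s 1.
Proof. by rewrite /derivable line_quot. Qed.

Lemma derive_line s : 'D_v f (x + s *: v) = 'D_1 (fun s : R => f (x + s *: v)) s.
Proof. by rewrite /derive line_quot. Qed.

Lemma is_derive_line s d : is_derive (x + s *: v) v f d ->
  is_derive s 1 (fun s : R => f (x + s *: v)) d.
Proof.
by move=> [/derivable_line fd <-]; apply: DeriveDef => //; rewrite derive_line.
Qed.
End Line.

(** A directional derivative does not give differentiability of [f] on [V]. On the line [x + s *: v]
    both maps become functions of a real variable, where the two notions agree and the chain rule
    for differentials applies. *)
Lemma is_derive_comp1 V W (f : V -> R) (g : R -> W) x v (df : R) (dg : W) :
  is_derive x v f df -> is_derive (f x) 1 g dg ->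
  is_derive x v (fun y => g (f y)) (df *: dg).
Proof.
move=> fx gx; have xE : x + 0 *: v = x by rewrite scale0r addr0.
have {}fx : is_derive (0 : R) (1 : R) (fun s : R => f (x + s *: v)) df.
  by apply: is_derive_line; rewrite xE.
have dgx : differentiable g (f (x + 0 *: v)).
  by rewrite xE; apply/derivable1_diffP; case: gx.
have dfx : differentiable (fun s : R => f (x + s *: v)) 0.
  by apply/derivable1_diffP; case: fx.
have dgf : differentiable (g \o (fun s : R => f (x + s *: v))) 0.
  exact: differentiable_comp.
have := derivable_line (fun y => g (f y)) x v 0.
have := derive_line (fun y => g (f y)) x v 0; rewrite xE => dE [_ dd].
apply: DeriveDef; first by apply/dd/derivable1_diffP.
rewrite dE (deriveE _ dgf) diff_comp//= -(deriveE _ dfx) xE.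
rewrite xE in dgx; case: fx => _ ->; case: gx => _ <-.
rewrite (deriveE _ dgx) -[X in 'd g _ X = _](mulr1 df) -[df * 1]/(df *: (1 : R)).
by rewrite linearZ.
Qed.

Section Rules.
Variables (V W : normedModType R) (x v : V).

Lemma is_derive_ext (f g : V -> W) (d d' : W) :
  f =1 g -> d = d' -> is_derive x v f d -> is_derive x v g d'.
Proof. by move=> /funext-> ->. Qed.

Lemma der_cst (c : W) : is_derive x v (fun=> c) 0.
Proof. exact: is_derive_cst. Qed.

Lemma der_add (f g : V -> W) df dg : is_derive x v f df -> is_derive x v g dg ->
  is_derive x v (fun y => f y + g y) (df + dg).
Proof. exact: is_deriveD. Qed.

Lemma der_sub (f g : V -> W) df dg : is_derive x v f df -> is_derive x v g dg ->
  is_derive x v (fun y => f y - g y) (df - dg).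
Proof. exact: is_deriveB. Qed.

Lemma der_mul (f g : V -> R) df dg : is_derive x v f df -> is_derive x v g dg ->
  is_derive x v (fun y => f y * g y) (df * g x + f x * dg).
Proof.
move=> fx gx; apply: is_derive_eq (@is_deriveM _ _ f g x v df dg fx gx) _.
by rewrite addrC; congr (_ + _); rewrite [LHS]mulrC.
Qed.
End Rules.

Section Coordinates.
Variables (V : normedModType R) (m n : nat) (x v : V).

Lemma is_derive_mxP (M : V -> 'M[R]_(m, n)) (d : 'M[R]_(m, n)) :
  is_derive x v M d <-> forall i j, is_derive x v (fun y => M y i j) (d i j).
Proof.
split=> [[Md <-] i j|h].
  by apply: DeriveDef; [exact: (derivable_mxP _ _ _).1|rewrite derive_mx// mxE].
have Md : derivable M x v by apply/derivable_mxP => i j; case: (h i j).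
apply: DeriveDef => //; rewrite derive_mx//; apply/matrixP => i j; rewrite mxE.
by case: (h i j).
Qed.

Lemma der_scale (c : V -> R) (M : V -> 'M[R]_(m, n)) dc dM :
  is_derive x v c dc -> is_derive x v M dM ->
  is_derive x v (fun y => c y *: M y) (dc *: M x + c x *: dM).
Proof.
move=> cx /is_derive_mxP Mx; apply/is_derive_mxP => i j.
apply: is_derive_ext (der_mul cx (Mx i j)) => [y|]; first by rewrite mxE.
by rewrite !mxE.
Qed.
End Coordinates.

Lemma der_lform V (f g : V -> 'rV[R]_6) x v df dg :
  is_derive x v f df -> is_derive x v g dg ->
  is_derive x v (fun y => lform (f y) (g y)) (lform df (g x) + lform (f x) dg).
Proof.
move=> /is_derive_mxP fx /is_derive_mxP gx.
have h (i : 'I_6) : is_derive x v (fun y => (if (i < 4)%N then 1 else -1) * f y 0 i * g y 0 i)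
    ((if (i < 4)%N then 1 else -1) * df 0 i * g x 0 i +
     (if (i < 4)%N then 1 else -1) * f x 0 i * dg 0 i).
  apply: is_derive_ext (der_mul (der_mul (der_cst _ _ _) (fx 0 i)) (gx 0 i)) => //.
  by rewrite mul0r add0r.
apply: is_derive_ext (@is_derive_sum _ _ _ 6 _ _ _ _ h) => [y|].
  by rewrite fct_sumE.
by rewrite big_split.
Qed.

Lemma der_coord m n (x v : 'M[R]_(m, n)) i j : is_derive x v (fun y => y i j) (v i j).
Proof. by have /is_derive_mxP := is_derive_id x v. Qed.
End DirectionalDerivatives.

Section SmoothFunctions.
Variable R : realType.
Implicit Types V W : normedModType R.

Lemma smooth_on_continuous V W U (f : V -> W) t : smooth_on U f -> U t ->
  {for t, continuous f}.
Proof. by move=> /(_ [::] t) h /h[]. Qed.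

Lemma smooth_on_derivable V W U (f : V -> W) t v : smooth_on U f -> U t ->
  is_derive t v f ('D_v f t).
Proof. by move=> /(_ [::] t) h /h[_ /(_ v)] fd; exact: derivableP. Qed.

Lemma smooth_on_derive V W U (f : V -> W) v : smooth_on U f -> smooth_on U ('D_v f).
Proof. by move=> h vs t /(h (rcons vs v)); rewrite /iter_derive foldr_rcons. Qed.

Lemma smooth_on_sub V W U U' (f : V -> W) : U' `<=` U -> smooth_on U f -> smooth_on U' f.
Proof. by move=> UU h vs t /UU/h. Qed.

Section Coinduction.
Variables (V W : normedModType R) (U : set V).
Hypothesis Uo : open U.

Let near_U t : U t -> \forall s \near t, U s.
Proof. by move=> Ut; apply: open_nbhs_nbhs. Qed.

Lemma derive_eq_on (f g : V -> W) v t : (forall t, U t -> f t = g t) -> U t ->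
  'D_v f t = 'D_v g t.
Proof.
by move=> fg Ut; apply: near_eq_derive; near=> s; apply: fg; near: s; exact: near_U.
Unshelve. all: by end_near. Qed.

Lemma continuous_eq_on (f g : V -> W) t : (forall t, U t -> f t = g t) -> U t ->
  {for t, continuous f} -> {for t, continuous g}.
Proof.
move=> fg Ut fc; rewrite /prop_for /continuous_at -(fg _ Ut).
apply: cvg_trans fc; apply: near_eq_cvg.
by near=> s; apply: fg; near: s; exact: near_U.
Unshelve. all: by end_near. Qed.

Lemma derivable_eq_on (f g : V -> W) v t : (forall t, U t -> f t = g t) -> U t ->
  derivable f t v -> derivable g t v.
Proof.
move=> fg Ut; apply: near_eq_derivable.
by near=> s; apply: fg; near: s; exact: near_U.
Unshelve. all: by end_near. Qed.

(** Smoothness by an invariant: [P] must be stable under directional derivatives. Equality with a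
    member of [P] is asked only on [U], which suffices because [U] is open and derivatives are
    local. *)
Lemma smooth_on_coind (P : (V -> W) -> Prop) :
  (forall f, P f -> forall t, U t ->
     {for t, continuous f} /\ forall v, derivable f t v) ->
  (forall f v, P f -> exists2 g, P g & forall t, U t -> 'D_v f t = g t) ->
  forall f, P f -> smooth_on U f.
Proof.
move=> P1 P2 f Pf vs.
have [g Pg fg] : exists2 g, P g & forall t, U t -> iter_derive vs f t = g t.
  elim: vs => [|v vs [g Pg fg]]; first by exists f.
  have [g' Pg' gg'] := P2 _ v Pg; exists g' => // t Ut.
  by rewrite /= (derive_eq_on v fg Ut) gg'.
have gf t : U t -> g t = iter_derive vs f t by move=> /fg.
move=> t Ut; have [gc gd] := P1 _ Pg _ Ut; split.
  exact: continuous_eq_on gf Ut gc.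
by move=> v; apply: derivable_eq_on gf Ut (gd v).
Qed.

Lemma smooth_on_ext (f g : V -> W) : (forall t, U t -> f t = g t) ->
  smooth_on U f -> smooth_on U g.
Proof.
move=> fg h; apply: (smooth_on_coind (P := fun g => exists2 f, smooth_on U f &
  forall t, U t -> f t = g t)); last by exists f.
  move=> {h fg} {}g [{}f h fg] t Ut; split.
    exact: continuous_eq_on fg Ut (smooth_on_continuous h Ut).
  by move=> v; apply: (derivable_eq_on fg Ut); case: (smooth_on_derivable v h Ut).
move=> {h fg} {}g v [{}f h fg]; exists ('D_v f).
  by exists ('D_v f); [exact: smooth_on_derive|].
by move=> t Ut; rewrite (derive_eq_on v fg Ut).
Qed.
End Coinduction.

Section Scalar.
Variables (V : normedModType R) (U : set V).
Hypothesis Uo : open U.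

(* The closure of the smooth functions under the field operations and square
   roots is stable under differentiation, hence consists of smooth functions. *)
Inductive smooth_closure : (V -> R) -> Prop :=
| sc_smooth f : smooth_on U f -> smooth_closure f
| sc_cst c : smooth_closure (fun=> c)
| sc_add f g : smooth_closure f -> smooth_closure g -> smooth_closure (fun t => f t + g t)
| sc_mul f g : smooth_closure f -> smooth_closure g -> smooth_closure (fun t => f t * g t)
| sc_inv f : (forall t, U t -> f t != 0) -> smooth_closure f ->
    smooth_closure (fun t => (f t)^-1)
| sc_sqrt f : (forall t, U t -> 0 < f t) -> smooth_closure f ->
    smooth_closure (fun t => Num.sqrt (f t)).

Let sc_continuous f : smooth_closure f -> forall t, U t -> {for t, continuous f}.
Proof.
elim=> {f} [f h t|c t _|f g _ hf _ hg t Ut|f g _ hf _ hg t Ut|f f0 _ hf t Ut|f f0 _ hf t Ut].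
- exact: smooth_on_continuous.
- exact: cst_continuous.
- exact: continuousD (hf t Ut) (hg t Ut).
- exact: continuousM (hf t Ut) (hg t Ut).
- exact: continuousV (f0 t Ut) (hf t Ut).
- by apply: continuous_comp; [exact: hf|exact: sqrt_continuous].
Qed.

Let sc_derive f : smooth_closure f -> forall v, exists2 g, smooth_closure g &
  forall t, U t -> is_derive t v f (g t).
Proof.
elim=> {f} [f h v|c v|f g _ hf _ hg v|f g sf hf sg hg v|f f0 sf hf v|f f0 sf hf v].
- exists ('D_v f); first by apply/sc_smooth/smooth_on_derive.
  by move=> t; exact: smooth_on_derivable.
- by exists (fun=> 0); [exact: sc_cst|move=> t _; exact: der_cst].
- have [f' sf' ff'] := hf v; have [g' sg' gg'] := hg v.
  exists (fun t => f' t + g' t); first exact: sc_add.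
  by move=> t Ut; apply: der_add; [exact: ff'|exact: gg'].
- have [f' sf' ff'] := hf v; have [g' sg' gg'] := hg v.
  exists (fun t => f' t * g t + f t * g' t); first by apply: sc_add; apply: sc_mul.
  by move=> t Ut; apply: der_mul; [exact: ff'|exact: gg'].
- have [f' sf' ff'] := hf v.
  exists (fun t => -1 * ((f t)^-1 * (f t)^-1) * f' t).
    by apply: sc_mul => //; apply: sc_mul; [exact: sc_cst|apply: sc_mul; exact: sc_inv].
  move=> t Ut; have [fd fD] := ff' t Ut; apply: DeriveDef.
    by apply: derivableV => //; exact: f0.
  rewrite deriveV//; last exact: f0.
  by rewrite fD mulN1r expr2 invfM.
- have [f' sf' ff'] := hf v.
  exists (fun t => f' t * (2^-1 * (Num.sqrt (f t))^-1)).
    apply: sc_mul => //; apply: sc_mul; first exact: sc_cst.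
    by apply: sc_inv; [move=> t /f0; rewrite -sqrtr_gt0; exact: lt0r_neq0|exact: sc_sqrt].
  move=> t Ut; have := is_derive_comp1 (ff' t Ut) (is_derive1_sqrt (f0 t Ut)).
  by rewrite invfM.
Qed.

Lemma smooth_closure_on f : smooth_closure f -> smooth_on U f.
Proof.
apply: (smooth_on_coind Uo (P := smooth_closure)) => {}f.
  move=> h t Ut; split; first exact: sc_continuous.
  by move=> v; have [g _ /(_ t Ut)[]] := sc_derive h v.
by move=> v h; have [g sg fg] := sc_derive h v; exists g => // t /fg[].
Qed.

Lemma smooth_cst c : smooth_on U (fun=> c : R).
Proof. exact/smooth_closure_on/sc_cst. Qed.

Lemma smooth_add (f g : V -> R) : smooth_on U f -> smooth_on U g ->
  smooth_on U (fun t => f t + g t).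
Proof. by move=> sf sg; apply/smooth_closure_on/sc_add; exact: sc_smooth. Qed.

Lemma smooth_mul (f g : V -> R) : smooth_on U f -> smooth_on U g ->
  smooth_on U (fun t => f t * g t).
Proof. by move=> sf sg; apply/smooth_closure_on/sc_mul; exact: sc_smooth. Qed.

Lemma smooth_sqrt (f : V -> R) : (forall t, U t -> 0 < f t) -> smooth_on U f ->
  smooth_on U (fun t => Num.sqrt (f t)).
Proof. by move=> f0 sf; apply/smooth_closure_on/sc_sqrt => //; exact: sc_smooth. Qed.

Lemma smooth_opp (f : V -> R) : smooth_on U f -> smooth_on U (fun t => - f t).
Proof.
move=> sf; have -> : (fun t => - f t) = (fun t => -1 * f t).
  by apply/funext => t; rewrite mulN1r.
exact: (smooth_mul (smooth_cst (-1)) sf).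
Qed.

Lemma smooth_sub (f g : V -> R) : smooth_on U f -> smooth_on U g ->
  smooth_on U (fun t => f t - g t).
Proof. by move=> sf sg; exact: (smooth_add sf (smooth_opp sg)). Qed.

Lemma smooth_sum n (f : 'I_n -> V -> R) : (forall i, smooth_on U (f i)) ->
  smooth_on U (fun t => \sum_i f i t).
Proof.
elim: n f => [|n IH] f sf.
  by under eq_fun do rewrite big_ord0; exact: smooth_cst.
under eq_fun do rewrite big_ord_recl.
by apply: (smooth_add (sf ord0)); apply: IH => i; exact: sf.
Qed.

Section Vector.
Variable n : nat.
Implicit Types f g : V -> 'rV[R]_n.

Lemma continuous_rV f t : (forall j, {for t, continuous (fun s => f s 0 j)}) ->
  {for t, continuous f}.
Proof.
move=> h; apply/cvgrPdist_le => /= e e0; near=> s.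
rewrite /Num.Def.normr/= mx_normrE (bigmax_le _ (ltW e0))//= => -[i j] _.
rewrite !mxE/= (ord1 i); move: j {i}; near: s; apply: filter_forall => j.
by have /cvgrPdist_le := h j; apply.
Unshelve. all: by end_near. Qed.

Lemma smooth_coord f j : smooth_on U f -> smooth_on U (fun t => f t 0 j).
Proof.
move=> sf; pose P (g : V -> R) := exists2 f : V -> 'rV[R]_n,
    smooth_on U f & forall t, U t -> g t = f t 0 j.
apply: (@smooth_on_coind V R U Uo P); last by exists f.
  move=> {sf f} g [f sf gf] t Ut; have fg s : U s -> f s 0 j = g s by move=> /gf.
  split.
    apply: (continuous_eq_on Uo fg Ut).
    exact: (continuous_comp (smooth_on_continuous sf Ut) (@coord_continuous _ _ _ _ _ _)).
  move=> v; apply: (derivable_eq_on Uo fg Ut).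
  by have /is_derive_mxP/(_ 0 j)[] := smooth_on_derivable v sf Ut.
move=> {sf f} g v [f sf gf]; exists (fun t => 'D_v f t 0 j).
  by exists ('D_v f); [exact: smooth_on_derive|].
move=> t Ut; rewrite (derive_eq_on Uo v gf Ut).
by have /is_derive_mxP/(_ 0 j)[] := smooth_on_derivable v sf Ut.
Qed.

Lemma smooth_rV f : (forall j, smooth_on U (fun t => f t 0 j)) -> smooth_on U f.
Proof.
pose P f := forall j, smooth_on U (fun t => f t 0 j).
apply: (@smooth_on_coind V 'rV[R]_n U Uo P).
  move=> {}f sf t Ut; split.
    by apply: continuous_rV => j; exact: smooth_on_continuous (sf j) Ut.
  by move=> v; apply/derivable_mxP => i j; rewrite (ord1 i);
    case: (smooth_on_derivable v (sf j) Ut).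
move=> {}f v sf; exists ('D_v f); [move=> j|by []].
apply: (@smooth_on_ext _ _ _ Uo ('D_v (fun t => f t 0 j))); last exact: smooth_on_derive.
move=> t Ut; have /derivable_mxP fd : forall i j, derivable (fun t => f t i j) t v.
  by move=> i k; rewrite (ord1 i); case: (smooth_on_derivable v (sf k) Ut).
by rewrite derive_mx// mxE.
Qed.

Lemma smooth_vcst (c : 'rV[R]_n) : smooth_on U (fun=> c).
Proof. by apply: smooth_rV => j; exact: smooth_cst. Qed.

Lemma smooth_vadd f g : smooth_on U f -> smooth_on U g -> smooth_on U (fun t => f t + g t).
Proof.
move=> sf sg; apply: smooth_rV => j; under eq_fun do rewrite mxE.
by apply: smooth_add; exact: smooth_coord.
Qed.

Lemma smooth_scale (c : V -> R) f : smooth_on U c -> smooth_on U f ->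
  smooth_on U (fun t => c t *: f t).
Proof.
move=> sc sf; apply: smooth_rV => j; under eq_fun do rewrite mxE.
exact: (smooth_mul sc (smooth_coord j sf)).
Qed.

Lemma smooth_vsub f g : smooth_on U f -> smooth_on U g -> smooth_on U (fun t => f t - g t).
Proof.
move=> sf sg; apply: smooth_rV => j; under eq_fun do rewrite !mxE.
by apply: smooth_sub; exact: smooth_coord.
Qed.
End Vector.

Lemma smooth_lform (f g : V -> 'rV[R]_6) : smooth_on U f -> smooth_on U g ->
  smooth_on U (fun t => lform (f t) (g t)).
Proof.
move=> sf sg; apply: smooth_sum => i; apply: smooth_mul; last exact: smooth_coord.
by apply: smooth_mul; [exact: smooth_cst|exact: smooth_coord].
Qed.
End Scalar.

Section Boxes.
Variables lo hi : 'rV[R]_3.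
Local Notation B := (box lo hi).

Lemma near_box t : B t -> \forall s \near t, B s.
Proof.
move=> Bt; near=> s => i; move: i; near: s; apply: filter_forall => i.
have := @coord_continuous R 1 3 0 i t.
move=> /(_ [set u | lo 0 i < u < hi 0 i]); apply.
rewrite (_ : [set u | _] = `]lo 0 i, hi 0 i[%classic); last by apply/seteqP; split=> u /=; rewrite in_itv.
by apply: near_in_itvoo; rewrite in_itv/=; exact: Bt.
Unshelve. all: by end_near. Qed.

Lemma box_open : open B.
Proof. by rewrite openE => t /near_box. Qed.

(** The invariant class consists of scalar multiples of pullbacks: differentiating along [v]
    replaces [c] by its derivative and multiplies the scalar by [v 0 i]. *)
Lemma smooth_pullback W (c : R -> W) i :
  smooth_on `]lo 0 i, hi 0 i[ c -> smooth_on B (fun t => c (t 0 i)).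
Proof.
move=> sc; have oI := box_open; have Bi t : B t -> `]lo 0 i, hi 0 i[%classic (t 0 i).
  by move=> /(_ i); rewrite /= in_itv.
pose P (g : 'rV[R]_3 -> W) := exists k (c : R -> W),
    smooth_on `]lo 0 i, hi 0 i[ c /\ g = fun t => k *: c (t 0 i).
apply: (@smooth_on_coind _ W B oI P); last first.
  by exists 1, c; split=> //; apply/funext => t; rewrite scale1r.
- move=> {sc c} g v [k [c [sc ->]]].
  exists (fun t : 'rV[R]_3 => (k * v 0 i) *: 'D_1 c (t 0 i)).
    by exists (k * v 0 i), ('D_1 c); split; first exact: smooth_on_derive.
  move=> t /Bi ti; have cd := smooth_on_derivable (1 : R) sc ti.
  have := is_derive_comp1 (der_coord t v 0 i) cd.
  move=> [h1 h2]; rewrite deriveZ//= h2 scalerA//.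
- move=> {sc c} g [k [c [sc ->]]] t /Bi ti; split.
    apply: continuousZr.
    exact: (continuous_comp (@coord_continuous _ _ _ _ _ _) (smooth_on_continuous sc ti)).
  move=> v; have := is_derive_comp1 (der_coord t v 0 i) (smooth_on_derivable (1 : R) sc ti).
  by move=> [h1 _]; apply: derivableZ.
Qed.

Lemma der_pullback W (c : R -> W) i t v : smooth_on `]lo 0 i, hi 0 i[ c -> B t ->
  is_derive t v (fun t : 'rV[R]_3 => c (t 0 i)) (v 0 i *: 'D_1 c (t 0 i)).
Proof.
move=> sc /(_ i) ti; apply: is_derive_comp1; first exact: der_coord.
by apply: smooth_on_derivable sc _; rewrite /= in_itv.
Qed.
End Boxes.
End SmoothFunctions.

(* Otherwise unification compares distinct derivatives or forms by unfolding them. *)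
Opaque smooth_on derive lform.

Section SubspaceDerivatives.
Variable R : realType.
Implicit Types V : normedModType R.

Lemma row_linear_sum n m (L : {linear 'rV[R]_n -> 'rV[R]_m}) (u : 'rV[R]_n) :
  L u = \sum_j u 0 j *: L (delta_mx 0 j).
Proof. by rewrite {1}(row_sum_delta u) linear_sum; apply: eq_bigr => j _; rewrite linearZ. Qed.

Lemma der_linear V n m (L : {linear 'rV[R]_n -> 'rV[R]_m}) (f : V -> 'rV[R]_n) x v d :
  is_derive x v f d -> is_derive x v (fun y => L (f y)) (L d).
Proof.
move=> /is_derive_mxP fx.
have h j : is_derive x v (fun y => f y 0 j *: L (delta_mx 0 j)) (d 0 j *: L (delta_mx 0 j)).
  apply: is_derive_ext (der_scale (fx 0 j) (der_cst x v (L (delta_mx 0 j)))) => //.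
  by rewrite scaler0 addr0.
apply: is_derive_ext (@is_derive_sum _ _ _ n _ _ _ _ h) => [y|].
  by rewrite fct_sumE [RHS]row_linear_sum.
by rewrite [RHS]row_linear_sum.
Qed.

Lemma derive_near0 V (W : normedModType R) (f : V -> W) x v d :
  (\forall y \near x, f y = 0) -> is_derive x v f d -> d = 0.
Proof.
move=> f0 [_ <-]; rewrite (_ : 0 = 'D_v (cst 0 : V -> W) x); last by rewrite derive_cst.
exact: near_eq_derive.
Qed.

(** The defect [f - projv U f] depends linearly on [f] and vanishes near [x], hence so does its
    derivative. *)
Lemma derive_mem V n (U : {vspace 'rV[R]_n}) (f : V -> 'rV[R]_n) x v d :
  is_derive x v f d -> (\forall y \near x, f y \in U) -> d \in U.
Proof.
move=> fx fU; have dx := der_sub fx (der_linear (projv U) fx).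
suff /eqP : d - projv U d = 0 by rewrite subr_eq0 => /eqP ->; exact: memv_proj.
apply: derive_near0 dx; near=> y; have yU : f y \in U by near: y.
by apply/eqP; rewrite subr_eq0; apply/eqP/esym/projv_id.
Unshelve. all: by end_near. Qed.

Lemma row_coord_neq0 n (u : 'rV[R]_n) : u != 0 -> exists j, u 0 j != 0.
Proof. by move=> /rV0Pn. Qed.

Lemma line_minors n (u w : 'rV[R]_n) j k : u \in <[w]>%VS -> u 0 j * w 0 k = u 0 k * w 0 j.
Proof. by move=> /vlineP[c ->]; rewrite !mxE mulrAC. Qed.

Lemma minors_line n (u w : 'rV[R]_n) j : w 0 j != 0 ->
  (forall k, u 0 j * w 0 k = u 0 k * w 0 j) -> u \in <[w]>%VS.
Proof.
move=> wj h; apply/vlineP; exists (u 0 j / w 0 j); apply/rowP => k.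
by rewrite mxE mulrAC h mulfK.
Qed.

(** The proportionality factor between [f] and [g] is not known to be differentiable, so the
    vanishing 2x2 minors are differentiated instead and solved for [df] by means of a nonzero
    coordinate of [g]. *)
Lemma derive_line_mem V n (f g : V -> 'rV[R]_n) x v df dg :
  is_derive x v f df -> is_derive x v g dg -> g x != 0 ->
  (\forall y \near x, f y \in <[g y]>%VS) -> df \in <<[:: g x; dg]>>%VS.
Proof.
move=> fx gx g0 fg; have [j gj] := row_coord_neq0 g0.
have /vlineP[c fc] : f x \in <[g x]>%VS by exact: nbhs_singleton fg.
have h k : df 0 j * g x 0 k + f x 0 j * dg 0 k = df 0 k * g x 0 j + f x 0 k * dg 0 j.
  have /is_derive_mxP fx' := fx; have /is_derive_mxP gx' := gx.
  have := der_sub (der_mul (fx' 0 j) (gx' 0 k)) (der_mul (fx' 0 k) (gx' 0 j)).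
  move=> /derive_near0 H; apply/eqP; rewrite -subr_eq0; apply/eqP/H.
  near=> y; apply/eqP; rewrite subr_eq0; apply/eqP/line_minors; by near: y.
apply/mem_span2P; exists ((df 0 j - c * dg 0 j) / g x 0 j), c; apply/rowP => k.
apply: (mulIf gj); rewrite !mxE mulrDl mulrAC divfK//.
by have := h k; rewrite fc !mxE => hk; lra.
Unshelve. all: by end_near. Qed.
End SubspaceDerivatives.

Section Update.
Variable R : realType.
Implicit Types (t : 'rV[R]_3) (i j : 'I_3).

(** Written as a displacement along a basis vector, so that derivatives along the coordinate line
    reduce to partial derivatives. *)
Definition upd t i (u : R) := t + (u - t 0 i) *: delta_mx 0 i.

Lemma updE t i u j : upd t i u 0 j = if j == i then u else t 0 j.
Proof.
rewrite /upd !mxE eqxx/=; case: eqVneq => [->|_]; first by rewrite mulr1 subrKC.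
by rewrite mulr0 addr0.
Qed.

Lemma upd_id t i : upd t i (t 0 i) = t.
Proof. by rewrite /upd subrr scale0r addr0. Qed.

Lemma upd_box lo hi t i u : box lo hi t -> lo 0 i < u < hi 0 i -> box lo hi (upd t i u).
Proof. by move=> Bt ui j; rewrite updE; case: eqVneq => [->|]. Qed.

Lemma upd_line t t' i : (forall j, j != i -> t' 0 j = t 0 j) -> t' = upd t i (t' 0 i).
Proof. by move=> h; apply/rowP => j; rewrite updE; case: eqVneq => [->|/h]. Qed.

Lemma is_derive_upd (W : normedModType R) (f : 'rV[R]_3 -> W) t i u d :
  is_derive (upd t i u) (delta_mx 0 i) f d -> is_derive u 1 (fun u => f (upd t i u)) d.
Proof.
move=> fd; have e (s : R) : upd t i s = (t - t 0 i *: delta_mx 0 i) + s *: delta_mx 0 i.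
  by rewrite /upd; apply/rowP => j; rewrite !mxE; ring.
under eq_fun do rewrite e; apply: is_derive_line.
by rewrite -e.
Qed.

Lemma near_upd lo hi t i : box lo hi t ->
  \forall u \near t 0 i, box lo hi (upd t i u).
Proof.
move=> Bt; near=> u; apply: upd_box => //.
rewrite -[_ && _]/(u \in `]lo 0 i, hi 0 i[) //; near: u.
apply: near_in_itvoo; rewrite in_itv/=; exact: Bt.
Unshelve. all: by end_near. Qed.

Lemma continuous_upd (W : normedModType R) (f : 'rV[R]_3 -> W) t i u :
  {for upd t i u, continuous f} -> {for u, continuous (fun u => f (upd t i u))}.
Proof.
move=> fc; apply: (@continuous_comp _ _ _ (upd t i) f) => //.
apply: continuousD; first exact: cst_continuous.
apply: continuousZl; apply: continuousB; first exact: cvg_id.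
exact: cst_continuous.
Qed.
End Update.

(** * Orthogonal coordinates *)

Section OrthogonalCoordinates.
Variable R : realType.
Local Notation vec := 'rV[R]_6.
Local Notation par := 'rV[R]_3.
Variables (p : vec) (lo hi : par).
Local Notation B := (box lo hi).

Lemma near_lform0 (f g : par -> vec) t v : smooth_on B f -> smooth_on B g -> B t ->
  (\forall s \near t, lform (f s) (g s) = 0) ->
  lform ('D_v f t) (g t) + lform (f t) ('D_v g t) = 0.
Proof.
move=> sf sg Bt h; apply: (derive_near0 h).
exact: der_lform (smooth_on_derivable v sf Bt) (smooth_on_derivable v sg Bt).
Qed.

Lemma lform0_derive (f g : par -> vec) t v : smooth_on B f -> smooth_on B g -> B t ->
  (forall s, B s -> lform (f s) (g s) = 0) ->
  lform ('D_v f t) (g t) + lform (f t) ('D_v g t) = 0.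
Proof.
move=> sf sg Bt h; apply: (near_lform0 v sf sg Bt); near=> s; apply: h.
by near: s; exact: near_box.
Unshelve. all: by end_near. Qed.

Lemma lformp0_derive (f : par -> vec) t v : smooth_on B f -> B t ->
  (forall s, B s -> lform (f s) p = 0) -> lform ('D_v f t) p = 0.
Proof.
move=> sf Bt h; have := lform0_derive v sf (smooth_vcst (box_open (hi:=hi)) p) Bt h.
by rewrite derive_cst lform0r addr0.
Qed.

Lemma null_derive (f : par -> vec) t v : smooth_on B f -> B t ->
  (forall s, B s -> lform (f s) (f s) = 0) -> lform (f t) ('D_v f t) = 0.
Proof.
by move=> sf Bt h; have := lform0_derive v sf sf Bt h; rewrite lformC => h2; lra.
Qed.

Hypothesis pp : lform p p = -1.

Let pp0 : lform p p < 0. Proof. by rewrite pp ltrN10. Qed.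

Variable X : par -> vec.
Hypothesis sX : smooth_on B X.
Hypothesis X_null : forall t, B t -> lform (X t) (X t) = 0.
Hypothesis X_p : forall t, B t -> lform (X t) p = 0.
Local Notation d i := (partial i X).

Lemma point_map_d t i : B t -> lform (X t) (d i t) = 0 /\ lform (d i t) p = 0.
Proof. by move=> Bt; split; [exact: null_derive|exact: lformp0_derive]. Qed.

Lemma point_map_frame t : B t -> X t != 0 ->
  (forall i j, i != j -> lform (d i t) (d j t) = 0) ->
  (forall i, d i t \notin <[X t]>%VS) -> orth_frame p (X t) (fun i => d i t).
Proof.
move=> Bt X0 dd dX; split=> //; [by rewrite X_null ?X_p|by move=> i; exact: point_map_d|].
move=> i; rewrite ltNge; apply: contra (dX i) => dn.
have [? ?] := point_map_d i Bt.
by apply: (timelike_perp_line pp0); rewrite ?X_null ?X_p.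
Qed.

Section System.
Hypothesis lohi : forall i, lo 0 i < hi 0 i.
Variable G : 'I_3 -> par -> R.
Hypothesis sG : forall i, smooth_on B (G i).
Hypothesis frame : forall t, B t -> orth_frame p (X t) (fun i => d i t).
Hypothesis GE : forall i t, B t -> G i t ^+ 2 = lform (d i t) (d i t).

Let n i t : vec := d i t + G i t *: p.

(** The spacelike vector [d i t] is an unoriented sphere through the point with the i-th direction
    as normal; a root [G i t] of its square makes [d i t + G i t *: p] null, that is, orients it.
    The sign of the root is the orientation. *)
Definition coordinate_system i t : {vspace vec} := <<[:: X t; n i t]>>%VS.

Let sn i : smooth_on B (n i).
Proof.
apply: (smooth_vadd (@box_open _ _ _)); first exact: smooth_on_derive.
exact: (smooth_scale (@box_open _ _ _) (sG i) (smooth_vcst (@box_open _ _ _) p)).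
Qed.

Let nn i t : B t -> lform (n i t) (n i t) = 0.
Proof.
move=> Bt; have [_ dp] := point_map_d i Bt.
by rewrite /n !lformE (lformC p) dp pp -GE//; ring.
Qed.

Let Xn i t : B t -> lform (X t) (n i t) = 0.
Proof. by move=> Bt; have [Xd _] := point_map_d i Bt; rewrite /n !lformE Xd X_p// mulr0 addr0. Qed.

Let nd i j t : B t -> j != i -> lform (n i t) (d j t) = 0.
Proof.
move=> Bt ji; have [_ _ _ dd _] := frame Bt; have [_ dp] := point_map_d j Bt.
by rewrite /n !lformE dd 1?eq_sym// (lformC p) dp mulr0 addr0.
Qed.

Let G0 i t : B t -> G i t != 0.
Proof.
by move=> Bt; have [_ _ _ _ dp] := frame Bt; rewrite -sqrf_eq0 GE// gt_eqF// dp.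
Qed.

Lemma coordinate_system_contact i t : B t -> contact_element (coordinate_system i t).
Proof.
move=> Bt; have [X0 _ _ _ dp] := frame Bt.
apply: null_pair_contact; rewrite ?X_null ?nn ?Xn//.
apply/negP => /vlineP[c nE]; have := congr1 (lform p) nE; rewrite /n !lformE pp.
have [_ h] := point_map_d i Bt; rewrite !(lformC p) h X_p// mulr0 add0r => /eqP.
by rewrite mulrN1 oppr_eq0 (negbTE (G0 i Bt)).
Qed.

Lemma coordinate_system_points i t x : B t -> x \in coordinate_system i t ->
  lform x p = 0 -> x \in <[X t]>%VS.
Proof.
move=> Bt /mem_span2P[a [b ->]]; rewrite /n !lformE X_p// pp.
have [_ ->] := point_map_d i Bt; rewrite mulr0 !add0r mulrN1 => /eqP.
rewrite mulrN oppr_eq0 mulf_eq0 (negbTE (G0 i Bt)) orbF => /eqP->.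
by rewrite scale0r addr0 memvZ ?memv_line.
Qed.

(** The two sections are arbitrary. [S1] is expanded in the frame at the single point [t], and the
    derivative is moved from [S2] to the frame, whose tangential derivatives are orthogonal to the
    contact element. *)
Lemma coordinate_system_legendre i : legendre_family lo hi i (coordinate_system i).
Proof.
split.
  split; first by move=> t; exact: coordinate_system_contact.
  by exists X, (n i); split; [exact: sX|exact: sn|].
move=> S1 S2 [sS1 S1E] [sS2 S2E] j t ji Bt.
have XS : forall s, B s -> lform (X s) (S2 s) = 0.
  by move=> s Bs; apply: lform_spanr (S2E s Bs); rewrite ?X_null ?Xn.
have nS : forall s, B s -> lform (n i s) (S2 s) = 0.
  by move=> s Bs; apply: lform_spanr (S2E s Bs); rewrite 1?lformC ?nn ?Xn.
have dS : lform (d j t) (S2 t) = 0.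
  by apply: lform_spanr (S2E t Bt); rewrite lformC ?nd//; case: (point_map_d j Bt).
have XdS : lform (X t) (partial j S2 t) = 0.
  have := lform0_derive (delta_mx 0 j) sX sS2 Bt XS.
  by rewrite -/(partial j X) dS add0r.
have dnX : lform ('D_(delta_mx 0 j) (n i) t) (X t) = 0.
  have := lform0_derive (delta_mx 0 j) sX (sn i) Bt (fun s Bs => Xn i Bs).
  by rewrite -/(partial j X) (lformC (d j t)) nd// add0r lformC.
have dnS : lform ('D_(delta_mx 0 j) (n i) t) (S2 t) = 0.
  apply: lform_spanr (S2E t Bt) => //; rewrite lformC.
  exact: (null_derive _ (sn i) Bt (fun s Bs => nn i Bs)).
have ndS : lform (n i t) (partial j S2 t) = 0.
  by have := lform0_derive (delta_mx 0 j) (sn i) sS2 Bt nS; rewrite dnS add0r.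
by rewrite lformC; apply: lform_spanr (S1E t Bt); rewrite lformC.
Qed.

Lemma coordinate_system_orthogonal i j t s1 s2 : i != j -> B t ->
  s1 \in coordinate_system i t -> s2 \in coordinate_system j t ->
  orthogonal_spheres p s1 s2.
Proof.
move=> ij Bt /mem_span2P[a [b ->]] /mem_span2P[a' [b' ->]]; rewrite /orthogonal_spheres /n.
have [_ _ _ dd _] := frame Bt; have [Xi ip] := point_map_d i Bt.
have [Xj jp] := point_map_d j Bt.
move: Xi Xj ip jp (dd _ _ ij) (X_null Bt) (X_p Bt).
move: (X t) (d i t) (d j t) (G i t) (G j t) => x u w g h Xi Xj ip jp uw xx xp.
by rewrite !lformE !(lformC p) !(lformC _ x) xx xp Xi Xj ip jp uw pp; ring.
Qed.

Lemma point_map_immersion : point_immersion p lo hi X.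
Proof.
split; first exact: sX.
by move=> t Bt; split; [exact: X_null|exact: X_p|exact: orth_frame_free (frame Bt)].
Qed.

Lemma coordinate_system_triply_orthogonal :
  triply_orthogonal_system p lo hi coordinate_system.
Proof.
split=> //; first by exact: coordinate_system_legendre.
- by exists X; [exact: point_map_immersion|move=> i t _; exact: memv_span2l].
- by move=> i j t ij Bt s1 s2; exact: coordinate_system_orthogonal.
Qed.
End System.
End OrthogonalCoordinates.

(** * Circular arcs and null curves *)

Section Circles.
Variable R : realType.
Local Notation vec := 'rV[R]_6.
Local Notation par := 'rV[R]_3.

(** Differentiating [lform x x = 0] twice along a null curve gives exactly these relations between
    position, velocity and acceleration. The space splits into the spacelike velocity and a
    hyperbolic plane. *)
Lemma osculating_signature21 (x y z : vec) : lform x x = 0 -> lform x y = 0 ->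
  0 < lform y y -> lform x z = - lform y y -> signature21 <<[:: x; y; z]>>%VS.
Proof.
move=> xx xy yy xz; have g0 := lt0r_neq0 yy.
pose g := lform y y; pose k := Num.sqrt g; pose m := Num.sqrt (2 * g).
have kk : k * k = g by rewrite -expr2 sqr_sqrtr// ltW.
have mm : m * m = 2 * g by rewrite -expr2 sqr_sqrtr// mulr_ge0// ltW.
have k0 : k != 0 by rewrite gt_eqF// sqrtr_gt0.
have m0 : m != 0 by rewrite gt_eqF// sqrtr_gt0 mulr_gt0.
(* [z1] drops the component along [y], and [z2] then loses its own square by a multiple of [x]. The
   null vectors [x] and [z2] have product [-g], so their difference and sum have squares [2 * g] and
   [- (2 * g)], whence [m]. *)
pose z1 := z - (lform z y / g) *: y.
pose z2 := z1 + (lform z1 z1 / (2 * g)) *: x.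
have xz1 : lform x z1 = - g by rewrite /z1 !lformE xz xy mulr0 subr0.
have yz1 : lform y z1 = 0 by rewrite /z1 !lformE (lformC y z) divfK ?subrr.
have z1E : z = z1 + (lform z y / g) *: y by rewrite subrK.
clearbody z1; have xz2 : lform x z2 = - g by rewrite /z2 !lformE xz1 xx mulr0 addr0.
have yz2 : lform y z2 = 0 by rewrite /z2 !lformE yz1 (lformC y) xy mulr0 addr0.
have z2z2 : lform z2 z2 = 0.
  rewrite /z2 !lformE (lformC z1 x) xz1 xx; move: (lform z1 z1) => w.
  by field.
have z2E : z1 = z2 - (lform z1 z1 / (2 * g)) *: x by rewrite addrK.
clearbody z2; have mem v : v \in <<[:: x; y; z]>>%VS ->
   v \in <<[:: k^-1 *: y; m^-1 *: (x - z2); m^-1 *: (x + z2)]>>%VS.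
  move=> /mem_span3P[a [b [c ->]]].
  have zE : z = z2 - (lform z1 z1 / (2 * g)) *: x + (lform z y / g) *: y.
    by rewrite -z2E -z1E.
  have xE : x = (m / 2) *: (m^-1 *: (x - z2)) + (m / 2) *: (m^-1 *: (x + z2)).
    by apply/rowP => j; rewrite !mxE; field.
  have z2E' : z2 = - (m / 2) *: (m^-1 *: (x - z2)) + (m / 2) *: (m^-1 *: (x + z2)).
    by apply/rowP => j; rewrite !mxE; field.
  have yE : y = k *: (k^-1 *: y) by rewrite scalerA mulfV// scale1r.
  set U := span _; have xU : x \in U.
    by rewrite xE; apply: memvD; apply: memvZ; apply: memv_span; rewrite !inE eqxx ?orbT.
  have z2U : z2 \in U.
    by rewrite z2E'; apply: memvD; apply: memvZ; apply: memv_span; rewrite !inE eqxx ?orbT.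
  have yU : y \in U by rewrite yE; apply: memvZ; apply: memv_span; rewrite !inE eqxx.
  by rewrite memvD ?memvZ// ?memvD ?memvZ// zE memvD ?memvB ?memvZ.
have {}mem : <<[:: x; y; z]>>%VS =
    <<[:: k^-1 *: y; m^-1 *: (x - z2); m^-1 *: (x + z2)]>>%VS.
  apply/eqP; rewrite eqEsubv; apply/andP; split; first by apply/subvP.
  have xU : x \in <<[:: x; y; z]>>%VS by rewrite memv_span ?inE ?eqxx.
  have yU : y \in <<[:: x; y; z]>>%VS by rewrite memv_span ?inE ?eqxx ?orbT.
  have zU : z \in <<[:: x; y; z]>>%VS by rewrite memv_span ?inE ?eqxx ?orbT.
  have z2U : z2 \in <<[:: x; y; z]>>%VS.
    have -> : z2 = z - (lform z y / g) *: y + (lform z1 z1 / (2 * g)) *: x.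
      rewrite -[LHS](subrK ((lform z1 z1 / (2 * g)) *: x)) -z2E; congr (_ + _).
      by rewrite -[LHS](addrK ((lform z y / g) *: y)) -z1E.
    by rewrite memvD ?memvB ?memvZ.
  by rewrite span3_subv !memvZ//; [exact: memvD|exact: memvB].
rewrite mem; exists (k^-1 *: y), (m^-1 *: (x - z2)), (m^-1 *: (x + z2)).
have h : m^-1 * m^-1 * (2 * g) = 1 by rewrite -mm; field.
split=> //; split; rewrite !lformE ?(lformC z2 x) ?(lformC y x) ?xx ?xz2 ?yz2 ?z2z2 ?xy.
- by rewrite -/g -kk; field.
- by rewrite -[RHS]h; ring.
- by rewrite -[in RHS]h; ring.
- by ring.
- by ring.
- by ring.
Qed.

(* A curve of points contained in a 3-dimensional subspace is a circular arc:
   position, velocity and acceleration already span a (2,1)-space. *)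
Lemma curve_in_circle (p : vec) lo hi (X : par -> vec) t k (M : {vspace vec}) :
  lform p p = -1 -> smooth_on (box lo hi) X ->
  (forall t, box lo hi t -> lform (X t) (X t) = 0) ->
  (forall t, box lo hi t -> lform (X t) p = 0) ->
  box lo hi t -> 0 < lform (partial k X t) (partial k X t) ->
  (\dim M <= 3)%N -> (forall u, lo 0 k < u < hi 0 k -> X (upd t k u) \in M) ->
  exists2 C, circle p C & forall u, lo 0 k < u < hi 0 k -> X (upd t k u) \in C.
Proof.
move=> pp sX XX Xp Bt dd M3 XM.
pose e : par := delta_mx 0 k; pose d := partial k X; pose dd' := 'D_e d.
have sd : smooth_on (box lo hi) d by exact: smooth_on_derive.
have Xd s : box lo hi s -> lform (X s) (d s) = 0.
  by move=> Bs; have [] := point_map_d sX XX Xp k Bs.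
have Bu u : lo 0 k < u < hi 0 k -> box lo hi (upd t k u) by move=> ?; exact: upd_box.
have nearM (f : par -> vec) : smooth_on (box lo hi) f ->
    (forall u, lo 0 k < u < hi 0 k -> f (upd t k u) \in M) ->
    forall u, lo 0 k < u < hi 0 k -> 'D_e f (upd t k u) \in M.
  move=> sf fM u ui; have fd := smooth_on_derivable e sf (Bu u ui).
  apply: (derive_mem (is_derive_upd fd)); near=> s; apply: fM.
  rewrite -[_ && _]/(s \in `]lo 0 k, hi 0 k[); near: s.
  by apply: near_in_itvoo; rewrite in_itv.
have dM := nearM X sX XM; have ddM := nearM d sd dM.
have tk : lo 0 k < t 0 k < hi 0 k by [].
have tE := upd_id t k.
pose C := <<[:: X t; d t; dd' t]>>%VS.
have Xdd : lform (X t) (dd' t) = - lform (d t) (d t).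
  have := lform0_derive e sX sd Bt Xd; rewrite -/(partial k X) -/d -/dd' => h.
  by apply/eqP; rewrite -subr_eq0 opprK addrC h.
have sC : signature21 C by apply: osculating_signature21 => //; [exact: XX|exact: Xd].
have CM : C = M.
  apply/eqP; rewrite eqEdim (signature21_dim sC) M3 andbT span3_subv.
  by rewrite -tE; apply/and3P; split; [exact: XM|exact: dM|exact: ddM].
exists C; last by rewrite CM.
split=> // x /mem_span3P[a [b [c ->]]].
have dp : forall s, box lo hi s -> lform (d s) p = 0.
  by move=> s Bs; have [] := point_map_d sX XX Xp k Bs.
have ddp : lform (dd' t) p = 0 by exact: lformp0_derive sd Bt dp.
by rewrite !lformE Xp// dp// ddp; ring.
Unshelve. all: by end_near. Qed.
End Circles.

Section NullCurves.
Variable R : realType.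
Local Notation vec := 'rV[R]_6.

Lemma near_interval (l h u : R) : l < u < h -> \forall v \near u, l < v < h.
Proof.
move=> ui; near=> v; rewrite -[_ && _]/(v \in `]l, h[); near: v.
by apply: near_in_itvoo; rewrite in_itv.
Unshelve. all: by end_near. Qed.

Lemma interval_mem (l h u : R) : l < u < h -> `]l, h[%classic u.
Proof. by rewrite /= in_itv. Qed.

Lemma null_curve_frame (D : {vspace vec}) (l h : R) c u :
  regular_null_curve D l h c -> l < u < h ->
  [/\ c u \in D, 'D_1 c u \in D, free [:: c u; 'D_1 c u],
      lform (c u) (c u) = 0 & lform (c u) ('D_1 c u) = 0].
Proof.
move=> [[sc cD] cn] ui; have [cu cf] := cD u ui.
have dc := smooth_on_derivable (1 : R) sc (interval_mem ui).
split=> //; [|exact: cn|].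
  apply: (derive_mem dc); near=> v.
  by have [] : c v \in D /\ free [:: c v; 'D_1 c v] by apply: cD; near: v; exact: near_interval.
have c0 : \forall v \near u, lform (c v) (c v) = 0.
  by near=> v; apply: cn; near: v; exact: near_interval.
have := derive_near0 c0 (der_lform dc dc); rewrite lformC => e; lra.
Unshelve. all: by end_near. Qed.

Lemma null_curve_spacelike (D : {vspace vec}) (l h : R) c u : signature21 D ->
  regular_null_curve D l h c -> l < u < h -> 0 < lform ('D_1 c u) ('D_1 c u).
Proof.
move=> sD rc ui; have [cD dD fc cn cd] := null_curve_frame rc ui.
have c0 : c u != 0 by apply: (free_not0 fc); rewrite inE eqxx.
have [m [mm /(_ _ dD)]] := null_tangent sD cD c0 cn.
rewrite lformC cd => /(_ erefl)[k1 [k2 dE]].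
have k20 : k2 != 0.
  move: fc; rewrite free_cons span_seq1 seq1_free => /andP[+ d0]; apply: contraNneq => k20.
  by apply: (memv_lineC d0); rewrite dE k20 scale0r addr0 memvZ ?memv_line.
move: cd; rewrite dE !lformE cn !mulr0 add0r => /eqP; rewrite mulf_eq0 (negbTE k20) => /eqP cm.
by rewrite (lformC m) cm !mulr0 !add0r mulrA -expr2 mulr_gt0// exprn_even_gt0.
Qed.
End NullCurves.

(** * The point sphere map of a pencil of cyclides *)

Ltac lform_sort1 x l :=
  lazymatch l with
  | nil => idtac
  | ?y :: ?l' => rewrite ?(lformC y x); lform_sort1 x l'
  end.

(* Orients every [lform u v] along the given list of vectors. *)
Ltac lform_sort l :=
  lazymatch l with
  | nil => idtac
  | ?x :: ?l' => lform_sort1 x l'; lform_sort l'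
  end.

Section PencilAlgebra.
Variable R : realType.
Local Notation vec := 'rV[R]_6.
Implicit Types a b db p r s x : vec.

(* For null [s1], [s2] the point sphere of the contact element
   [sigma_b <s1, s2>] is spanned by [sigma_b (q2 s1 - q1 s2)] with
   [q_i = <s_i, sigma_b p>]; cleared of denominators this is polynomial in [b]
   and keeps a meaning when [b] is lightlike. *)
Definition pencil_weight p b s := lform b b * lform s p - 2 * lform p b * lform s b.

Definition pencil_minor p b s1 s2 := lform s2 p * lform s1 b - lform s1 p * lform s2 b.

Definition pencil_point p b s1 s2 : vec :=
  pencil_weight p b s2 *: s1 - pencil_weight p b s1 *: s2
  - (2 * pencil_minor p b s1 s2) *: b.

(** This and [pencil_velocity] are the derivatives of [pencil_weight] and [pencil_point] with
    respect to [b] in the direction [db], the spheres being fixed. *)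
Definition pencil_dweight p b db s :=
  2 * lform b db * lform s p - 2 * lform p db * lform s b - 2 * lform p b * lform s db.

Definition pencil_velocity p b db s1 s2 : vec :=
  pencil_dweight p b db s2 *: s1 - pencil_dweight p b db s1 *: s2
  - (2 * pencil_minor p db s1 s2) *: b - (2 * pencil_minor p b s1 s2) *: db.

(** A polynomial square root of the squared length of [pencil_velocity]. Its sign is the one for
    which [pencil_velocity] plus this multiple of [p] is orthogonal to sigma_b <s1, s2>, so that the
    cyclide gets its own orientation. *)
Definition pencil_speed p b db s1 s2 :=
  - 2 * (pencil_minor p b s1 s2 * lform db p - pencil_minor p db s1 s2 * lform b p).

Local Notation pencilE := (pencil_velocity, pencil_point, pencil_speed, pencil_weight,
  pencil_dweight, pencil_minor).

Lemma pencil_point_null p b s1 s2 : lform s1 s1 = 0 -> lform s2 s2 = 0 -> lform s1 s2 = 0 ->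
  lform (pencil_point p b s1 s2) (pencil_point p b s1 s2) = 0.
Proof.
move=> h1 h2 h12; rewrite /pencil_point /pencil_weight /pencil_minor !lformE.
by lform_sort [:: s1; s2; b; p]; rewrite h1 h2 h12; ring.
Qed.

Lemma pencil_point_p p b s1 s2 : lform (pencil_point p b s1 s2) p = 0.
Proof.
rewrite /pencil_point /pencil_weight /pencil_minor !lformE.
by lform_sort [:: b; p]; ring.
Qed.

Lemma pencil_point_orth12 p b s1 s2 ds1 ds2 :
  lform s1 s2 = 0 -> lform s1 ds1 = 0 -> lform s2 ds2 = 0 -> lform ds1 ds2 = 0 ->
  lform (pencil_point p b ds1 s2) (pencil_point p b s1 ds2) = 0.
Proof.
move=> h12 g1 g2 gg.
rewrite /pencil_point /pencil_weight /pencil_minor !lformE.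
lform_sort [:: s1; s2; ds1; ds2; b; p].
by rewrite h12 g1 g2 gg; ring.
Qed.

Lemma pencil_point_norm1 p b s2 ds1 : lform s2 s2 = 0 -> lform s2 ds1 = 0 ->
  lform (pencil_point p b ds1 s2) (pencil_point p b ds1 s2) =
  pencil_weight p b s2 ^+ 2 * lform ds1 ds1.
Proof.
move=> h2 h; rewrite /pencil_point /pencil_weight /pencil_minor !lformE.
by lform_sort [:: s2; ds1; b; p]; rewrite h2 h; ring.
Qed.

Lemma pencil_point_norm2 p b s1 ds2 : lform s1 s1 = 0 -> lform s1 ds2 = 0 ->
  lform (pencil_point p b s1 ds2) (pencil_point p b s1 ds2) =
  pencil_weight p b s1 ^+ 2 * lform ds2 ds2.
Proof.
move=> h1 h; rewrite /pencil_point /pencil_weight /pencil_minor !lformE.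
by lform_sort [:: s1; ds2; b; p]; rewrite h1 h; ring.
Qed.

(** In [pencil_weight p b s2 *: s1 - pencil_weight p b s1 *: s2] the terms with
    [lform s1 b * lform s2 b] cancel, so its product with [b] is [lform b b] times the minor. The
    denominator of the inversion disappears and leaves the last summand of [pencil_point]. *)
Lemma pencil_point_mem p b s1 s2 : lform b b != 0 ->
  pencil_point p b s1 s2 \in lie_inversion_image b <<[:: s1; s2]>>%VS.
Proof.
move=> bb; rewrite lie_inversion_span; apply/mem_span2P.
exists (pencil_weight p b s2), (- pencil_weight p b s1).
apply/rowP => j; rewrite /pencil_point /pencil_weight /pencil_minor /lie_inversion !mxE.
by lform_sort [:: b; p]; field.
Qed.

Section Plane.
Variables (a p b db : vec) (b1 b2 c1 c2 : R).
Hypothesis pp : lform p p = -1.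
Hypothesis bE : b = b1 *: a + b2 *: p.
Hypothesis dbE : db = c1 *: a + c2 *: p.

(** The speed splits into a factor depending on the spheres only and the Wronskian of [b]; for a
    regular [b] it vanishes only with the minor taken at [a]. *)
Lemma pencil_speedE s1 s2 : pencil_speed p b db s1 s2 =
  2 * pencil_minor p a s1 s2 * (b1 * c2 - c1 * b2).
Proof. by rewrite /pencil_speed /pencil_minor bE dbE !lformE pp; ring. Qed.

Lemma pencil_minorE s1 s2 : pencil_minor p b s1 s2 = b1 * pencil_minor p a s1 s2.
Proof. by rewrite /pencil_minor bE !lformE; ring. Qed.

Section Null.
Variables s1 s2 : vec.
Hypotheses (h1 : lform s1 s1 = 0) (h2 : lform s2 s2 = 0) (h12 : lform s1 s2 = 0).

Lemma pencil_velocity_norm :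
  lform (pencil_velocity p b db s1 s2) (pencil_velocity p b db s1 s2) =
  pencil_speed p b db s1 s2 ^+ 2.
Proof.
rewrite /pencil_velocity /pencil_speed /pencil_dweight /pencil_minor bE dbE !lformE.
by lform_sort [:: s1; s2; a; p]; rewrite pp h1 h2 h12; ring.
Qed.

Lemma pencil_velocity_orth1 ds1 :
  lform s1 ds1 = 0 -> lform s2 ds1 = 0 ->
  lform (pencil_velocity p b db s1 s2) (pencil_point p b ds1 s2) = 0.
Proof.
move=> g1 g2.
rewrite /pencil_velocity /pencil_point /pencil_weight /pencil_dweight /pencil_minor bE dbE !lformE.
by lform_sort [:: s1; s2; ds1; a; p]; rewrite pp h2 h12 g1 g2; ring.
Qed.

Lemma pencil_velocity_orth2 ds2 :
  lform s1 ds2 = 0 -> lform s2 ds2 = 0 ->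
  lform (pencil_velocity p b db s1 s2) (pencil_point p b s1 ds2) = 0.
Proof.
move=> g1 g2.
rewrite /pencil_velocity /pencil_point /pencil_weight /pencil_dweight /pencil_minor bE dbE !lformE.
by lform_sort [:: s1; s2; ds2; a; p]; rewrite pp h1 h12 g1 g2; ring.
Qed.

Local Notation n := (pencil_velocity p b db s1 s2 + pencil_speed p b db s1 s2 *: p).

(** The second vector is [lform b b] times the inverted sphere; without the denominator the identity
    is polynomial. *)
Let normal_orth (k1 k2 : R) : lform n (lform b b *: (k1 *: s1 + k2 *: s2) -
   (2 * (k1 * lform s1 b + k2 * lform s2 b)) *: b) = 0.
Proof.
rewrite /pencil_velocity /pencil_speed /pencil_dweight /pencil_minor bE dbE !lformE.
by lform_sort [:: s1; s2; a; p]; rewrite pp h1 h2 h12; ring.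
Qed.

Lemma pencil_normal_orth s : lform b b != 0 -> s \in <<[:: s1; s2]>>%VS ->
  lform n (lie_inversion b s) = 0.
Proof.
move=> bb /mem_span2P[k1 [k2 ->]]; apply: (mulfI bb); rewrite mulr0 -lformZr.
rewrite -(normal_orth k1 k2); congr (lform _ _); rewrite /lie_inversion scalerBr scalerA.
by rewrite mulrCA mulfV// mulr1 lformDl !lformZl.
Qed.

(** Together with [pencil_point_null_member], this puts a lightlike [b] into every contact element
    of its surface, by maximality: the surface is totally umbilic. *)
Lemma pencil_normal_null_member : lform b b = 0 -> lform n b = 0.
Proof.
move=> bb; have -> : lform n b = - (2 * c1 * pencil_minor p a s1 s2) * lform b b.
  rewrite /pencil_velocity /pencil_speed /pencil_dweight /pencil_minor bE dbE !lformE.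
  by lform_sort [:: s1; s2; a; p]; rewrite pp; ring.
by rewrite bb mulr0.
Qed.
End Null.
End Plane.

Lemma pencil_point_null_member p b s1 s2 : lform b b = 0 -> lform (pencil_point p b s1 s2) b = 0.
Proof.
move=> bb; rewrite /pencil_point /pencil_weight /pencil_minor !lformE bb.
by lform_sort [:: s1; s2; b; p]; ring.
Qed.
End PencilAlgebra.

Section PencilMap.
Variable R : realType.
Local Notation vec := 'rV[R]_6.
Local Notation par := 'rV[R]_3.

Lemma pencil_point_linear1 (p b s r s2 : vec) c :
  pencil_point p b (c *: s + r) s2 = c *: pencil_point p b s s2 + pencil_point p b r s2.
Proof.
apply/rowP => j; rewrite /pencil_point /pencil_weight /pencil_minor !mxE !lformE; ring.
Qed.

Lemma pencil_point_linear2 (p b s r s1 : vec) c :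
  pencil_point p b s1 (c *: s + r) = c *: pencil_point p b s1 s + pencil_point p b s1 r.
Proof.
apply/rowP => j; rewrite /pencil_point /pencil_weight /pencil_minor !mxE !lformE; ring.
Qed.

Lemma pencil_point01 (p b s2 : vec) : pencil_point p b 0 s2 = 0.
Proof. by have := pencil_point_linear1 p b 0 0 s2 (-1); rewrite scaler0 add0r => h;
  apply/eqP; rewrite h scaleN1r addNr. Qed.

Lemma pencil_point02 (p b s1 : vec) : pencil_point p b s1 0 = 0.
Proof. by have := pencil_point_linear2 p b 0 0 s1 (-1); rewrite scaler0 add0r => h;
  apply/eqP; rewrite h scaleN1r addNr. Qed.

Lemma pencil_velocity0 (p b s1 s2 : vec) : pencil_velocity p b 0 s1 s2 = 0.
Proof.
apply/rowP => j; rewrite /pencil_velocity /pencil_dweight /pencil_minor !lformE !mxE; ring.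
Qed.

Lemma der_pencil_point (V : normedModType R) (p : vec) (b s1 s2 : V -> vec) x v db ds1 ds2 :
  is_derive x v b db -> is_derive x v s1 ds1 -> is_derive x v s2 ds2 ->
  is_derive x v (fun y => pencil_point p (b y) (s1 y) (s2 y))
    (pencil_velocity p (b x) db (s1 x) (s2 x) + pencil_point p (b x) ds1 (s2 x) +
     pencil_point p (b x) (s1 x) ds2).
Proof.
move=> bx s1x s2x; have px := der_cst x v p; have c2 := der_cst x v (2 : R).
have dw (s : V -> vec) ds : is_derive x v s ds ->
    is_derive x v (fun y => pencil_weight p (b y) (s y))
      (pencil_dweight p (b x) db (s x) + pencil_weight p (b x) ds).
  move=> sx; apply: is_derive_ext (der_sub (der_mul (der_lform bx bx) (der_lform sx px))
    (der_mul (der_mul c2 (der_lform px bx)) (der_lform sx bx))) => //.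
  rewrite /pencil_dweight /pencil_weight !lform0r !lform0l.
  by lform_sort [:: p; b x; db]; ring.
have dm := der_sub (der_mul (der_lform s2x px) (der_lform s1x bx))
    (der_mul (der_lform s1x px) (der_lform s2x bx)).
have := der_sub (der_sub (der_scale (dw _ _ s2x) s1x) (der_scale (dw _ _ s1x) s2x))
    (der_scale (der_mul c2 dm) bx).
apply: is_derive_ext => //.
move: (b x) (s1 x) (s2 x) => b0 r1 r2.
apply/rowP => j; rewrite /pencil_velocity /pencil_dweight /pencil_point /pencil_weight.
rewrite /pencil_minor !lform0r !mxE.
by lform_sort [:: p; b0; db]; ring.
Qed.

Section Map.
Variables (p a : vec) (D1 D2 : {vspace vec}) (lo hi : par) (b s1 s2 : R -> vec).
Hypothesis pp : lform p p = -1.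
Hypothesis hD : dupin_cyclide D1 D2.
Hypothesis lohi : forall i, lo 0 i < hi 0 i.
Hypothesis hb : regular_curve <<[:: a; p]>>%VS (lo 0 0) (hi 0 0) b.
Hypothesis hs1 : regular_null_curve D1 (lo 0 1) (hi 0 1) s1.
Hypothesis hs2 : regular_null_curve D2 (lo 0 2) (hi 0 2) s2.
Local Notation B := (box lo hi).
Let pp0 : lform p p < 0. Proof. by rewrite pp ltrN10. Qed.

Definition pencil_map (t : par) := pencil_point p (b (t 0 0)) (s1 (t 0 1)) (s2 (t 0 2)).

Let b0 (t : par) := b (t 0 0).
Let r1 (t : par) := s1 (t 0 1).
Let r2 (t : par) := s2 (t 0 2).
Let db (t : par) := 'D_1 b (t 0 0).
Let dr1 (t : par) := 'D_1 s1 (t 0 1).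
Let dr2 (t : par) := 'D_1 s2 (t 0 2).

Let sb0 : smooth_on B b0. Proof. by apply: smooth_pullback; case: hb. Qed.
Let sr1 : smooth_on B r1. Proof. by apply: smooth_pullback; case: hs1 => -[]. Qed.
Let sr2 : smooth_on B r2. Proof. by apply: smooth_pullback; case: hs2 => -[]. Qed.

Let sdb : smooth_on B db.
Proof. by apply: (smooth_pullback (c := 'D_1 b)); apply: smooth_on_derive; case: hb. Qed.

Lemma pencil_map_smooth : smooth_on B pencil_map.
Proof.
have oB := @box_open R lo hi; have sp := smooth_vcst oB p; have s2' := smooth_cst oB (2 : R).
have sw (s : par -> vec) : smooth_on B s -> smooth_on B (fun t => pencil_weight p (b0 t) (s t)).
  move=> ss; exact: (smooth_sub oB (smooth_mul oB (smooth_lform oB sb0 sb0) (smooth_lform oB ss sp))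
    (smooth_mul oB (smooth_mul oB s2' (smooth_lform oB sp sb0)) (smooth_lform oB ss sb0))).
have sm := smooth_sub oB (smooth_mul oB (smooth_lform oB sr2 sp) (smooth_lform oB sr1 sb0))
  (smooth_mul oB (smooth_lform oB sr1 sp) (smooth_lform oB sr2 sb0)).
exact: (smooth_vsub oB (smooth_vsub oB (smooth_scale oB (sw _ sr2) sr1)
  (smooth_scale oB (sw _ sr1) sr2)) (smooth_scale oB (smooth_mul oB s2' sm) sb0)).
Qed.

Let speed t := pencil_speed p (b0 t) (db t) (r1 t) (r2 t).

Let speed_smooth : smooth_on B speed.
Proof.
have oB := @box_open R lo hi; have sp := smooth_vcst oB p.
have sm (c : par -> vec) : smooth_on B c ->
    smooth_on B (fun t => pencil_minor p (c t) (r1 t) (r2 t)).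
  move=> sc; exact: (smooth_sub oB (smooth_mul oB (smooth_lform oB sr2 sp) (smooth_lform oB sr1 sc))
  (smooth_mul oB (smooth_lform oB sr1 sp) (smooth_lform oB sr2 sc))).
exact: (smooth_mul oB (smooth_cst oB (- 2 : R)) (smooth_sub oB
  (smooth_mul oB (sm _ sb0) (smooth_lform oB sdb sp))
  (smooth_mul oB (sm _ sdb) (smooth_lform oB sb0 sp)))).
Qed.

Let box_coord t i : B t -> lo 0 i < t 0 i < hi 0 i. Proof. by apply. Qed.

Let r1D t : B t -> [/\ r1 t \in D1, dr1 t \in D1, free [:: r1 t; dr1 t],
  lform (r1 t) (r1 t) = 0 & lform (r1 t) (dr1 t) = 0].
Proof. by move=> Bt; exact: null_curve_frame hs1 (Bt 1). Qed.

Let r2D t : B t -> [/\ r2 t \in D2, dr2 t \in D2, free [:: r2 t; dr2 t],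
  lform (r2 t) (r2 t) = 0 & lform (r2 t) (dr2 t) = 0].
Proof. by move=> Bt; exact: null_curve_frame hs2 (Bt 2). Qed.

Let D12 : forall x y, x \in D1 -> y \in D2 -> lform x y = 0. Proof. by case: hD. Qed.

Let r1_orth t : B t -> lform (r1 t) (dr1 t) = 0. Proof. by case/r1D. Qed.

Let r2_orth t : B t -> lform (r2 t) (dr2 t) = 0. Proof. by case/r2D. Qed.

Lemma pencil_map_partial t : B t ->
  [/\ partial 0 pencil_map t =
        pencil_velocity p (b (t 0 0)) ('D_1 b (t 0 0)) (s1 (t 0 1)) (s2 (t 0 2)),
      partial 1 pencil_map t = pencil_point p (b (t 0 0)) ('D_1 s1 (t 0 1)) (s2 (t 0 2)) &
      partial 2 pencil_map t = pencil_point p (b (t 0 0)) (s1 (t 0 1)) ('D_1 s2 (t 0 2))].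
Proof.
move=> Bt; have [sb _] := hb; have [[ss1 _] _] := hs1; have [[ss2 _] _] := hs2.
have h v := der_pencil_point p (der_pullback v sb Bt) (der_pullback v ss1 Bt)
  (der_pullback v ss2 Bt).
have [[_ h0] [_ h1] [_ h2]] := And3 (h (delta_mx 0 0)) (h (delta_mx 0 1)) (h (delta_mx 0 2)).
split; rewrite /partial.
- by rewrite h0 !mxE eqxx/= scale1r !scale0r pencil_point01 pencil_point02 !addr0.
- by rewrite h1 !mxE eqxx/= scale1r !scale0r pencil_velocity0 pencil_point02 add0r addr0.
- by rewrite h2 !mxE eqxx/= scale1r !scale0r pencil_velocity0 pencil_point01 !add0r.
Qed.

Lemma pencil_plane t : B t -> exists b1 b2 c1 c2,
  [/\ b (t 0 0) = b1 *: a + b2 *: p, 'D_1 b (t 0 0) = c1 *: a + c2 *: p & b1 * c2 - c1 * b2 != 0].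
Proof.
move=> Bt; have [sb bD] := hb; have ti := box_coord 0 Bt.
have [/mem_span2P[b1 [b2 bE]] fb] := bD _ ti.
have ti' : `]lo 0 0, hi 0 0[%classic (t 0 0) by rewrite /= in_itv.
have : db t \in <<[:: a; p]>>%VS.
  apply: (derive_mem (smooth_on_derivable (1 : R) sb ti')); near=> u.
  have : lo 0 0 < u < hi 0 0; last by move=> /bD[].
  by rewrite -[_ && _]/(u \in `]lo 0 0, hi 0 0[); near: u; apply: near_in_itvoo; rewrite in_itv.
move=> /mem_span2P[c1 [c2 dE]]; exists b1, b2, c1, c2; split=> //.
apply/eqP => det; move: fb; rewrite free_cons span_seq1 seq1_free => /andP[/negP bn d0].
apply: bn; rewrite -[b _]/(b0 t) -[derive _ _ _]/(db t) in d0 *.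
have [c10|c10] := eqVneq c1 0.
  have c20 : c2 != 0.
    by apply: contraNneq d0 => c20; rewrite dE c10 c20 !scale0r addr0.
  have b10 : b1 = 0.
    by apply/eqP; move/eqP: det; rewrite c10 mul0r subr0 mulf_eq0 (negbTE c20) orbF.
  apply/vlineP; exists (b2 / c2); rewrite /b0 bE dE b10 c10 !scale0r !add0r scalerA.
  by rewrite divfK.
apply/vlineP; exists (b1 / c1); rewrite /b0 bE dE scalerDr !scalerA divfK//; congr (_ + _ *: _).
by apply: (mulIf c10); transitivity (b1 * c2); [lra|field].
Unshelve. all: by end_near. Qed.

Lemma pencil_map_null t : B t -> lform (pencil_map t) (pencil_map t) = 0.
Proof.
move=> Bt; have [r1d _ _ r1n _] := r1D Bt; have [r2d _ _ r2n _] := r2D Bt.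
by apply: pencil_point_null => //; exact: D12.
Qed.

Lemma pencil_map_p t : lform (pencil_map t) p = 0.
Proof. exact: pencil_point_p. Qed.

Lemma pencil_map_orth t i j : B t -> i != j ->
  lform (partial i pencil_map t) (partial j pencil_map t) = 0.
Proof.
move=> Bt; have [d0 d1 d2] := pencil_map_partial Bt.
have [r1d dr1d _ r1n _] := r1D Bt; have [r2d dr2d _ r2n _] := r2D Bt.
have [b1 [b2 [c1 [c2 [bE dE _]]]]] := pencil_plane Bt.
have h01 : lform (partial 0 pencil_map t) (partial 1 pencil_map t) = 0.
  rewrite d0 d1; apply: (pencil_velocity_orth1 pp bE dE) => //;
    [exact: D12|exact: r1_orth|by rewrite lformC D12].
have h02 : lform (partial 0 pencil_map t) (partial 2 pencil_map t) = 0.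
  rewrite d0 d2.
  exact: (pencil_velocity_orth2 pp bE dE r1n (D12 r1d r2d) (D12 r1d dr2d) (r2_orth Bt)).
have h12 : lform (partial 1 pencil_map t) (partial 2 pencil_map t) = 0.
  rewrite d1 d2; apply: pencil_point_orth12;
    [exact: D12|exact: r1_orth|exact: r2_orth|exact: D12].
move: i j; apply: ord3_split; apply: ord3_split; try by move=> /negP[]; exact: eqxx.
- by move=> _; exact: h01.
- by move=> _; exact: h02.
- by move=> _; rewrite lformC; exact: h01.
- by move=> _; exact: h12.
- by move=> _; rewrite lformC; exact: h02.
- by move=> _; rewrite lformC; exact: h12.
Qed.

Lemma pencil_map_velocity_norm t : B t ->
  lform (partial 0 pencil_map t) (partial 0 pencil_map t) =
  pencil_speed p (b (t 0 0)) ('D_1 b (t 0 0)) (s1 (t 0 1)) (s2 (t 0 2)) ^+ 2.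
Proof.
move=> Bt; have [-> _ _] := pencil_map_partial Bt.
have [r1d dr1d _ r1n _] := r1D Bt; have [r2d dr2d _ r2n _] := r2D Bt.
have [b1 [b2 [c1 [c2 [bE dE _]]]]] := pencil_plane Bt.
by apply: (pencil_velocity_norm pp bE dE) => //; exact: D12.
Qed.

Section System.
Hypothesis X0 : forall t, B t -> pencil_map t != 0.
Hypothesis dX : forall t i, B t -> partial i pencil_map t \notin <[pencil_map t]>%VS.
Local Notation X := pencil_map.

Let frame t : B t -> orth_frame p (X t) (fun i => partial i X t).
Proof.
move=> Bt; apply: (point_map_frame pp pencil_map_smooth pencil_map_null _ Bt) => //.
- by move=> s _; exact: pencil_map_p.
- exact: X0.
- by move=> i j; exact: pencil_map_orth.
- by move=> i; exact: dX.
Qed.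

(** The orientation matters only in family 0, whose contact elements must be sigma_b <s1, s2>; for
    the other two families either root would do. *)
Let G (i : 'I_3) (t : par) : R :=
  if i == 0 then speed t else Num.sqrt (lform (partial i X t) (partial i X t)).

Let sG i : smooth_on B (G i).
Proof.
rewrite /G; case: eqP => _; first exact: speed_smooth.
apply: (smooth_sqrt (@box_open _ _ _)).
  by move=> t Bt; have [_ _ _ _] := frame Bt; apply.
have sd : smooth_on B (partial i X) by exact: smooth_on_derive pencil_map_smooth.
exact: (smooth_lform (@box_open _ _ _) sd sd).
Qed.

Let GE i t : B t -> G i t ^+ 2 = lform (partial i X t) (partial i X t).
Proof.
move=> Bt; rewrite /G; case: eqP => [->|_]; first by rewrite pencil_map_velocity_norm.
by rewrite sqr_sqrtr// ltW//; have [_ _ _ _] := frame Bt; apply.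
Qed.

Let F := coordinate_system p X G.

Let Xp t : B t -> lform (X t) p = 0. Proof. by move=> _; exact: pencil_map_p. Qed.

Let F_contact i t : B t -> contact_element (F i t).
Proof. exact: (coordinate_system_contact pp pencil_map_smooth pencil_map_null Xp frame GE). Qed.

Let F0E t : F 0 t = <<[:: X t; (partial 0 X t + speed t *: p)%R]>>%VS.
Proof. by []. Qed.

Let cyclide_contact t : B t -> lform (b0 t) (b0 t) != 0 ->
  contact_element (lie_inversion_image (b0 t) <<[:: r1 t; r2 t]>>%VS).
Proof.
move=> Bt bb; have [r1d _ f1 r1n _] := r1D Bt; have [r2d _ f2 r2n _] := r2D Bt.
have [r10 r20] : r1 t != 0 /\ r2 t != 0.
  by split; [move: f1|move: f2]; rewrite free_cons; apply: contraTneq => ->; rewrite mem0v.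
have r12 := D12 r1d r2d.
split; last first.
  move=> x; rewrite mem_lie_inversion_image// => h; rewrite -(lform_inversion bb).
  exact: (null_pair_isotropic r1n r2n r12 h h).
rewrite lie_inversion_dim// span2C free_dim2//.
apply/negP => /vlineP[c r2E]; move/eqP: r20; apply.
by apply: (cyclide_disjoint hD _ r2d); rewrite r2E memvZ.
Qed.

(** The point sphere lies in the inverted element by construction, and the normal sphere does
    because it is null and orthogonal to it; equal dimensions finish. *)
Let F_image t : B t -> lform (b0 t) (b0 t) != 0 ->
  F 0 t = lie_inversion_image (b0 t) <<[:: r1 t; r2 t]>>%VS.
Proof.
move=> Bt bb; have [r1d _ _ r1n _] := r1D Bt; have [r2d _ _ r2n _] := r2D Bt.
have r12 := D12 r1d r2d; have hE := cyclide_contact Bt bb.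
have [hF Fn] := F_contact 0 Bt; have [hEd _] := hE.
apply/eqP; rewrite eqEdim hF hEd leqnn andbT F0E span2_subv pencil_point_mem//=.
apply: contact_element_max => //; first by apply: Fn; rewrite F0E memv_span2r.
move=> x; rewrite mem_lie_inversion_image// => xE.
have [b1 [b2 [c1 [c2 [bE dE _]]]]] := pencil_plane Bt; have [-> _ _] := pencil_map_partial Bt.
rewrite -[x](lie_inversionK bb).
exact: (pencil_normal_orth pp bE dE r1n r2n r12 bb xE).
Qed.

Let F_umbilic t : B t -> lform (b0 t) (b0 t) = 0 -> b0 t \in F 0 t.
Proof.
move=> Bt bb; apply: contact_element_max => //; first exact: F_contact.
have [b1 [b2 [c1 [c2 [bE dE _]]]]] := pencil_plane Bt; have [d0 _ _] := pencil_map_partial Bt.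
move=> x; rewrite F0E d0; apply: lform_spanr; rewrite lformC.
  by rewrite pencil_point_null_member.
by rewrite (pencil_normal_null_member pp bE dE).
Qed.

(* Otherwise b, b' and hence p would be orthogonal to p. *)
Lemma pencil_nonnull u : lo 0 0 < u < hi 0 0 ->
  ~ \forall v \near u, lform (b v) (b v) = 0.
Proof.
move=> ui bn; have [sb bD] := hb.
have bp v : lo 0 0 < v < hi 0 0 -> (\forall w \near v, lform (b w) (b w) = 0) ->
    lform (b v) p = 0 /\ exists k l, p = k *: b v + l *: 'D_1 b v.
  move=> vi bvn; have dbv := smooth_on_derivable (1 : R) sb (interval_mem vi).
  have bv0 : lform (b v) (b v) = 0 by exact: nbhs_singleton bvn.
  have bdb : lform (b v) ('D_1 b v) = 0.
    have := derive_near0 bvn (der_lform dbv dbv); rewrite lformC => h; lra.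
  have [bm fb] := bD v vi.
  have dm : 'D_1 b v \in <<[:: a; p]>>%VS.
    by apply: (derive_mem dbv); near=> w; have /bD[] : lo 0 0 < w < hi 0 0 by near: w; exact: near_interval.
  have : p \in <<[:: b v; 'D_1 b v]>>%VS.
    by rewrite -(span2_eq fb bm dm) memv_span2r.
  move=> /mem_span2P[k [l pE]]; split; last by exists k, l.
  by rewrite {1}pE !lformE bv0 bdb !mulr0 addr0.
have [bup [k [l pE]]] := bp u ui bn.
have dbu := smooth_on_derivable (1 : R) sb (interval_mem ui).
have : lform ('D_1 b u) p = 0.
  have bpn : \forall v \near u, lform (b v) p = 0.
    move/near_join: bn => bn; near=> v.
    by have [] : lform (b v) p = 0 /\ exists k l, p = k *: b v + l *: 'D_1 b v
      by apply: bp; near: v; [exact: near_interval|].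
  have := derive_near0 bpn (der_lform dbu (der_cst u (1 : R) p)).
  by rewrite lform0r addr0.
move=> dbp; move: pp; rewrite {1}pE !lformE bup dbp !mulr0 addr0 => /eqP.
by rewrite eq_sym oppr_eq0 oner_eq0.
Unshelve. all: by end_near. Qed.

Let pr (v : vec) := v + lform v p *: p.

(** Projecting along [p] saves one dimension: a trajectory that lives in the span of three vectors
    and [p] stays, being orthogonal to [p], in a 3-dimensional space. *)
Let projE (v u1 u2 u3 : vec) c1 c2 c3 c4 :
  v = c1 *: u1 + c2 *: u2 + c3 *: u3 + c4 *: p -> lform v p = 0 ->
  v \in <<[:: pr u1; pr u2; pr u3]>>%VS.
Proof.
move=> vE vp; apply/mem_span3P; exists c1, c2, c3.
have c4E : c4 = c1 * lform u1 p + c2 * lform u2 p + c3 * lform u3 p.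
  by move: vp; rewrite vE !lformE pp; lra.
by rewrite vE c4E /pr; apply/rowP => j; rewrite !mxE; ring.
Qed.

Let circles : circular_trajectories p lo hi F.
Proof.
move=> k t Bt.
suff [M M3 XM] : exists2 M : {vspace vec}, (\dim M <= 3)%N &
    forall u, lo 0 k < u < hi 0 k -> X (upd t k u) \in M.
  have dk : 0 < lform (partial k X t) (partial k X t).
    by have [_ _ _ _] := frame Bt; apply.
  have [C hC XC] := curve_in_circle pp pencil_map_smooth pencil_map_null Xp Bt dk M3 XM.
  exists C => // t' Bt' tt' i x xF xp.
  have /vlineP[c ->] : x \in <[X t']>%VS.
    exact: (coordinate_system_points pp pencil_map_smooth pencil_map_null Xp frame GE Bt' xF xp).
  by rewrite memvZ// (upd_line tt') XC//; exact: Bt'.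
have Bu u : lo 0 k < u < hi 0 k -> B (upd t k u) by move=> ?; exact: upd_box.
have X_upd u : X (upd t k u) = pencil_point p (b0 (upd t k u)) (r1 (upd t k u)) (r2 (upd t k u)).
  by [].
move: k Bu X_upd; apply: ord3_split => Bu X_upd.
- exists <<[:: pr (r1 t); pr (r2 t); pr a]>>%VS.
    exact: dim_span_size.
  move=> u ui; have [b1 [b2 [c1 [c2 [bE _ _]]]]] := pencil_plane (Bu u ui).
  have := pencil_map_p (upd t 0 u); rewrite X_upd /b0 bE.
  have -> : r1 (upd t 0 u) = r1 t by rewrite /r1 updE.
  have -> : r2 (upd t 0 u) = r2 t by rewrite /r2 updE.
  rewrite /pencil_point; set w1 := pencil_weight _ _ _; set w2 := pencil_weight _ _ _.
  set m := pencil_minor _ _ _ _; clearbody w1 w2 m => h.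
  apply: (@projE _ _ _ _ w1 (- w2) (- (2 * m) * b1) (- (2 * m) * b2)) => //.
  by apply/rowP => j; rewrite !mxE; ring.
(* Along this trajectory only the sphere in [D1] moves, and [pencil_point] is linear in it, so three
   values at a basis of [D1] suffice. *)
- have [[e1 [e2 [e3 [DE _ _]]]] _ _ _] := hD.
  exists <<[:: pencil_point p (b0 t) e1 (r2 t); pencil_point p (b0 t) e2 (r2 t);
    pencil_point p (b0 t) e3 (r2 t)]>>%VS; first exact: dim_span_size.
  move=> u ui; have [+ _ _ _ _] := r1D (Bu u ui); rewrite X_upd.
  have -> : b0 (upd t 1 u) = b0 t by rewrite /b0 updE.
  have -> : r2 (upd t 1 u) = r2 t by rewrite /r2 updE.
  rewrite DE => /mem_span3P[k1 [k2 [k3 ->]]]; apply/mem_span3P; exists k1, k2, k3.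
  rewrite -addrA !pencil_point_linear1 -[k3 *: e3]addr0 pencil_point_linear1.
  by rewrite pencil_point01 addr0 addrA.
- have [_ [e1 [e2 [e3 [DE _ _]]]] _ _] := hD.
  exists <<[:: pencil_point p (b0 t) (r1 t) e1; pencil_point p (b0 t) (r1 t) e2;
    pencil_point p (b0 t) (r1 t) e3]>>%VS; first exact: dim_span_size.
  move=> u ui; have [+ _ _ _ _] := r2D (Bu u ui); rewrite X_upd.
  have -> : b0 (upd t 2 u) = b0 t by rewrite /b0 updE.
  have -> : r1 (upd t 2 u) = r1 t by rewrite /r1 updE.
  rewrite DE => /mem_span3P[k1 [k2 [k3 ->]]]; apply/mem_span3P; exists k1, k2, k3.
  rewrite -addrA !pencil_point_linear2 -[k3 *: e3]addr0 pencil_point_linear2.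
  by rewrite pencil_point02 addr0 addrA.
Qed.

Let midpoint_in i : lo 0 i < (lo 0 i + hi 0 i) / 2 < hi 0 i.
Proof. by have := lohi i => h; apply/andP; split; lra. Qed.

Lemma pencil_exists_nonnull : exists2 u, lo 0 0 < u < hi 0 0 & lform (b u) (b u) != 0.
Proof.
apply/not_exists2P => h; apply: (pencil_nonnull (midpoint_in 0)); near=> v.
apply/eqP; have [//|] := h v; first last.
  by move=> /negP; rewrite negbK.
case; rewrite -[_ && _]/(v \in `]lo 0 0, hi 0 0[); near: v.
by apply: near_in_itvoo; rewrite in_itv; exact: midpoint_in.
Unshelve. all: by end_near. Qed.

Lemma pencil_dc_system : exists F : 'I_3 -> par -> {vspace vec},
  dc_system p lo hi F /\
  forall t, B t ->
    (lform (b (t 0 0)) (b (t 0 0)) != 0 ->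
       F 0 t = lie_inversion_image (b (t 0 0)) <<[:: s1 (t 0 1)%R; s2 (t 0 2)%R]>>%VS) /\
    (lform (b (t 0 0)) (b (t 0 0)) = 0 -> b (t 0 0) \in F 0 t).
Proof.
exists F; split; last by move=> t Bt; split; [exact: F_image|exact: F_umbilic].
split; [|exact: circles|].
  exact: (coordinate_system_triply_orthogonal pp pencil_map_smooth pencil_map_null Xp lohi sG frame GE).
have [c ci bc] := pencil_exists_nonnull.
exists 0, c, (lie_inversion_image (b c) D1), (lie_inversion_image (b c) D2).
split=> //; first exact: lie_inversion_cyclide.
move=> t Bt tc; have tb : b0 t = b c by rewrite /b0 tc.
have [r1d _ f1 r1n _] := r1D Bt; have [r2d _ f2 r2n _] := r2D Bt.
exists (lie_inversion (b c) (r1 t)), (lie_inversion (b c) (r2 t)); split.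
- by rewrite mem_lie_inversion_image2.
- by rewrite mem_lie_inversion_image2.
- have r10 : r1 t != 0 by move: f1; rewrite free_cons; apply: contraTneq => ->; rewrite mem0v.
  have r20 : r2 t != 0 by move: f2; rewrite free_cons; apply: contraTneq => ->; rewrite mem0v.
  apply/andP; split; [apply: contraNneq r10|apply: contraNneq r20] => h.
    by rewrite -[r1 t](lie_inversionK bc) h linear0.
  by rewrite -[r2 t](lie_inversionK bc) h linear0.
- by rewrite !lform_inversion.
- by rewrite F_image ?tb// lie_inversion_span.
Qed.
End System.
End Map.
End PencilMap.

(** * From the given immersion to the polynomial point map *)

Section PencilImmersion.
Variable R : realType.
Local Notation vec := 'rV[R]_6.
Local Notation par := 'rV[R]_3.

(** Pairing with [s1] and [s2] shows that the minor kills both [lform s1 b] and [lform s2 b], of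
    which it is itself a combination; hence it is zero. Independence of the spheres then kills the
    weights. *)
Lemma pencil_point_eq0 (p b s1 s2 : vec) : lform s1 s1 = 0 -> lform s2 s2 = 0 ->
  lform s1 s2 = 0 -> s1 != 0 -> s2 \notin <[s1]>%VS -> pencil_point p b s1 s2 = 0 ->
  [/\ pencil_minor p b s1 s2 = 0, pencil_weight p b s1 = 0 & pencil_weight p b s2 = 0].
Proof.
move=> h1 h2 h12 s10 s21 X0.
have e1 : pencil_minor p b s1 s2 * lform s1 b = 0.
  have := congr1 (lform s1) X0; rewrite /pencil_point !lformE h1 h12 => h; lra.
have e2 : pencil_minor p b s1 s2 * lform s2 b = 0.
  have := congr1 (lform s2) X0; rewrite /pencil_point !lformE h2 (lformC s2 s1) h12 => h; lra.
have m0 : pencil_minor p b s1 s2 = 0.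
  have [//|m0] := eqVneq (pencil_minor p b s1 s2) 0.
  have b1 : lform s1 b = 0 by apply/eqP; move/eqP: e1; rewrite mulf_eq0 (negbTE m0).
  have b2 : lform s2 b = 0 by apply/eqP; move/eqP: e2; rewrite mulf_eq0 (negbTE m0).
  by rewrite /pencil_minor b1 b2 !mulr0 subrr.
move: X0; rewrite /pencil_point m0 mulr0 scale0r subr0 => /eqP; rewrite subr_eq0 => /eqP qE.
have q1 : pencil_weight p b s1 = 0.
  have [//|q1] := eqVneq (pencil_weight p b s1) 0.
  case/negP: s21; apply/vlineP; exists ((pencil_weight p b s1)^-1 * pencil_weight p b s2).
  by rewrite -scalerA qE scalerA mulVf// scale1r.
split=> //; move: qE; rewrite q1 scale0r => /eqP; rewrite scaler_eq0 (negbTE s10) orbF.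
by move/eqP.
Qed.

Lemma pencil_point_neq0 (p b s1 s2 : vec) : lform p p = -1 -> lform b b != 0 ->
  lform s1 s1 = 0 -> lform s2 s2 = 0 ->
  lform s1 s2 = 0 -> s1 != 0 -> s2 \notin <[s1]>%VS -> pencil_point p b s1 s2 != 0.
Proof.
move=> pp bb h1 h2 h12 s10 s21; apply/eqP => /(pencil_point_eq0 h1 h2 h12 s10 s21)[_ q1 q2].
(* [q] is [lform b b] times the inverted [p], hence timelike, and the weight of a sphere is its
   product with [q]. Two null vectors orthogonal to each other and to a timelike vector are
   proportional. *)
pose q := lform b b *: p - (2 * lform p b) *: b.
have qq : lform q q < 0.
  have -> : lform q q = - (lform b b * lform b b).
    by rewrite /q !lformE pp (lformC b p); ring.
  by rewrite oppr_lt0 -expr2 exprn_even_gt0.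
have qE s : lform s q = pencil_weight p b s by rewrite /q !lformE.
case/negP: s21; apply: (timelike_perp_line qq s10 h1) => //; rewrite ?qE//.
by rewrite h2.
Qed.

Lemma immersion_line (x : vec) (d : 'I_3 -> vec) i : free [:: x; d 0; d 1; d 2] ->
  d i \notin <[x]>%VS.
Proof.
have yi : d i \in [:: d 0; d 1; d 2].
  by move: i; apply: ord3_split; rewrite !inE eqxx ?orbT.
move: (d i) yi => y yi fx; have y0' : y != 0 by apply: (free_not0 fx); rewrite inE yi orbT.
move: fx; rewrite free_cons => /andP[xn _]; apply: contra xn => /(memv_lineC y0') xy.
by apply: (subvP _ _ xy); rewrite -span_seq1; apply: sub_span => z; rewrite inE => /eqP->.
Qed.

Lemma immersion_partial p lo hi (x : par -> vec) t i : point_immersion p lo hi x ->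
  box lo hi t -> x t != 0 /\ partial i x t \notin <[x t]>%VS.
Proof.
move=> [_ /[apply] [[_ _ fx]]]; split; first by apply: (free_not0 fx); rewrite inE eqxx.
exact: (immersion_line (d := fun i => partial i x t) i fx).
Qed.

Section Regular.
Variables (p a : vec) (D1 D2 : {vspace vec}) (lo hi : par) (b s1 s2 : R -> vec).
Variable x : par -> vec.
Hypothesis pp : lform p p = -1.
Hypothesis hD : dupin_cyclide D1 D2.
Hypothesis pencil : regular_pencil p D1 D2 a lo hi b s1 s2 x.
Local Notation B := (box lo hi).
Let pp0 : lform p p < 0. Proof. by rewrite pp ltrN10. Qed.
Let lohi : forall i, lo 0 i < hi 0 i. Proof. by case: pencil. Qed.
Let hb : regular_curve <<[:: a; p]>>%VS (lo 0 0) (hi 0 0) b. Proof. by case: pencil. Qed.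
Let hs1 : regular_null_curve D1 (lo 0 1) (hi 0 1) s1. Proof. by case: pencil => _ _ []. Qed.
Let hs2 : regular_null_curve D2 (lo 0 2) (hi 0 2) s2. Proof. by case: pencil => _ _ []. Qed.
Let hx : point_immersion p lo hi x. Proof. by case: pencil. Qed.
Let xE t : B t -> lform (b (t 0 0)) (b (t 0 0)) != 0 ->
  x t \in lie_inversion_image (b (t 0 0)) <<[:: s1 (t 0 1)%R; s2 (t 0 2)%R]>>%VS.
Proof. by case: pencil => _ _ _ _; apply. Qed.
Let sx : smooth_on B x. Proof. by case: hx. Qed.
Local Notation X := (pencil_map p b s1 s2).
Let sX : smooth_on B X. Proof. exact: (pencil_map_smooth hb hs1 hs2). Qed.

Lemma pencil_spheres t : B t ->
  [/\ lform (s1 (t 0 1)) (s1 (t 0 1)) = 0, lform (s2 (t 0 2)) (s2 (t 0 2)) = 0,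
      lform (s1 (t 0 1)) (s2 (t 0 2)) = 0, s1 (t 0 1) != 0 &
      s2 (t 0 2) \notin <[s1 (t 0 1)%R]>%VS].
Proof.
move=> Bt; have [[_ /(_ _ (Bt 1))[d1 f1]] /(_ _ (Bt 1)) n1] := hs1.
have [[_ /(_ _ (Bt 2))[d2 f2]] /(_ _ (Bt 2)) n2] := hs2.
have s10 : s1 (t 0 1) != 0 by apply: (free_not0 f1); rewrite inE eqxx.
have s20 : s2 (t 0 2) != 0 by apply: (free_not0 f2); rewrite inE eqxx.
split=> //; first by have [_ _ D12 _] := hD; apply: D12.
apply/negP => /vlineP[c s2E]; move/eqP: s20; apply.
by apply: (cyclide_disjoint hD _ d2); rewrite s2E memvZ.
Qed.

Let X_neq0 t : B t -> lform (b (t 0 0)) (b (t 0 0)) != 0 -> X t != 0.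
Proof.
move=> Bt bb; have [n1 n2 n12 s10 s21] := pencil_spheres Bt.
exact: (pencil_point_neq0 pp bb n1 n2 n12 s10 s21).
Qed.

Let x_line t : B t -> lform (b (t 0 0)) (b (t 0 0)) != 0 -> x t \in <[X t]>%VS.
Proof.
move=> Bt bb; have [n1 n2 n12 s10 s21] := pencil_spheres Bt.
have iso u v : u \in lie_inversion_image (b (t 0 0)) <<[:: s1 (t 0 1)%R; s2 (t 0 2)%R]>>%VS ->
    v \in lie_inversion_image (b (t 0 0)) <<[:: s1 (t 0 1)%R; s2 (t 0 2)%R]>>%VS ->
    lform u v = 0.
  rewrite !mem_lie_inversion_image// => hu hv; rewrite -(lform_inversion bb).
  exact: (null_pair_isotropic n1 n2 n12 hu hv).
have XE := pencil_point_mem p (s1 (t 0 1)) (s2 (t 0 2)) bb.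
have [_ /(_ t Bt)[_ xp _]] := hx.
apply: (timelike_perp_line pp0 (X_neq0 Bt bb)).
- exact: (iso _ _ XE XE).
- exact: pencil_map_p.
- exact: xp.
- exact: (iso _ _ XE (xE Bt bb)).
- by rewrite (iso _ _ (xE Bt bb) (xE Bt bb)).
Qed.

Let near_nonnull t : B t -> lform (b (t 0 0)) (b (t 0 0)) != 0 ->
  \forall s \near t, B s /\ lform (b (s 0 0)) (b (s 0 0)) != 0.
Proof.
move=> Bt bb; have oB := @box_open R lo hi.
have sb : smooth_on B (fun t : par => b (t 0 0)) by apply: smooth_pullback; case: hb.
have := smooth_on_continuous (smooth_lform oB sb sb) Bt.
move=> /(_ [set k | k != 0]) h; near=> s; split; near: s; first exact: near_box.
by apply: h; exact: (open_nbhs_nbhs (conj (@open_neq _ 0) bb)).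
Unshelve. all: by end_near. Qed.

(** If the partial derivative of the polynomial lift were parallel to the lift, so would be that of
    [x], by differentiating the proportionality. *)
Let X_partial t i : B t -> X t != 0 -> (\forall s \near t, x s \in <[X s]>%VS) ->
  partial i X t \notin <[X t]>%VS.
Proof.
move=> Bt X0 xX; have [x0 dx] := immersion_partial i hx Bt.
have xl : x t \in <[X t]>%VS by exact: nbhs_singleton xX.
apply: contra dx => dX; have := derive_line_mem (smooth_on_derivable (delta_mx 0 i) sx Bt)
  (smooth_on_derivable (delta_mx 0 i) sX Bt) X0 xX.
move=> /mem_span2P[c [d dE]]; rewrite /partial dE; move: dX => /vlineP[k].
rewrite /partial => ->; by rewrite scalerA -scalerDl memvZ// (memv_lineC x0).
Qed.

(** The minor at [a] does not involve the first coordinate, so that coordinate can be moved to a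
    non-null [b]. There a zero minor would make the velocity null, against the immersion. *)
Let minor_neq0 t : B t -> pencil_minor p a (s1 (t 0 1)) (s2 (t 0 2)) != 0.
Proof.
move=> Bt; apply/eqP => w0.
have ti : lo 0 0 < t 0 0 < hi 0 0 by exact: Bt.
apply: (pencil_nonnull pp hb ti); near=> u.
have Bu : B (upd t 0 u) by near: u; exact: near_upd.
have [//|bb] := eqVneq (lform (b u) (b u)) 0.
have uE : upd t 0 u 0 0 = u by rewrite updE eqxx.
have bb' : lform (b (upd t 0 u 0 0)) (b (upd t 0 u 0 0)) != 0 by rewrite uE.
have X0 := X_neq0 Bu bb'.
have : partial 0 X (upd t 0 u) \notin <[X (upd t 0 u)%R]>%VS.
  apply: (X_partial 0 Bu X0); have := near_nonnull Bu bb'.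
  by apply: filterS => s [Bs bs]; exact: x_line.
have Xn : forall t, B t -> lform (X t) (X t) = 0.
  exact: (pencil_map_null p b hD hs1 hs2).
have Xp : forall t, B t -> lform (X t) p = 0 by move=> *; exact: pencil_map_p.
have [Xd dp] := point_map_d sX Xn Xp 0 Bu.
case/negP; apply: (timelike_perp_line pp0 X0 (Xn _ Bu) (Xp _ Bu) dp Xd).
rewrite (pencil_map_velocity_norm pp hD hb hs1 hs2 Bu).
have [b1 [b2 [c1 [c2 [bE dE _]]]]] := pencil_plane hb Bu.
rewrite (pencil_speedE pp bE dE) !updE/=.
by rewrite w0 !(mulr0, mul0r) expr0n.
Unshelve. all: by end_near. Qed.

(** A zero forces the [a]-coefficient of [b] to vanish, since the minor at [b] is that coefficient
    times the nonzero minor at [a]. Then [b] is a multiple of [p], hence non-null, where the lift is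
    known to be nonzero. *)
Let X_neq0' t : B t -> X t != 0.
Proof.
move=> Bt; have [b1 [b2 [c1 [c2 [bE dE det]]]]] := pencil_plane hb Bt.
have [n1 n2 n12 s10 s21] := pencil_spheres Bt.
apply/eqP => X0; have [m0 _ _] := pencil_point_eq0 n1 n2 n12 s10 s21 X0.
have b10 : b1 = 0.
  apply/eqP; move: m0; rewrite (pencil_minorE bE) => /eqP.
  by rewrite mulf_eq0 (negbTE (minor_neq0 Bt)) orbF.
have b20 : b2 != 0.
  by apply: contraNneq det => b20; rewrite b10 b20 mul0r mulr0 subrr.
move/eqP: X0; apply/negP; apply: (X_neq0 Bt).
by rewrite bE b10 scale0r add0r !lformE pp mulrN1 mulrN oppr_eq0 mulf_neq0.
Qed.

(** A nonzero minor of [x] and the lift would stay nonzero along a piece of the coordinate line,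
    which contains non-null values of [b], where all minors vanish. *)
Let x_line' t : B t -> x t \in <[X t]>%VS.
Proof.
move=> Bt; have [j Xj] := row_coord_neq0 (X_neq0' Bt).
apply: (minors_line Xj) => k; apply/eqP/negP => /negP h.
have ti : lo 0 0 < t 0 0 < hi 0 0 by exact: Bt.
apply: (pencil_nonnull pp hb ti); have oB := @box_open R lo hi.
pose m s := x s 0 j * X s 0 k - x s 0 k * X s 0 j.
have sm : smooth_on B m.
  exact: (smooth_sub oB (smooth_mul oB (smooth_coord oB j sx) (smooth_coord oB k sX))
    (smooth_mul oB (smooth_coord oB k sx) (smooth_coord oB j sX))).
have mc : {for t 0 0, continuous (fun u => m (upd t 0 u))}.
  by apply: continuous_upd; rewrite upd_id; exact: smooth_on_continuous sm Bt.
have mt : m t != 0 by rewrite subr_eq0.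
have := mc [set r | r != 0]; rewrite /= upd_id => /(_ (open_nbhs_nbhs (conj (@open_neq _ 0) mt))) mn.
near=> u; have [//|bb] := eqVneq (lform (b u) (b u)) 0.
have Bu : B (upd t 0 u) by near: u; exact: near_upd.
have : m (upd t 0 u) != 0 by near: u; exact: mn.
rewrite subr_eq0 (line_minors j k (x_line Bu _)) ?eqxx//.
by rewrite updE eqxx.
Unshelve. all: by end_near. Qed.

Lemma regular_pencil_dc_system : exists F : 'I_3 -> par -> {vspace vec},
  dc_system p lo hi F /\
  forall t, B t ->
    (lform (b (t 0 0)) (b (t 0 0)) != 0 ->
       F 0 t = lie_inversion_image (b (t 0 0)) <<[:: s1 (t 0 1)%R; s2 (t 0 2)%R]>>%VS) /\
    (lform (b (t 0 0)) (b (t 0 0)) = 0 -> b (t 0 0) \in F 0 t).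
Proof.
apply: (pencil_dc_system pp hD lohi hb hs1 hs2 X_neq0').
move=> t i Bt; apply: (X_partial i Bt (X_neq0' Bt)).
by near=> s; apply: x_line'; near: s; exact: near_box.
Unshelve. all: by end_near. Qed.
End Regular.
End PencilImmersion.

(** * Regular pencils through a prescribed member *)

Section PencilConstruction.
Variable R : realType.
Local Notation vec := 'rV[R]_6.
Local Notation par := 'rV[R]_3.

Lemma is_derive_affine (k c u v : R) : is_derive u v (fun u => k * u + c) (k * v).
Proof.
have := der_add (der_mul (der_cst u v k) (is_derive_id u v)) (der_cst u v c).
by apply: is_derive_ext => //; rewrite mul0r add0r addr0.
Qed.

Lemma smooth_affine (U : set R) (k c : R) : open U -> smooth_on U (fun u => k * u + c).
Proof.
move=> Uo; pose P (f : R -> R) := exists k c, f = fun u => k * u + c.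
apply: (smooth_on_coind Uo (P := P)); last by exists k, c.
  move=> {k c} f [k [c ->]] u _; split; last by move=> v; case: (is_derive_affine k c u v).
  apply: differentiable_continuous; apply/derivable1_diffP.
  by case: (is_derive_affine k c u 1).
move=> {k c} f v [k [c ->]]; exists (fun=> k * v).
  by exists 0, (k * v); apply/funext => u; rewrite mul0r add0r.
by move=> u _; case: (is_derive_affine k c u v).
Qed.

Lemma smooth_id (U : set R) : open U -> smooth_on U (fun u : R => u).
Proof.
by move=> Uo; have := smooth_affine 1 0 Uo; under eq_fun do rewrite mul1r addr0.
Qed.

(** The rational parametrization of the null conic, from (1 - u^2)^2 + (2 u)^2 = (1 + u^2)^2. *)
Definition conic (e1 e2 e3 : vec) (u : R) : vec :=
  (1 - u * u) *: e1 + (2 * u) *: e2 + (1 + u * u) *: e3.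

Section Conic.
Variables e1 e2 e3 : vec.
Hypotheses (h1 : lform e1 e1 = 1) (h2 : lform e2 e2 = 1) (h3 : lform e3 e3 = -1).
Hypotheses (h12 : lform e1 e2 = 0) (h13 : lform e1 e3 = 0) (h23 : lform e2 e3 = 0).
Local Notation c := (conic e1 e2 e3).

Lemma conic_derive (u : R) : is_derive u (1 : R) c ((- (2 * u)) *: e1 + 2 *: e2 + (2 * u) *: e3).
Proof.
have du := is_derive_id u (1 : R); have d1 := der_cst u (1 : R) (1 : R).
have duu := der_mul du du.
have := der_add (der_add (der_scale (der_sub d1 duu) (der_cst u (1 : R) e1))
  (der_scale (der_mul (der_cst u (1 : R) (2 : R)) du) (der_cst u (1 : R) e2)))
  (der_scale (der_add d1 duu) (der_cst u (1 : R) e3)).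
by apply: is_derive_ext => //; apply/rowP => j; rewrite !mxE; ring.
Qed.

Lemma conic_regular (l h : R) : regular_null_curve <<[:: e1; e2; e3]>>%VS l h c.
Proof.
have cc u : lform (c u) (c u) = 0.
  by rewrite /conic !lformE; lform_sort [:: e1; e2; e3]; rewrite h1 h2 h3 h12 h13 h23; ring.
split; last by move=> u _; exact: cc.
have oI : open `]l, h[%classic by exact: interval_open.
split.
  have si := smooth_id oI; have s1 := smooth_cst oI (1 : R); have sii := smooth_mul oI si si.
  exact: (smooth_vadd oI (smooth_vadd oI
    (smooth_scale oI (smooth_sub oI s1 sii) (smooth_vcst oI e1))
    (smooth_scale oI (smooth_mul oI (smooth_cst oI (2 : R)) si) (smooth_vcst oI e2)))
    (smooth_scale oI (smooth_add oI s1 sii) (smooth_vcst oI e3))).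
move=> u _; split.
  by apply/mem_span3P; exists (1 - u * u), (2 * u), (1 + u * u).
have [_ ->] := conic_derive u; set d := _ + _ *: e3.
have dd : lform d d = 4.
  by rewrite /d !lformE; lform_sort [:: e1; e2; e3]; rewrite h1 h2 h3 h12 h13 h23; ring.
have d0 : d != 0 by apply/eqP => d0; move: dd; rewrite d0 lform0l; lra.
rewrite free_cons span_seq1 seq1_free d0 andbT; apply/negP => /vlineP[k ck].
have k0 : k = 0.
  move: (cc u); rewrite ck lformZl lformZr dd => /eqP.
  by rewrite !mulf_eq0 => /orP[/eqP//|/orP[/eqP//|]]; rewrite pnatr_eq0.
have : lform (c u) e3 = 0 by rewrite ck k0 scale0r lform0l.
by rewrite /conic !lformE h3 h13 h23; have := sqr_ge0 u; rewrite expr2; lra.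
Qed.

Lemma conic_lform u v : lform (c u) v =
  (1 - u * u) * lform e1 v + (2 * u) * lform e2 v + (1 + u * u) * lform e3 v.
Proof. by rewrite /conic !lformE. Qed.

(** [lform (c u) v] is a polynomial in [u], nonzero because its values at 0, 1 and -1 determine the
    products of [v] with the basis. The product of two such polynomials has fewer roots than its
    size. *)
Lemma conic_choose v w : (exists2 e, e \in <<[:: e1; e2; e3]>>%VS & lform e v != 0) ->
  (exists2 e, e \in <<[:: e1; e2; e3]>>%VS & lform e w != 0) ->
  exists u, lform (c u) v != 0 /\ lform (c u) w != 0.
Proof.
pose q v : {poly R} := (lform e1 v + lform e3 v)%:P + (2 * lform e2 v) *: 'X +
  (lform e3 v - lform e1 v) *: 'X^2.
have qE x u : (q x).[u] = lform (c u) x.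
  by rewrite /q !hornerE conic_lform /=; ring.
have q0 x : (exists2 e, e \in <<[:: e1; e2; e3]>>%VS & lform e x != 0) -> q x != 0.
  move=> [e /mem_span3P[k1 [k2 [k3 ->]]] ex]; apply: contraNneq ex => qx0.
  have := qE x 0; have := qE x 1; have := qE x (-1); rewrite !conic_lform qx0 !horner0.
  move=> m1 p1 z0; rewrite !lformE.
  have -> : lform e1 x = 0 by lra.
  have -> : lform e2 x = 0 by lra.
  have -> : lform e3 x = 0 by lra.
  by rewrite !mulr0 !addr0.
move=> /q0 v0 /q0 w0; have vw0 : q v * q w != 0 by rewrite mulf_neq0.
pose s := [seq i%:R : R | i <- iota 0 (size (q v * q w))].
have us : uniq s.
  by rewrite map_inj_uniq ?iota_uniq// => i j /eqP; rewrite eqr_nat => /eqP.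
have := max_poly_roots vw0 _ us; rewrite size_map size_iota ltnn.
case: (boolP (all (root (q v * q w)) s)) => [_ /(_ isT)//|].
move=> /allPn[u _ ur] _; exists u.
by move: ur; rewrite rootM negb_or /root !qE => /andP.
Qed.
End Conic.

Lemma near_small_box (t : par) (P : par -> Prop) : (\forall s \near t, P s) ->
  exists e : R, 0 < e /\ forall s, box (t - const_mx e) (t + const_mx e) s -> P s.
Proof.
move=> /nbhs_ballP[e /= e0 eP]; exists e; split=> // s Bs; apply: eP; split=> // i j.
have := Bs j; rewrite !mxE (ord1 i) /ball/= => h.
by rewrite ltr_norml; lra.
Qed.

Section Construct.
Variables (p a b0 : vec) (D1 D2 : {vspace vec}).
Hypothesis pp : lform p p = -1.
Hypothesis hD : dupin_cyclide D1 D2.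
Hypothesis ap : a \notin <[p]>%VS.
Hypothesis b0m : b0 \in <<[:: a; p]>>%VS.
Hypothesis b00 : b0 != 0.
(** One vector serves both kinds of members. For non-null [b0] it is a nonzero multiple of the
    inverted [p], so the hypotheses say that [p] avoids the inverted [D1] and [D2]; for null [b0] it
    is a multiple of [b0]. Its product with a sphere is the weight at [b0]. *)
Local Notation q := (lform b0 b0 *: p - (2 * lform p b0) *: b0).
Hypothesis q1 : q \notin D1.
Hypothesis q2 : q \notin D2.

Let p0 : p != 0.
Proof. by apply/eqP => p0; move: pp; rewrite p0 lform0l => /eqP; rewrite eq_sym oppr_eq0 oner_eq0. Qed.

Lemma perp_exists (D D' : {vspace vec}) (v : vec) : dupin_cyclide D D' -> v \notin D' ->
  exists2 e, e \in D & lform e v != 0.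
Proof.
move=> h vD; apply/not_exists2P => H; case/negP: vD; apply: (cyclide_perp h) => w wD.
have [//|/negP] := H w; rewrite negbK lformC => /eqP //.
Qed.

(* Otherwise all rows (<e,a>, <e,p>), for e in D1 and in D2, are proportional,
   and so are a and p. *)
Let minor_exists : exists e f : vec, [/\ e \in D1, f \in D2 &
  lform f p * lform e a - lform e p * lform f a != 0].
Proof.
apply: contrapT => H.
have w0 e f : e \in D1 -> f \in D2 -> lform f p * lform e a = lform e p * lform f a.
  move=> eD fD; apply/eqP; rewrite -subr_eq0; apply/negP => /negP h.
  by apply: H; exists e, f.
have [k [l qE]] : exists k l, q = k *: a + l *: p.
  move: b0m => /mem_span2P[b1 [b2 ->]]; set N := lform _ _; set P := 2 * _.
  exists (- P * b1), (N - P * b2).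
  by apply/rowP => j; rewrite !mxE; ring.
have [e eD eq] := perp_exists hD q2.
have [f fD fq] := perp_exists (dupin_cyclideC hD) q1.
pose z := lform f p *: a - lform f a *: p.
have z1 w : w \in D1 -> lform z w = 0.
  by move=> wD; rewrite /z lformC !lformE w0//; ring.
have z2 w : w \in D2 -> lform z w = 0.
  move=> wD; have ew := w0 _ _ eD wD; have ef := w0 _ _ eD fD.
  have : lform e q * lform z w = 0.
    rewrite qE /z !lformE (lformC a w) (lformC p w).
    have -> : (k * lform e a + l * lform e p) * (lform f p * lform w a - lform f a * lform w p) =
      k * (lform f p * lform e a * lform w a - lform f a * (lform w p * lform e a)) +
      l * (lform f p * (lform e p * lform w a) - lform e p * lform f a * lform w p) by ring.
    have -> : lform f p * lform e a * lform w a - lform f a * (lform w p * lform e a) = 0.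
      by rewrite ef ew; ring.
    have -> : lform f p * (lform e p * lform w a) - lform e p * lform f a * lform w p = 0.
      by rewrite -ew -ef; ring.
    by rewrite !mulr0 addr0.
  by move=> /eqP; rewrite mulf_eq0 (negbTE eq) => /eqP.
have z0 : z = 0 by apply: (cyclide_disjoint hD); [apply: (cyclide_perp (dupin_cyclideC hD))|
  apply: (cyclide_perp hD)].
have fp : lform f p = 0.
  apply/eqP/negP => /negP fp; case/negP: ap; apply/vlineP; exists ((lform f p)^-1 * lform f a).
  move: z0 => /eqP; rewrite subr_eq0 => /eqP zE.
  by rewrite -scalerA -zE scalerA mulVf// scale1r.
have fa : lform f a = 0.
  move: z0; rewrite /z fp scale0r sub0r => /eqP; rewrite oppr_eq0 scaler_eq0 (negbTE p0) orbF.
  by move/eqP.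
by move: fq; rewrite qE !lformE fp fa !mulr0 addr0 eqxx.
Qed.

Lemma complement_direction : exists c, [/\ c \in <<[:: a; p]>>%VS, c != 0 & b0 \notin <[c]>%VS].
Proof.
case: (boolP (b0 \in <[p]>%VS)) => [bp|bp]; last by exists p; rewrite memv_span2r.
exists a; split; first exact: memv_span2l.
  by apply: contraNneq ap => ->; rewrite mem0v.
apply/negP => ba; case/negP: ap; have /vlineP[k bE] := bp.
by apply: (subvP _ _ (memv_lineC b00 ba)); apply/subvP => v /vlineP[l ->]; rewrite memvZ.
Qed.

(** A straight line in span{a,p} and two conics are taken as curves. The squared lengths of the
    three partial derivatives are, up to nonzero factors, the squares of the minor and of the two
    weights, so it suffices to start at spheres where these three do not vanish and to shrink the
    box. *)
Lemma pencil_construction : exists lo hi b s1 s2 x u,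
  [/\ regular_pencil p D1 D2 a lo hi b s1 s2 x, lo 0 0 < u < hi 0 0 & b u = b0].
Proof.
have [c [cm c0 bc]] := complement_direction.
have [sig1 sig2 D12 _] := hD.
have [e1 [e2 [e3 [E1 [h1 h2 h3] [h12 h13 h23]]]]] := sig1.
have [f1 [f2 [f3 [E2 [g1 g2 g3] [g12 g13 g23]]]]] := sig2.
pose s1 := conic e1 e2 e3; pose s2 := conic f1 f2 f3; pose b (u : R) := b0 + u *: c.
have rs1 l h : regular_null_curve D1 l h s1 by rewrite E1; exact: conic_regular.
have rs2 l h : regular_null_curve D2 l h s2 by rewrite E2; exact: conic_regular.
have db (u : R) : is_derive u (1 : R) b c.
  have := der_add (der_cst u (1 : R) b0) (der_scale (is_derive_id u (1 : R)) (der_cst u (1 : R) c)).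
  by apply: is_derive_ext => //; rewrite scaler0 addr0 add0r scale1r.
have rb (l h : R) : regular_curve <<[:: a; p]>>%VS l h b.
  have oI : open `]l, h[%classic by exact: interval_open.
  split.
    exact: (smooth_vadd oI (smooth_vcst oI b0) (smooth_scale oI (smooth_id oI) (smooth_vcst oI c))).
  move=> u _; split; first by rewrite /b memvD ?memvZ.
  have [_ ->] := db u; rewrite free_cons span_seq1 seq1_free c0 andbT.
  apply: contra bc => /vlineP[k bE]; apply/vlineP; exists (k - u).
  by rewrite scalerBl -bE /b addrK.
have [u1 [u2 [w1 w2 m0]]] : exists u1 u2, [/\ lform (s1 u1) q != 0, lform (s2 u2) q != 0 &
    pencil_minor p a (s1 u1) (s2 u2) != 0].
  have [e [f [eD fD ef]]] := minor_exists.
  (* [e] and [f] need not be null. The minor is linear in each of them, so first [f] and then [e]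
     can be replaced by points of the conics. *)
  have [u2 [w2 m2]] : exists u, lform (s2 u) q != 0 /\
      lform (s2 u) (lform e a *: p - lform e p *: a) != 0.
    apply: conic_choose; rewrite -E2; first exact: perp_exists (dupin_cyclideC hD) q1.
    by exists f => //; rewrite !lformE mulrC.
  have [u1 [w1 m1]] : exists u, lform (s1 u) q != 0 /\
      lform (s1 u) (lform (s2 u2) p *: a - lform (s2 u2) a *: p) != 0.
    apply: conic_choose; rewrite -E1; first exact: perp_exists hD q2.
    exists e => //; apply: contraNneq m2; rewrite !lformBr !lformZr => h; apply/eqP.
    by rewrite -h; ring.
  exists u1, u2; split=> //; apply: contraNneq m1; rewrite /pencil_minor !lformBr !lformZr => h.
  by apply/eqP; rewrite -h; ring.
have wE s : pencil_weight p b0 s = lform s q by rewrite lformBr !lformZr.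
pose t : par := \row_i (if i == 0 then 0 else if i == 1 then u1 else u2).
have t0 : t 0 0 = 0 by rewrite mxE.
have t1 : t 0 1 = u1 by rewrite mxE.
have t2 : t 0 2 = u2 by rewrite mxE.
pose lo0 := t - const_mx 1; pose hi0 := t + const_mx 1.
have Bt : box lo0 hi0 t by move=> i; rewrite !mxE; lra.
pose X := pencil_map p b s1 s2.
have sX : smooth_on (box lo0 hi0) X by exact: pencil_map_smooth (rb _ _) (rs1 _ _) (rs2 _ _).
have Xn lo hi s : box lo hi s -> lform (X s) (X s) = 0.
  exact: (pencil_map_null p b hD (rs1 _ _) (rs2 _ _)).
have [d0 d1 d2] := pencil_map_partial (rb _ _) (rs1 _ _) (rs2 _ _) Bt.
have bt : b (t 0 0) = b0 by rewrite t0 /b scale0r addr0.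
have [s1D ds1D fs1 s1n _] := null_curve_frame (rs1 _ _) (Bt 1).
have [s2D ds2D fs2 s2n _] := null_curve_frame (rs2 _ _) (Bt 2).
have ds1 := null_curve_spacelike sig1 (rs1 _ _) (Bt 1).
have ds2 := null_curve_spacelike sig2 (rs2 _ _) (Bt 2).
have s10 : s1 (t 0 1) != 0 by apply: (free_not0 fs1); rewrite inE eqxx.
have s20 : s2 (t 0 2) != 0 by apply: (free_not0 fs2); rewrite inE eqxx.
have Xt : X t != 0.
  have s21 : s2 (t 0 2) \notin <[s1 (t 0 1)%R]>%VS.
    apply/negP => /vlineP[k s2E]; move/eqP: s20; apply.
    by apply: (cyclide_disjoint hD _ s2D); rewrite s2E memvZ.
  apply/eqP => X0; have [_ + _] := pencil_point_eq0 s1n s2n (D12 _ _ s1D s2D) s10 s21 X0.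
  by rewrite bt wE t1 => h; rewrite h eqxx in w1.
have dt : forall i, lform (partial i X t) (partial i X t) != 0.
  apply: ord3_split.
  - rewrite (pencil_map_velocity_norm pp hD (rb _ _) (rs1 _ _) (rs2 _ _) Bt).
    have [b1 [b2 [c1 [c2 [bE dE det]]]]] := pencil_plane (rb _ _) Bt.
    by apply: expf_neq0; rewrite (pencil_speedE pp bE dE) t1 t2 !mulf_neq0// ?pnatr_eq0.
  - rewrite d1 pencil_point_norm1//; last by rewrite lformC D12.
    have n2 : lform (s2 (t 0 2)) q != 0 by rewrite t2.
    by rewrite bt wE; exact: (mulf_neq0 (expf_neq0 2 n2) (lt0r_neq0 ds1)).
  - rewrite d2 pencil_point_norm2//; last by rewrite D12.
    have n1 : lform (s1 (t 0 1)) q != 0 by rewrite t1.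
    by rewrite bt wE; exact: (mulf_neq0 (expf_neq0 2 n1) (lt0r_neq0 ds2)).
have oB := @box_open R lo0 hi0.
have near_neq0 (f : par -> R) : smooth_on (box lo0 hi0) f -> f t != 0 ->
    \forall s \near t, f s != 0.
  move=> /smooth_on_continuous/(_ Bt) fc ft; have := fc [set r | r != 0].
  by apply; exact: (open_nbhs_nbhs (conj (@open_neq _ 0) ft)).
have [j Xj] := row_coord_neq0 Xt.
have nX := near_neq0 _ (smooth_coord oB j sX) Xj.
have nd i := near_neq0 _ (smooth_lform oB (smooth_on_derive (delta_mx 0 i) sX)
  (smooth_on_derive (delta_mx 0 i) sX)) (dt i).
have [e [e0 eP]] : exists e : R, 0 < e /\ forall s, box (t - const_mx e) (t + const_mx e) s ->
    box lo0 hi0 s /\ (X s != 0 /\ forall i, lform (partial i X s) (partial i X s) != 0).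
  apply: near_small_box; near=> s; split; first by near: s; exact: near_box.
  split; first by apply/rV0Pn; exists j; near: s.
  by move=> i; move: i; near: s; apply: filter_forall.
exists (t - const_mx e), (t + const_mx e), b, s1, s2, X, 0.
split; last by rewrite /b scale0r addr0.
- split; [|exact: rb|by split|split|].
  + by move=> i; rewrite !mxE ltrBlDr -addrA ltrDl addr_gt0.
  + by apply: smooth_on_sub sX => s /eP[].
  + move=> s Bs; have [Bs0 [Xs ds]] := eP s Bs.
    split; [exact: Xn Bs|exact: pencil_map_p|].
    apply: (@orth_frame_free _ p _ (fun i => partial i X s)).
    apply: (point_map_frame pp sX (fun t => @Xn lo0 hi0 t) _ Bs0 Xs) => //.
    * by move=> r _; exact: pencil_map_p.
    * by move=> i k; exact: (pencil_map_orth pp hD (rb _ _) (rs1 _ _) (rs2 _ _) Bs0).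
    * move=> i; apply: contra (ds i) => /vlineP[k ->].
      by rewrite lformZl lformZr (Xn lo0 hi0 s Bs0) !mulr0.
  + by move=> s Bs bb; exact: pencil_point_mem.
- by rewrite !mxE /= sub0r add0r oppr_lt0 e0.
Unshelve. all: by end_near. Qed.
End Construct.
End PencilConstruction.

(** * Dupin's theorem *)

Section Schwarz.
Variable R : realType.
Local Notation par := 'rV[R]_3.
Variables lo hi : par.
Local Notation B := (box lo hi).

Lemma mvt_line (f : par -> R) s v (h : R) : 0 < h ->
  (forall r, 0 <= r <= h -> derivable f (s + r *: v) v) ->
  exists2 r, 0 <= r <= h & f (s + h *: v) - f s = 'D_v f (s + r *: v) * h.
Proof.
move=> h0 fd.
have gd r : 0 <= r <= h -> is_derive r (1 : R) (fun r => f (s + r *: v)) ('D_v f (s + r *: v)).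
  by move=> /fd /derivableP; exact: is_derive_line.
have gd' (r : R) : r \in `]0, h[ -> is_derive r (1 : R) (fun r => f (s + r *: v)) ('D_v f (s + r *: v)).
  by rewrite in_itv/= => /andP[r0 rh]; apply: gd; rewrite !ltW.
have gc : {within `[0, h], continuous (fun r => f (s + r *: v))}.
  by apply: derivable_within_continuous => r; rewrite in_itv/= => rh; case: (gd r rh).
have [r rh e] := MVT_segment (ltW h0) gd' gc.
exists r; first by move: rh; rewrite in_itv.
by move: e; rewrite scale0r addr0 subr0.
Qed.

Lemma near_small_square (t : par) i j (P : par -> Prop) : (\forall s \near t, P s) ->
  exists2 h : R, 0 < h & forall r q : R, 0 <= r <= h -> 0 <= q <= h ->
    P (t + r *: delta_mx 0 i + q *: delta_mx 0 j).
Proof.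
(* A quarter of [e] leaves room for the case [i = j], where the two increments add up. *)
move=> /near_small_box[e [e0 eP]]; exists (e / 4); first by rewrite divr_gt0.
move=> r q rh qh; apply: eP => l; rewrite !mxE !eqxx/=.
by case: (l == i); case: (l == j); rewrite /= ?mulr1 ?mulr0; lra.
Qed.

Let halves (k l m e : R) : `|k - m| <= e / 2 -> `|l - m| <= e / 2 -> `|k - l| <= e.
Proof. by rewrite !ler_norml; lra. Qed.

Let second_difference (f : par -> R) (t : par) i j (h : R) : smooth_on B f -> 0 < h ->
  (forall r q : R, 0 <= r <= h -> 0 <= q <= h ->
    B (t + r *: delta_mx 0 i + q *: delta_mx 0 j)) ->
  exists r q : R, [/\ 0 <= r <= h, 0 <= q <= h &
    f (t + h *: delta_mx 0 i + h *: delta_mx 0 j) - f (t + h *: delta_mx 0 i)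
    - (f (t + h *: delta_mx 0 j) - f t) =
    'D_(delta_mx 0 j) ('D_(delta_mx 0 i) f) (t + r *: delta_mx 0 i + q *: delta_mx 0 j) * h * h].
Proof.
move=> sf h0 hB; set u := delta_mx 0 i; set v := delta_mx 0 j.
have hh : 0 <= h <= h by rewrite lexx ltW.
have h00 : 0 <= (0 : R) <= h by rewrite lexx ltW.
have e1 r : t + h *: v + r *: u = t + r *: u + h *: v by rewrite addrAC.
pose g s := f (s + h *: v) - f s.
have gd r : 0 <= r <= h -> is_derive (t + r *: u) u g
    ('D_u f (t + r *: u + h *: v) - 'D_u f (t + r *: u)).
  move=> rh; apply: der_sub.
    have fd : is_derive (t + r *: u + h *: v) u f ('D_u f (t + r *: u + h *: v)).
      by apply: smooth_on_derivable sf _; exact: hB.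
    have : is_derive (t + h *: v + r *: u) u f ('D_u f (t + r *: u + h *: v)) by rewrite e1.
    move=> /is_derive_line fl.
    have sl : (fun r => f (t + h *: v + r *: u)) = (fun r => f (t + r *: u + h *: v)).
      by apply/funext => q; rewrite e1.
    rewrite sl in fl; apply: DeriveDef.
      by apply/(derivable_line (fun s => f (s + h *: v))); case: fl.
    by rewrite (derive_line (fun s => f (s + h *: v))); case: fl.
  apply: smooth_on_derivable sf _; rewrite -[_ + r *: u]addr0 -(scale0r v); exact: hB.
have [r rh gE] : exists2 r, 0 <= r <= h & g (t + h *: u) - g t = 'D_u g (t + r *: u) * h.
  by apply: (mvt_line (f := g) h0) => r rh; case: (gd r rh).
have [_ gr] := gd r rh; rewrite gr in gE.
have [q qh qE] : exists2 q, 0 <= q <= h & 'D_u f (t + r *: u + h *: v) - 'D_u f (t + r *: u) =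
    'D_v ('D_u f) (t + r *: u + q *: v) * h.
  apply: (mvt_line (f := 'D_u f) h0) => q qh; have : B (t + r *: u + q *: v) by exact: hB.
  by move=> /(smooth_on_derivable v (smooth_on_derive u sf))[].
by exists r, q; split; [exact: rh|exact: qh|rewrite -qE -gE].
Qed.

(** The second difference over a small square is symmetric in the two directions, and the mean value
    theorem expresses it by either mixed derivative at some point of the square. Continuity brings
    both points to [t]. *)
Lemma schwarz (f : par -> R) t i j : smooth_on B f -> B t ->
  'D_(delta_mx 0 i) ('D_(delta_mx 0 j) f) t = 'D_(delta_mx 0 j) ('D_(delta_mx 0 i) f) t.
Proof.
move=> sf Bt; set u := delta_mx 0 i; set v := delta_mx 0 j.
have c1 := smooth_on_continuous (smooth_on_derive u (smooth_on_derive v sf)) Bt.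
have c2 := smooth_on_continuous (smooth_on_derive v (smooth_on_derive u sf)) Bt.
apply/eqP; rewrite -subr_eq0 -normr_le0; apply/ler_addgt0Pr => e e0.
have e20 : 0 < e / 2 by rewrite divr_gt0.
have n1 : \forall s \near t, `|'D_u ('D_v f) t - 'D_u ('D_v f) s| <= e / 2.
  by move: c1 => /cvgrPdist_le; apply.
have n2 : \forall s \near t, `|'D_v ('D_u f) t - 'D_v ('D_u f) s| <= e / 2.
  by move: c2 => /cvgrPdist_le; apply.
have [h h0 hP] : exists2 h : R, 0 < h & forall r q : R, 0 <= r <= h -> 0 <= q <= h ->
    let s := t + r *: u + q *: v in [/\ B s, `|'D_u ('D_v f) t - 'D_u ('D_v f) s| <= e / 2 &
      `|'D_v ('D_u f) t - 'D_v ('D_u f) s| <= e / 2].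
  apply: (@near_small_square t i j (fun s => [/\ B s, `|'D_u ('D_v f) t - 'D_u ('D_v f) s| <= e / 2 &
      `|'D_v ('D_u f) t - 'D_v ('D_u f) s| <= e / 2])).
  apply: filterS (filterI (near_box Bt) (filterI n1 n2)) => s [b [q1 q2]].
  by split; [exact: b|exact: q1|exact: q2].
have [r [q [rh qh E1]]] := second_difference (i := i) (j := j) sf h0
  (fun r q rh qh => let: And3 b _ _ := hP r q rh qh in b).
have [r' [q' [rh' qh' E2]]] : exists r q : R, [/\ 0 <= r <= h, 0 <= q <= h &
    f (t + h *: v + h *: u) - f (t + h *: v) - (f (t + h *: u) - f t) =
    'D_u ('D_v f) (t + r *: v + q *: u) * h * h].
  apply: (second_difference sf h0) => r1 q1 rh1 qh1; rewrite addrAC.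
  by case: (hP q1 r1 qh1 rh1).
rewrite -/u -/v in E1.
have E : 'D_v ('D_u f) (t + r *: u + q *: v) = 'D_u ('D_v f) (t + r' *: v + q' *: u).
  have hh0 : h * h != 0 by rewrite mulf_neq0 ?gt_eqF.
  apply: (mulIf hh0); apply: (etrans (mulrA _ _ _)); apply: (etrans (esym E1)).
  apply: (etrans _ (esym (mulrA _ _ _))); apply: (etrans _ E2); rewrite (addrAC t (h *: v)).
  move: (f (t + h *: u + h *: v)) (f (t + h *: u)) (f (t + h *: v)) (f t) => k1 k2 k3 k4.
  by ring.
have [_ _ b1] := hP r q rh qh; have [_ b2 _] := hP q' r' qh' rh'.
rewrite add0r; rewrite E in b1; rewrite (addrAC t (q' *: u)) in b2.
exact: halves b2 b1.
Qed.

Lemma schwarz_rV n (f : par -> 'rV[R]_n) t i j : smooth_on B f -> B t ->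
  'D_(delta_mx 0 i) ('D_(delta_mx 0 j) f) t = 'D_(delta_mx 0 j) ('D_(delta_mx 0 i) f) t.
Proof.
move=> sf Bt; have oB := @box_open R lo hi; apply/rowP => l.
have D1 v s : B s -> 'D_v f s 0 l = 'D_v (fun t => f t 0 l) s.
  by move=> Bs; have /is_derive_mxP/(_ 0 l)[] := smooth_on_derivable v sf Bs.
have D2 u v : 'D_u ('D_v f) t 0 l = 'D_u ('D_v (fun t => f t 0 l)) t.
  have /is_derive_mxP/(_ 0 l)[_ <-] := smooth_on_derivable u (smooth_on_derive v sf) Bt.
  by apply: (derive_eq_on oB) => // s Bs; exact: D1.
apply: (etrans (D2 _ _)); apply: (etrans _ (esym (D2 _ _))).
exact: (schwarz i j (smooth_coord oB l sf) Bt).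
Qed.
End Schwarz.

(** Applying the two symmetries alternately, three times each, returns to the same triple of indices
    with the sign -1. *)
Lemma mixed_symmetry_eq0 (R : realType) (I : eqType) (L : I -> I -> I -> R) :
  (forall i j k, j != k -> L i j k = - L i k j) -> (forall i j k, L i j k = L j i k) ->
  forall i j k, i != j -> j != k -> i != k -> L i j k = 0.
Proof.
move=> anti sym i j k ij jk ik; have ki : k != i by rewrite eq_sym.
have : L i j k = - L i j k.
  by rewrite {1}(anti i j k jk) (sym i k j) (anti k i j ij) opprK (sym k j i)
    (anti j k i ki) (sym j i k).
by move=> h; lra.
Qed.

Section TriplyOrthogonal.
Variable R : realType.
Local Notation vec := 'rV[R]_6.
Local Notation par := 'rV[R]_3.
Variables (p : vec) (lo hi : par) (F : 'I_3 -> par -> {vspace vec}) (x : par -> vec).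
Local Notation B := (box lo hi).
Hypothesis pp : lform p p = -1.
Hypothesis legendre : forall i, legendre_family lo hi i (F i).
Hypothesis hx : point_immersion p lo hi x.
Hypothesis xF : forall i t, B t -> x t \in F i t.
Hypothesis orthF : forall i j t, i != j -> B t ->
  forall s1 s2, s1 \in F i t -> s2 \in F j t -> orthogonal_spheres p s1 s2.
Local Notation d i := (partial i x).
Let pp0 : lform p p < 0. Proof. by rewrite pp ltrN10. Qed.
Let oB := @box_open R lo hi.

Lemma tos_smooth : smooth_on B x. Proof. by case: hx. Qed.

Lemma tos_null t : B t -> lform (x t) (x t) = 0.
Proof. by case: hx => _ h /h[]. Qed.

Lemma tos_p t : B t -> lform (x t) p = 0.
Proof. by case: hx => _ h /h[]. Qed.

Let Fc i t : B t -> contact_element (F i t).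
Proof. by have [[h _] _] := legendre i; exact: h. Qed.

Lemma tos_frame_sections i : exists S1 S2, [/\ section_of lo hi (F i) S1,
  section_of lo hi (F i) S2 & forall t, B t -> F i t = <<[:: S1 t; S2 t]>>%VS].
Proof.
have [[_ [S1 [S2 [sS1 sS2 FE]]]] _] := legendre i; exists S1, S2.
by split=> //; split=> // t Bt; rewrite FE// ?memv_span2l ?memv_span2r.
Qed.

Lemma tos_legendre i j t v S : j != i -> B t -> v \in F i t -> section_of lo hi (F i) S ->
  lform v (partial j S t) = 0.
Proof.
move=> ji Bt vF sS; have [S1 [S2 [sS1 sS2 FE]]] := tos_frame_sections i.
have [_ L] := legendre i; rewrite FE// in vF.
by rewrite lformC; apply: lform_spanr vF; rewrite lformC; apply: L.
Qed.

Let x_section i : section_of lo hi (F i) x.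
Proof. by split; [exact: tos_smooth|move=> t; exact: xF]. Qed.

Let normal i t : B t -> exists v, v \in F i t /\ lform v p != 0.
Proof.
move=> Bt; have [S1 [S2 [_ _ FE]]] := tos_frame_sections i.
have [x0 _] := immersion_partial 0 hx Bt; have hc := Fc i Bt.
apply: contrapT => H; have Fp v : v \in F i t -> lform v p = 0.
  by move=> vF; apply/eqP/negP => /negP vp; apply: H; exists v.
have Fx : (F i t <= <[x t]>)%VS.
  apply/subvP => v vF; apply: (timelike_perp_line pp0 x0); rewrite ?Fp ?xF//.
  - exact: contact_element_orth hc (xF i Bt) (xF i Bt).
  - exact: contact_element_orth hc (xF i Bt) vF.
  - by rewrite (contact_element_orth hc vF vF).
by have [d2 _] := hc; have := dimvS Fx; rewrite d2 dim_vline; case: (_ != _).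
Qed.

(** Each [F i t] contains a sphere [n i] not orthogonal to [p]. Orthogonality of the surfaces makes
    the projections [N i] to the complement of [p] mutually orthogonal, and the Legendre condition
    leaves for [d i t] only a combination of [x t] and [N i]. Undoing the projection gives the root
    [G]. *)
Lemma tos_frame t : B t -> orth_frame p (x t) (fun i => d i t) /\
  forall i, exists G, G ^+ 2 = lform (d i t) (d i t) /\ d i t + G *: p \in F i t.
Proof.
move=> Bt; have xx := tos_null Bt; have xp := tos_p Bt.
have /choice[n nP] i : exists v, v \in F i t /\ lform v p != 0 by exact: normal.
have nn i : lform (n i) (n i) = 0 by apply: contact_element_orth (Fc i Bt) _ _; case: (nP i).
have xn i : lform (x t) (n i) = 0.
  by apply: (contact_element_orth (Fc i Bt) (xF i Bt)); case: (nP i).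
have [N NE] : exists N : 'I_3 -> vec, forall i, N i = n i + lform (n i) p *: p.
  by exists (fun i => n i + lform (n i) p *: p).
have x0 : x t != 0 by have [] := immersion_partial 0 hx Bt.
have fN : orth_frame p (x t) N.
  split=> //.
  - by move=> i; rewrite NE !lformE xn xp pp; split; ring.
  - move=> i j ij; have := orthF ij Bt (proj1 (nP i)) (proj1 (nP j)).
    rewrite /orthogonal_spheres !NE !lformE pp (lformC p) => h.
    by rewrite -h; ring.
  - move=> i; have -> : lform (N i) (N i) = lform (n i) p ^+ 2.
      by rewrite NE !lformE nn pp (lformC p); ring.
    by rewrite exprn_even_gt0 //= (proj2 (nP i)).
have dN i : exists b c, b != 0 /\ d i t = c *: x t + b *: N i.
  have [xd dp] := point_map_d tos_smooth tos_null tos_p i Bt.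
  have [c [b [e dE]]] : exists a b c, d i t = a *: x t + b *: N i + c *: p.
    apply: (orth_frame_normal pp fN) => // j ji.
    rewrite lformC NE !lformE (lformC p) dp mulr0 addr0.
    by apply: tos_legendre (proj1 (nP j)) (x_section j); rewrite // eq_sym.
  have [_ _ /(_ i)[_ Np] _ _] := fN.
  have e0 : e = 0 by move: dp; rewrite dE !lformE xp Np pp => h; lra.
  exists b, c; split; last by rewrite dE e0 scale0r addr0.
  have [_] := immersion_partial i hx Bt; apply: contraNneq => b0.
  by rewrite dE e0 b0 !scale0r !addr0 memvZ ?memv_line.
have [_ _ xN NN NN0] := fN; split.
  split=> //.
  - by move=> i; exact: (point_map_d tos_smooth tos_null tos_p i Bt).
  - move=> i j ij; have [b [c [_ ->]]] := dN i; have [b' [c' [_ ->]]] := dN j.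
    by rewrite !lformE xx (NN i j)// !(lformC _ (x t)) !(proj1 (xN _)); ring.
  - move=> i; have [b [c [b0 ->]]] := dN i.
    have -> : lform (c *: x t + b *: N i) (c *: x t + b *: N i) = b ^+ 2 * lform (N i) (N i).
      by rewrite !lformE xx !(lformC _ (x t)) !(proj1 (xN _)); ring.
    by rewrite mulr_gt0// exprn_even_gt0.
move=> i; have [b [c [b0 dE]]] := dN i; exists (- b * lform (n i) p); split.
  rewrite dE !lformE xx !(lformC _ (x t)) !(proj1 (xN _)).
  have -> : lform (N i) (N i) = lform (n i) p ^+ 2.
    by rewrite NE !lformE nn pp (lformC p); ring.
  by ring.
have -> : d i t + (- b * lform (n i) p) *: p = c *: x t + b *: n i.
  by rewrite dE NE scalerDr scalerA mulNr scaleNr addrA addrK.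
by rewrite memvD ?memvZ ?xF//; case: (nP i).
Qed.

Let sd i : smooth_on B (d i). Proof. exact: smooth_on_derive tos_smooth. Qed.

Lemma tos_orth i j t : i != j -> B t -> lform (d i t) (d j t) = 0.
Proof. by move=> ij Bt; have [[_ _ _ h _] _] := tos_frame Bt; apply: h. Qed.

(* Dupin's theorem: <d_i d_j x, d_k x> is symmetric in i, j and antisymmetric in
   j, k, hence vanishes. *)
Lemma dupin_theorem i j k t : i != j -> j != k -> i != k -> B t ->
  lform (partial i (d j) t) (d k t) = 0.
Proof.
move=> ij jk ik Bt.
have anti a b c : b != c -> lform (partial a (d b) t) (d c t) = - lform (partial a (d c) t) (d b t).
  move=> bc; apply/eqP; rewrite -subr_eq0 opprK; apply/eqP.
  have := lform0_derive (delta_mx 0 a) (sd b) (sd c) Bt (fun s Bs => tos_orth bc Bs).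
  by rewrite (lformC (d b t)).
have sym a b c : lform (partial a (d b) t) (d c t) = lform (partial b (d a) t) (d c t).
  have e : partial a (d b) t = partial b (d a) t by exact: (schwarz_rV a b tos_smooth Bt).
  by rewrite e.
exact: (mixed_symmetry_eq0 anti sym ij jk ik).
Qed.
End TriplyOrthogonal.

(** * Slices by Dupin cyclides *)

Lemma ord3_cases (i j k l : 'I_3) : i != j -> i != k -> j != k ->
  [|| l == i, l == j | l == k].
Proof.
by case: i => [[|[|[|//]]] ?]; case: j => [[|[|[|//]]] ?]; case: k => [[|[|[|//]]] ?];
  case: l => [[|[|[|//]]] ?].
Qed.

Section DirectionConstant.
Variable R : realType.

Lemma interval_constant (f : R -> R) (l h : R) :
  (forall u, l < u < h -> is_derive u (1 : R) f 0) ->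
  forall u v, l < u < h -> l < v < h -> f u = f v.
Proof.
move=> fd; suff H u v : u <= v -> l < u < h -> l < v < h -> f u = f v.
  move=> u v ui vi; have [uv|/ltW vu] := lerP u v; first exact: H.
  by apply/esym/H.
move=> uv ui vi; have Iu w : u <= w <= v -> l < w < h by move=> wi; lra.
have gd (w : R) : w \in `]u, v[ -> is_derive w (1 : R) f 0.
  by rewrite in_itv/= => wi; apply/fd/Iu; lra.
have gc : {within `[u, v], continuous f}.
  by apply: derivable_within_continuous => w; rewrite in_itv/= => /Iu/fd[].
have [w _ e] := MVT_segment uv gd gc.
by apply/esym/eqP; rewrite -subr_eq0 e mul0r.
Qed.

(* The quotients of the coordinates by a nonvanishing one have derivative 0. *)
Lemma direction_constant n (f df : R -> 'rV[R]_n) (l h : R) j :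
  (forall u, l < u < h -> [/\ is_derive u (1 : R) f (df u), df u \in <[f u]>%VS & f u 0 j != 0]) ->
  forall u v, l < u < h -> l < v < h -> f u \in <[f v]>%VS.
Proof.
move=> fd u v ui vi; have [_ _ fv] := fd v vi; have [_ _ fu] := fd u ui.
have q k : f u 0 k / f u 0 j = f v 0 k / f v 0 j.
  apply: (interval_constant (f := fun w => f w 0 k / f w 0 j) (l := l) (h := h)) => // w wi.
  have [/is_derive_mxP fw /vlineP[c dc] fw0] := fd w wi.
  have dj := fw 0 j; have dk := fw 0 k.
  have iv : is_derive w (1 : R) (fun w => (f w 0 j)^-1) (- (f w 0 j) ^- 2 *: df w 0 j).
    have [dd <-] := dj; apply: DeriveDef; first exact: derivableV.
    by rewrite deriveV.
  have := der_mul dk iv; apply: is_derive_ext => //.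
  by rewrite dc !mxE -[_ *: _]/(_ * _); field.
apply: (minors_line fv) => k; have /eqP := q k; rewrite eqr_div// => /eqP e.
by rewrite mulrC -e.
Qed.
End DirectionConstant.

(** Without its [d m] component, [u] is a combination of [x], [d i] and [p]; orthogonality to the
    null vector [d i + G *: p] forces the last two coefficients into the ratio [1 : G]. *)
Lemma orth_frame_decomposition (R : realType) (p x : 'rV[R]_6) d i m l G u :
  lform p p = -1 -> orth_frame p x d -> m != i -> l != i -> m != l ->
  G ^+ 2 = lform (d i) (d i) ->
  lform u x = 0 -> lform u (d i + G *: p) = 0 -> lform u (d l) = 0 ->
  exists a b e, u = a *: x + b *: (d i + G *: p) + e *: d m.
Proof.
move=> pp hf mi li ml GE ux un ul; have [x0 [xx xp] xd dd dp] := hf.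
pose e := lform u (d m) / lform (d m) (d m).
have im : lform (d i) (d m) = 0 by rewrite dd// eq_sym.
have [a [b [b' vE]]] : exists a b b', u - e *: d m = a *: x + b *: d i + b' *: p.
  apply: (orth_frame_normal pp hf).
    by rewrite lformBr lformZr (lformC x) ux (proj1 (xd m)) mulr0 subrr.
  move=> n ni; rewrite lformBl lformZl.
  have /or3P[/eqP nE|/eqP->|/eqP->] : [|| n == i, n == m | n == l].
  - by apply: ord3_cases; rewrite // eq_sym.
  - by rewrite nE eqxx in ni.
  - by rewrite /e divfK ?subrr// gt_eqF.
  - by rewrite ul dd// mulr0 subrr.
have G0 : G != 0 by rewrite -sqrf_eq0 GE gt_eqF.
have bb : b' = b * G.
  have := congr1 (fun v => lform v (d i + G *: p)) vE.
  rewrite /= lformBl lformZl un !lformE xp (proj1 (xd i)) (proj2 (xd i)) (lformC (d m)) im.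
  rewrite (proj2 (xd m)) (lformC p) (proj2 (xd i)) pp -GE => h.
  by apply: (mulIf G0); lra.
exists a, b, e; rewrite -[LHS](subrK (e *: d m)) vE bb scalerDr scalerA addrA.
by [].
Qed.

Section Slices.
Variable R : realType.
Local Notation vec := 'rV[R]_6.
Local Notation par := 'rV[R]_3.

(** The only consequence of regularity used from here on: over no subinterval does the curve stay in
    a subspace that misses part of [D]. In this form it passes to smaller intervals and to reflected
    curves. *)
Definition spanning_curve (D : {vspace vec}) (l h : R) (s : R -> vec) : Prop :=
  (forall u, l < u < h -> [/\ s u \in D, s u != 0, lform (s u) (s u) = 0 &
     {for u, continuous s}]) /\
  forall l' h' (W : {vspace vec}), l <= l' -> l' < h' -> h' <= h ->
    (forall u, l' < u < h' -> s u \in W) -> (D <= W)%VS.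

Lemma spanning_curve_sub D l h l1 h1 s : l <= l1 -> h1 <= h ->
  spanning_curve D l h s -> spanning_curve D l1 h1 s.
Proof.
move=> ll hh [sD sW]; split; first by move=> u ui; apply: sD; lra.
by move=> l' h' W ll' lh hh'; apply: sW => //; lra.
Qed.

Variables (p : vec) (lo hi : par) (F : 'I_3 -> par -> {vspace vec}) (x : par -> vec).
Local Notation B := (box lo hi).
Hypothesis pp : lform p p = -1.
Hypothesis legendre : forall i, legendre_family lo hi i (F i).
Hypothesis hx : point_immersion p lo hi x.
Hypothesis xF : forall i t, B t -> x t \in F i t.
Hypothesis orthF : forall i j t, i != j -> B t ->
  forall s1 s2, s1 \in F i t -> s2 \in F j t -> orthogonal_spheres p s1 s2.
Local Notation d i := (partial i x).
Let oB := @box_open R lo hi.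
Let sx := tos_smooth hx.
Let frame t (Bt : B t) := tos_frame pp legendre hx xF orthF Bt.

Section Slice.
Variables (i : 'I_3) (c : R).

(** Membership is asked only on the slice: the splitting belongs to that single cyclide, so a
    curvature sphere field projected from a section need not lie in [F i] elsewhere. Only
    derivatives tangent to the slice are then usable. *)
Definition slice_section (f : par -> vec) :=
  smooth_on B f /\ forall t, B t -> t 0 i = c -> f t \in F i t.

Lemma slice_lform0 f g t m : smooth_on B f -> smooth_on B g -> m != i ->
  B t -> t 0 i = c -> (forall s, B s -> s 0 i = c -> lform (f s) (g s) = 0) ->
  lform (partial m f t) (g t) + lform (f t) (partial m g t) = 0.
Proof.
move=> sf sg mi Bt tc h.
have Dt (e : par -> vec) : smooth_on B e ->
    is_derive (t 0 m) (1 : R) (fun u => e (upd t m u)) (partial m e t).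
  by move=> se; apply: is_derive_upd; rewrite upd_id; exact: (smooth_on_derivable _ se Bt).
have := der_lform (Dt f sf) (Dt g sg); rewrite upd_id; apply: derive_near0.
near=> u; apply: h; first by near: u; exact: near_upd.
by rewrite updE eq_sym (negbTE mi).
Unshelve. all: by end_near. Qed.

Lemma slice_perp f t m v : slice_section f -> m != i -> B t -> t 0 i = c ->
  v \in F i t -> lform (partial m f t) v = 0.
Proof.
move=> [sf fF] mi Bt tc; have [S1 [S2 [sS1 sS2 FE]]] := tos_frame_sections legendre i.
have H S : section_of lo hi (F i) S -> lform (partial m f t) (S t) = 0.
  move=> sS; have := slice_lform0 sf (proj1 sS) mi Bt tc
    (fun s Bs sc => contact_element_orth (proj1 (proj1 (legendre i)) s Bs) (fF s Bs sc) (proj2 sS s Bs)).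
  by rewrite (tos_legendre legendre mi Bt (fF t Bt tc) sS) addr0.
by rewrite FE//; apply: lform_spanr; exact: H.
Qed.

Lemma element_coord t v : B t -> v \in F i t ->
  exists a b G, v = a *: x t + b *: (d i t + G *: p) /\ G ^+ 2 = lform (d i t) (d i t).
Proof.
move=> Bt; have [hf /(_ i)[G [GE GF]]] := frame Bt.
have [x0 [xx xp] xd _ dd] := hf; have [[hc _] _] := legendre i; have [F2 _] := hc t Bt.
have -> : F i t = <<[:: x t; (d i t + G *: p)%R]>>%VS.
  apply/esym/eqP; rewrite eqEdim span2_subv xF// GF/= F2.
  have -> : \dim <<[:: x t; (d i t + G *: p)%R]>> = 2%N; last by [].
  rewrite span2C free_dim2//; apply/negP => /vlineP[e dE].
  have := congr1 (lform (d i t)) dE; rewrite !lformE (proj2 (xd i)) (lformC _ (x t)).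
  by rewrite (proj1 (xd i)) !mulr0 addr0 => e0; have := dd i; rewrite e0 ltxx.
by move=> /mem_span2P[a [b ->]]; exists a, b, G.
Qed.

Lemma slice_second f t m l : slice_section f -> m != i -> l != i -> B t -> t 0 i = c ->
  lform (partial m f t) (d l t) = - lform (f t) (partial m (d l) t).
Proof.
move=> sf mi li Bt tc; apply/eqP; rewrite -subr_eq0 opprK; apply/eqP.
apply: (slice_lform0 (proj1 sf) (smooth_on_derive (delta_mx 0 l) sx) mi Bt tc) => s Bs sc.
by apply: (tos_legendre legendre li Bs (proj2 sf s Bs sc)); split; [exact: sx|move=> r; exact: xF].
Qed.

(** After the derivative is moved to [d l], the value [f t] is expanded in [x t], [d i t] and [p],
    each orthogonal to the mixed derivative of [x]; for [d i t] this is Dupin's theorem. Coordinate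
    lines are thus curvature lines. *)
Lemma slice_cross f t m l : slice_section f -> m != i -> l != i -> m != l -> B t -> t 0 i = c ->
  lform (partial m f t) (d l t) = 0.
Proof.
move=> sf mi li ml Bt tc; rewrite slice_second//.
have [a [b [G [-> _]]]] := element_coord Bt (proj2 sf t Bt tc).
have sd n : smooth_on B (d n) by exact: smooth_on_derive sx.
have e1 : lform (x t) (partial m (d l) t) = 0.
  have := lform0_derive (delta_mx 0 m) sx (sd l) Bt
    (fun s Bs => proj1 (point_map_d sx (tos_null hx) (tos_p hx) l Bs)).
  by rewrite -/(partial m x) (tos_orth pp legendre hx xF orthF ml Bt) add0r.
have e2 : lform (d i t) (partial m (d l) t) = 0.
  by rewrite lformC; apply: (dupin_theorem pp legendre hx xF orthF).
have e3 : lform p (partial m (d l) t) = 0.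
  rewrite lformC; apply: (lformp0_derive (delta_mx 0 m) (sd l) Bt) => s Bs.
  exact: (proj2 (point_map_d sx (tos_null hx) (tos_p hx) l Bs)).
by rewrite !lformE e1 e2 e3 !(mulr0, addr0) oppr0.
Qed.

(** By [orth_frame_decomposition] the first derivative is a combination of [x t], the normal sphere
    and [d m t], and the second is orthogonal to all three. *)
Lemma slice_orth f g t m l : slice_section f -> slice_section g ->
  m != i -> l != i -> m != l -> B t -> t 0 i = c ->
  lform (partial m f t) (partial l g t) = 0.
Proof.
move=> sf sg mi li ml Bt tc; have lm : l != m by rewrite eq_sym.
have [hf /(_ i)[G [GE GF]]] := frame Bt.
have [a [b [e ->]]] := orth_frame_decomposition pp hf mi li ml GE
  (slice_perp sf mi Bt tc (xF i Bt)) (slice_perp sf mi Bt tc GF) (slice_cross sf mi li ml Bt tc).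
have wn := slice_perp sg li Bt tc GF; have wx := slice_perp sg li Bt tc (xF i Bt).
have wm := slice_cross sg li mi lm Bt tc.
move: (d i t + G *: p) (partial l g t) wn wx wm => n w wn wx wm.
by rewrite lformC !lformDr !lformZr wn wx wm; ring.
Qed.
End Slice.
End Slices.

Section Adapted.
Variable R : realType.
Local Notation vec := 'rV[R]_6.
Local Notation par := 'rV[R]_3.
Variables (p : vec) (lo hi : par) (F : 'I_3 -> par -> {vspace vec}) (x : par -> vec).
Local Notation B := (box lo hi).
Hypothesis pp : lform p p = -1.
Hypothesis legendre : forall i, legendre_family lo hi i (F i).
Hypothesis hx : point_immersion p lo hi x.
Hypothesis xF : forall i t, B t -> x t \in F i t.
Hypothesis orthF : forall i j t, i != j -> B t ->
  forall s1 s2, s1 \in F i t -> s2 \in F j t -> orthogonal_spheres p s1 s2.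
Let oB := @box_open R lo hi.
Let sx := tos_smooth hx.
Let Fc i t (Bt : B t) : contact_element (F i t) := proj1 (proj1 (legendre i)) t Bt.

Section Curvature.
Variables (i : 'I_3) (c : R).
Local Notation slice_section := (slice_section lo hi F i c).

Lemma slice_null f t : slice_section f -> B t -> t 0 i = c -> lform (f t) (f t) = 0.
Proof. by move=> [_ fF] Bt tc; apply: (contact_element_orth (Fc i Bt)); exact: fF. Qed.

Lemma slice_partial_mem f (D : {vspace vec}) t m : slice_section f -> (forall s, f s \in D) ->
  B t -> partial m f t \in D.
Proof.
move=> [sf _] fD Bt; apply: (derive_mem (smooth_on_derivable (delta_mx 0 m) sf Bt)).
by near=> s; exact: fD.
Unshelve. all: by end_near. Qed.

Section Curve.
Variables (D : {vspace vec}) (f : par -> vec) (t : par).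
Hypotheses (sD : signature21 D) (sf : slice_section f) (fD : forall s, f s \in D).
Hypotheses (Bt : B t) (tc : t 0 i = c) (f0 : f t != 0).

Let tangent : exists mu, 0 < lform mu mu /\ forall m, m != i ->
  exists a b, partial m f t = a *: f t + b *: mu /\ lform (f t) mu * b = 0.
Proof.
have [mu [mm mP]] := null_tangent sD (fD t) f0 (slice_null sf Bt tc).
exists mu; split=> // m mi.
have pf := slice_perp legendre sf mi Bt tc (proj2 sf t Bt tc).
have [a [b dE]] := mP _ (slice_partial_mem m sf fD Bt) pf; exists a, b; split=> //.
move: pf; rewrite dE lformC lformDr !lformZr slice_null//.
by rewrite mulr0 add0r mulrC.
Qed.

(** Turns failure of parallelism into nonvanishing of a smooth function, hence into an open
    condition. *)
Lemma slice_parallelP m : m != i ->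
  (partial m f t \in <[f t]>%VS) = (lform (partial m f t) (partial m f t) == 0).
Proof.
move=> mi; have [mu [mm /(_ m mi)[a [b [dE fb]]]]] := tangent.
have fn := slice_null sf Bt tc.
apply/idP/eqP => [/vlineP[k ->]|]; first by rewrite lformZl lformZr fn !mulr0.
rewrite dE !lformDl !lformDr !lformZl !lformZr fn (lformC mu) => h.
have b0 : b = 0.
  move: h; have -> : a * (a * 0) + a * (b * lform (f t) mu) + (b * (a * lform (f t) mu) + b * (b * lform mu mu)) =
    2 * a * (lform (f t) mu * b) + b ^+ 2 * lform mu mu by ring.
  rewrite fb mulr0 add0r => /eqP; rewrite mulf_eq0 (gt_eqF mm) orbF sqrf_eq0.
  by move/eqP.
by rewrite b0 scale0r addr0 memvZ ?memv_line.
Qed.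

Lemma slice_norm_ge0 m : m != i -> 0 <= lform (partial m f t) (partial m f t).
Proof.
move=> mi; have [mu [mm /(_ m mi)[a [b [dE fb]]]]] := tangent.
rewrite dE !lformDl !lformDr !lformZl !lformZr (slice_null sf Bt tc) (lformC mu).
have -> : a * (a * 0) + a * (b * lform (f t) mu) + (b * (a * lform (f t) mu) + b * (b * lform mu mu)) =
  2 * a * (lform (f t) mu * b) + b ^+ 2 * lform mu mu by ring.
by rewrite fb mulr0 add0r mulr_ge0 ?sqr_ge0// ltW.
Qed.

(** Modulo [f t] both derivatives are multiples of the same spacelike vector, and they are
    orthogonal, so one multiple is zero: a curvature sphere is stationary along one of the two
    coordinate directions. *)
Lemma slice_dichotomy m l : m != i -> l != i -> m != l ->
  (partial m f t \in <[f t]>%VS) || (partial l f t \in <[f t]>%VS).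
Proof.
move=> mi li ml; have [mu [mm mP]] := tangent.
have [a [b [dE fb]]] := mP m mi; have [a' [b' [dE' fb']]] := mP l li.
have := slice_orth pp legendre hx xF orthF sf sf mi li ml Bt tc.
have fn := slice_null sf Bt tc.
rewrite dE dE' !lformDl !lformDr !lformZl !lformZr fn (lformC mu).
have -> : a * (a' * 0) + a * (b' * lform (f t) mu) + (b * (a' * lform (f t) mu) + b * (b' * lform mu mu)) =
    a * (lform (f t) mu * b') + a' * (lform (f t) mu * b) + b * b' * lform mu mu by ring.
rewrite fb fb' !mulr0 !add0r => /eqP; rewrite mulf_eq0 (gt_eqF mm) orbF mulf_eq0.
by move=> /orP[] /eqP->; rewrite scale0r addr0 !memvZ ?memv_line ?orbT.
Qed.
End Curve.

Section TwoCurves.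
Variables (D1 D2 : {vspace vec}) (f h : par -> vec) (t : par).
Hypotheses (hD : dupin_cyclide D1 D2) (sf : slice_section f) (sh : slice_section h).
Hypotheses (fD : forall s, f s \in D1) (hD2 : forall s, h s \in D2).
Hypotheses (Bt : B t) (tc : t 0 i = c) (f0 : f t != 0) (h0 : h t != 0).

Lemma slice_span : F i t = <<[:: f t; h t]>>%VS /\ h t \notin <[f t]>%VS.
Proof.
have hf : h t \notin <[f t]>%VS.
  apply/negP => /vlineP[e hE]; move/eqP: h0; apply.
  by apply: (cyclide_disjoint hD _ (hD2 t)); rewrite hE memvZ.
split=> //; apply/esym/eqP; rewrite eqEdim span2_subv.
by rewrite (proj2 sf t Bt tc) (proj2 sh t Bt tc) span2C free_dim2//= (proj1 (Fc i Bt)).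
Qed.

(** If both curvature spheres were stationary along [m], the point sphere they span would be
    orthogonal to its second derivative, and its velocity would be null. *)
Lemma slice_not_both m : m != i -> partial m f t \in <[f t]>%VS ->
  partial m h t \in <[h t]>%VS -> False.
Proof.
move=> mi /vlineP[a fE] /vlineP[b hE].
have xm : section_of lo hi (F i) x by split; [exact: sx|move=> s; exact: xF].
have dm g : slice_section g -> lform (g t) (partial m x t) = 0.
  by move=> [_ gF]; exact: (tos_legendre legendre mi Bt (gF t Bt tc) xm).
have e1 : lform (f t) (partial m (partial m x) t) = 0.
  apply/eqP; rewrite -oppr_eq0 -(slice_second legendre hx xF sf mi mi Bt tc) fE.
  by rewrite lformZl dm// mulr0.
have e2 : lform (h t) (partial m (partial m x) t) = 0.
  apply/eqP; rewrite -oppr_eq0 -(slice_second legendre hx xF sh mi mi Bt tc) hE.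
  by rewrite lformZl dm// mulr0.
have xE : lform (x t) (partial m (partial m x) t) = 0.
  rewrite lformC; apply: (lform_spanr (u := f t) (v := h t)); rewrite 1?lformC//.
  by rewrite -(proj1 slice_span) xF.
have sd := smooth_on_derive (delta_mx 0 m) sx.
have := lform0_derive (delta_mx 0 m) sx sd Bt
  (fun s Bs => proj1 (point_map_d sx (tos_null hx) (tos_p hx) m Bs)).
rewrite -/(partial m x) xE addr0 => e.
have [[_ _ _ _ /(_ m) d0] _] := tos_frame pp legendre hx xF orthF Bt.
by rewrite /partial e ltxx in d0.
Qed.
End TwoCurves.

(** On the slice the contact element is spanned by one vector of [D1] and one of [D2], so projecting
    it to [D1] along [D2] stays inside it. Smooth curvature sphere fields come from smooth sections
    this way. *)
Lemma slice_projection D1 D2 S : dupin_cyclide D1 D2 -> dupin_surface D1 D2 lo hi i c (F i) ->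
  section_of lo hi (F i) S -> slice_section (fun t => daddv_pi D1 D2 (S t)).
Proof.
move=> hD hS [sS SF]; split.
  have pE v : daddv_pi D1 D2 v = \sum_j v 0 j *: daddv_pi D1 D2 (delta_mx 0 j).
    exact: row_linear_sum.
  apply: (smooth_rV oB) => l; under eq_fun do rewrite pE summxE.
  apply: (smooth_sum oB) => j; under eq_fun do rewrite mxE.
  exact: (smooth_mul oB (smooth_coord oB j sS) (smooth_cst oB _)).
move=> t Bt tc; have [s1 [s2 [s1D s2D _ _ FE]]] := hS t Bt tc.
have := SF t Bt; rewrite FE => /mem_span2P[a [b ->]].
rewrite linearD !linearZ/= (daddv_pi_id (cyclide_cap hD) s1D).
have -> : daddv_pi D1 D2 s2 = 0.
  have cap : (D2 :&: D1 = 0)%VS by rewrite capvC (cyclide_cap hD).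
  have := daddv_pi_add (cyclide_cap hD) (w := s2).
  rewrite (daddv_pi_id cap s2D) => h; apply/eqP; rewrite -(subr_eq0 _ 0) subr0; apply/eqP.
  apply: (addIr s2); rewrite add0r; apply: h.
  by have [_ _ _ ->] := hD; exact: memvf.
by rewrite scaler0 addr0 memvZ// memv_span2l.
Qed.
End Curvature.
End Adapted.

Section CoordinatePoints.
Variable R : realType.
Local Notation vec := 'rV[R]_6.
Local Notation par := 'rV[R]_3.

Definition coord_point (i j : 'I_3) c y z : par :=
  \row_l (if l == i then c else if l == j then y else z).

Definition adapted (lo hi : par) (F : 'I_3 -> par -> {vspace vec}) (i j : 'I_3)
    (c yl yh zl zh : R) (D1 D2 : {vspace vec}) (s1 s2 : R -> vec) : Prop :=
  [/\ dupin_cyclide D1 D2, dupin_surface D1 D2 lo hi i c (F i),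
      spanning_curve D1 yl yh s1, spanning_curve D2 zl zh s2 &
      forall y z, yl < y < yh -> zl < z < zh ->
        F i (coord_point i j c y z) = <<[:: s1 y; s2 z]>>%VS].

Lemma adapted_sub lo hi F i j c yl yh zl zh yl' yh' zl' zh' D1 D2 s1 s2 :
  yl <= yl' -> yh' <= yh -> zl <= zl' -> zh' <= zh ->
  adapted lo hi F i j c yl yh zl zh D1 D2 s1 s2 ->
  adapted lo hi F i j c yl' yh' zl' zh' D1 D2 s1 s2.
Proof.
move=> h1 h2 h3 h4 [hD hS c1 c2 FE]; split; [exact: hD|exact: hS| | |].
- exact: spanning_curve_sub c1.
- exact: spanning_curve_sub c2.
- by move=> y z yi zi; apply: FE; lra.
Qed.

Lemma smooth_near_neq0 lo hi (f : par -> R) (t : par) : smooth_on (box lo hi) f -> box lo hi t ->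
  f t != 0 -> \forall s \near t, f s != 0.
Proof.
move=> sf Bt ft; have fc := smooth_on_continuous sf Bt; have := fc [set r | r != 0].
by apply; exact: (open_nbhs_nbhs (conj (@open_neq _ 0) ft)).
Qed.

Variables (i j k : 'I_3).
Hypotheses (ij : i != j) (ik : i != k) (jk : j != k).
Local Notation pt := (coord_point i j).

Lemma coord_pointi c y z : pt c y z 0 i = c. Proof. by rewrite mxE eqxx. Qed.

Lemma coord_pointj c y z : pt c y z 0 j = y.
Proof. by rewrite mxE eq_sym (negbTE ij) eqxx. Qed.

Lemma coord_pointk c y z : pt c y z 0 k = z.
Proof. by rewrite mxE eq_sym (negbTE ik) eq_sym (negbTE jk). Qed.

Lemma coord_point_box (lo hi : par) c y z : lo 0 i < c < hi 0 i -> lo 0 j < y < hi 0 j ->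
  lo 0 k < z < hi 0 k -> box lo hi (pt c y z).
Proof.
move=> ci yi zi l; have /or3P[] := ord3_cases l ij ik jk => /eqP ->;
  by rewrite ?coord_pointi ?coord_pointj ?coord_pointk.
Qed.

Lemma upd_coord_pointi c c' y z : upd (pt c y z) i c' = pt c' y z.
Proof. by apply/rowP => l; rewrite updE !mxE; case: eqP. Qed.

Lemma upd_coord_pointj c y y' z : upd (pt c y z) j y' = pt c y' z.
Proof.
apply/rowP => l; rewrite updE !mxE; case: (eqVneq l j) => // ->.
by rewrite eq_sym (negbTE ij).
Qed.

Lemma upd_coord_pointk c y z z' : upd (pt c y z) k z' = pt c y z'.
Proof.
apply/rowP => l; rewrite updE; have /or3P[] := ord3_cases l ij ik jk => /eqP ->.
- by rewrite (negbTE ik) !coord_pointi.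
- by rewrite (negbTE jk) !coord_pointj.
- by rewrite eqxx !coord_pointk.
Qed.

Variables (p : vec) (lo hi : par) (F : 'I_3 -> par -> {vspace vec}) (x : par -> vec).
Local Notation B := (box lo hi).
Hypothesis pp : lform p p = -1.
Hypothesis legendre : forall i, legendre_family lo hi i (F i).
Hypothesis hx : point_immersion p lo hi x.
Hypothesis xF : forall i t, B t -> x t \in F i t.
Hypothesis orthF : forall i j t, i != j -> B t ->
  forall s1 s2, s1 \in F i t -> s2 \in F j t -> orthogonal_spheres p s1 s2.
Let oB := @box_open R lo hi.

(** A subspace containing the curve on an interval also contains velocity and acceleration, and at
    one point these osculating vectors already span the three dimensions of [D]. *)
Lemma slice_spanning_curve (c : R) (D : {vspace vec}) (f : par -> vec) t m l h :
  signature21 D -> slice_section lo hi F i c f -> (forall s, f s \in D) ->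
  m != i -> B t -> t 0 i = c ->
  (forall u, l < u < h -> [/\ B (upd t m u), f (upd t m u) != 0 &
    lform (partial m f (upd t m u)) (partial m f (upd t m u)) != 0]) ->
  spanning_curve D l h (fun u => f (upd t m u)).
Proof.
move=> sD sf fD mi Bt tc H.
have uc u : upd t m u 0 i = c by rewrite updE eq_sym (negbTE mi).
split.
  move=> u ui; have [Bu fu _] := H u ui.
  split; [exact: fD|exact: fu|exact: (slice_null legendre sf Bu (uc u))|].
  by apply: continuous_upd; exact: (smooth_on_continuous (proj1 sf) Bu).
move=> l' h' W ll lh hh fW.
have Hu u : l' < u < h' -> l < u < h by move=> ?; lra.
have nearW (g : par -> vec) : smooth_on B g -> (forall u, l' < u < h' -> g (upd t m u) \in W) ->
    forall u, l' < u < h' -> partial m g (upd t m u) \in W.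
  move=> sg gW u ui; have [Bu _ _] := H u (Hu u ui).
  apply: (derive_mem (is_derive_upd (smooth_on_derivable (delta_mx 0 m) sg Bu))).
  by near=> v; apply: gW; near: v; exact: near_interval.
have sd := smooth_on_derive (delta_mx 0 m) (proj1 sf).
have W1 := nearW _ (proj1 sf) fW; have W2 := nearW _ sd W1.
pose u := (l' + h') / 2; have ui : l' < u < h' by rewrite /u; lra.
have [Bu fu du] := H u (Hu u ui); set s := upd t m u in Bu fu du.
have sc : s 0 i = c := uc u.
have fd0 r : B r -> r 0 i = c -> lform (f r) (partial m f r) = 0.
  by move=> Br rc; rewrite lformC; exact: (slice_perp legendre sf mi Br rc (proj2 sf r Br rc)).
have e2 : lform (f s) (partial m (partial m f) s) = - lform (partial m f s) (partial m f s).
  apply/eqP; rewrite -subr_eq0 opprK addrC; apply/eqP.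
  exact: (slice_lform0 (proj1 sf) sd mi Bu sc fd0).
have n0 : 0 < lform (partial m f s) (partial m f s).
  by rewrite lt_def du (slice_norm_ge0 legendre sD sf fD Bu sc fu).
have sC := osculating_signature21 (slice_null legendre sf Bu sc) (fd0 s Bu sc) n0 e2.
have pD : partial m f s \in D by exact: slice_partial_mem sf fD Bu.
have ppD : partial m (partial m f) s \in D.
  apply: (derive_mem (smooth_on_derivable (delta_mx 0 m) sd Bu)).
  by near=> r; apply: (slice_partial_mem m sf fD); near: r; exact: near_box.
have <- : <<[:: f s; partial m f s; partial m (partial m f) s]>>%VS = D.
  apply/eqP; rewrite eqEdim span3_subv fD pD ppD/=.
  by rewrite (signature21_dim sC) (signature21_dim sD).
by rewrite span3_subv fW// W1// W2.
Unshelve. all: by end_near. Qed.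

Lemma slice_direction (c : R) (f : par -> vec) t m l h a : smooth_on B f ->
  (forall u, l < u < h -> [/\ B (upd t m u), f (upd t m u) 0 a != 0 &
    partial m f (upd t m u) \in <[f (upd t m u)]>%VS]) ->
  forall u v, l < u < h -> l < v < h -> f (upd t m u) \in <[f (upd t m v)]>%VS.
Proof.
move=> sf H; apply: (@direction_constant R _ (fun u => f (upd t m u))
  (fun u => partial m f (upd t m u)) l h a) => u ui; have [Bu fa fd] := H u ui.
split; [exact: (is_derive_upd (smooth_on_derivable (delta_mx 0 m) sf Bu))|exact: fd|exact: fa].
Qed.

Section AdaptFrom.
Variables (c y0 z0 : R) (D1 D2 : {vspace vec}) (f h : par -> vec).
Let t := pt c y0 z0.
Hypotheses (Bt : B t) (hD : dupin_cyclide D1 D2).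
Hypothesis hS : dupin_surface D1 D2 lo hi i c (F i).
Hypotheses (sf : slice_section lo hi F i c f) (sh : slice_section lo hi F i c h).
Hypotheses (fD : forall s, f s \in D1) (hD2 : forall s, h s \in D2).
Hypotheses (f0 : f t != 0) (h0 : h t != 0).
Hypothesis fj : partial j f t \notin <[f t]>%VS.
Let ji : j != i. Proof. by rewrite eq_sym. Qed.
Let ki : k != i. Proof. by rewrite eq_sym. Qed.
Let sig1 : signature21 D1. Proof. by case: hD. Qed.
Let sig2 : signature21 D2. Proof. by case: hD. Qed.

(** Since [f] moves along [j] it is stationary along [k]; then [h] must move along [k] and is
    stationary along [j]. The two motions persist nearby, so on a rectangle the line of [f] depends
    on [y] only and that of [h] on [z] only. *)
Lemma adapted_from : exists e : R, 0 < e /\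
  adapted lo hi F i j c (y0 - e) (y0 + e) (z0 - e) (z0 + e) D1 D2
    (fun y => f (pt c y z0)) (fun z => h (pt c y0 z)).
Proof.
have tc : t 0 i = c := coord_pointi c y0 z0.
have fk : partial k f t \in <[f t]>%VS.
  have /orP[h1|h1] := slice_dichotomy pp legendre hx xF orthF sig1 sf fD Bt tc f0 ji ki jk.
    by case/negP: fj; exact: h1.
  exact: h1.
have hk : partial k h t \notin <[h t]>%VS.
  apply/negP => hk.
  exact: (slice_not_both pp legendre hx xF orthF hD sf sh fD hD2 Bt tc f0 h0 ki fk hk).
have [a fa] := row_coord_neq0 f0; have [b hb] := row_coord_neq0 h0.
have nfa := smooth_near_neq0 (smooth_coord oB a (proj1 sf)) Bt fa.
have nhb := smooth_near_neq0 (smooth_coord oB b (proj1 sh)) Bt hb.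
have sdf := smooth_on_derive (delta_mx 0 j) (proj1 sf).
have sdh := smooth_on_derive (delta_mx 0 k) (proj1 sh).
have nfj : \forall s \near t, lform (partial j f s) (partial j f s) != 0.
  apply: (smooth_near_neq0 (smooth_lform oB sdf sdf) Bt).
  by rewrite -(slice_parallelP legendre sig1 sf fD Bt tc f0 ji).
have nhk : \forall s \near t, lform (partial k h s) (partial k h s) != 0.
  apply: (smooth_near_neq0 (smooth_lform oB sdh sdh) Bt).
  by rewrite -(slice_parallelP legendre sig2 sh hD2 Bt tc h0 ki).
have [e [e0 eP]] := near_small_box (filterI (filterI (near_box Bt) (filterI nfa nhb))
  (filterI nfj nhk)).
have in_box y z : y0 - e < y < y0 + e -> z0 - e < z < z0 + e ->
    box (t - const_mx e) (t + const_mx e) (pt c y z).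
  have lE n : (t - const_mx e) 0 n = t 0 n - e by move: (t) => s; rewrite !mxE.
  have hE n : (t + const_mx e) 0 n = t 0 n + e by move: (t) => s; rewrite !mxE.
  move=> yi zi; apply: coord_point_box; rewrite !lE !hE /t.
  - by rewrite coord_pointi; lra.
  - by rewrite coord_pointj.
  - by rewrite coord_pointk.
have neq0 (g : par -> vec) s n : g s 0 n != 0 -> g s != 0.
  by apply: contraNneq => ->; rewrite mxE.
have Pyz y z : y0 - e < y < y0 + e -> z0 - e < z < z0 + e ->
    [/\ B (pt c y z), f (pt c y z) 0 a != 0, h (pt c y z) 0 b != 0,
        partial k f (pt c y z) \in <[f (pt c y z)]>%VS &
        partial j h (pt c y z) \in <[h (pt c y z)]>%VS].
  move=> yi zi; have [[Bs [fs hs]] [fjs hks]] := eP _ (in_box y z yi zi).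
  have sc := coord_pointi c y z; have fs0 := neq0 f _ _ fs; have hs0 := neq0 h _ _ hs.
  have fks : partial k f (pt c y z) \in <[f (pt c y z)]>%VS.
    have /orP[h1|h1] := slice_dichotomy pp legendre hx xF orthF sig1 sf fD Bs sc fs0 ji ki jk.
      by case/negP: fjs; rewrite -(slice_parallelP legendre sig1 sf fD Bs sc fs0 ji); exact: h1.
    exact: h1.
  split; [exact: Bs|exact: fs|exact: hs|exact: fks|].
  have /orP[h1|h1] := slice_dichotomy pp legendre hx xF orthF sig2 sh hD2 Bs sc hs0 ji ki jk.
    exact: h1.
  by case/negP: hks; rewrite -(slice_parallelP legendre sig2 sh hD2 Bs sc hs0 ki); exact: h1.
have y0i : y0 - e < y0 < y0 + e by lra.
have z0i : z0 - e < z0 < z0 + e by lra.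
have fline y z : y0 - e < y < y0 + e -> z0 - e < z < z0 + e ->
    f (pt c y z0) \in <[f (pt c y z)]>%VS.
  move=> yi zi; rewrite -(upd_coord_pointk c y z0 z) -{1}(upd_coord_pointk c y z0 z0).
  apply: (@slice_direction c f (pt c y z0) k (z0 - e) (z0 + e) a (proj1 sf)) => // u ui.
  by rewrite upd_coord_pointk; case: (Pyz y u yi ui).
have hline y z : y0 - e < y < y0 + e -> z0 - e < z < z0 + e ->
    h (pt c y0 z) \in <[h (pt c y z)]>%VS.
  move=> yi zi; rewrite -(upd_coord_pointj c y0 y z) -{1}(upd_coord_pointj c y0 y0 z).
  apply: (@slice_direction c h (pt c y0 z) j (y0 - e) (y0 + e) b (proj1 sh)) => // u ui.
  by rewrite upd_coord_pointj; case: (Pyz u z ui zi).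
exists e; split; first exact: e0.
split; [exact: hD|exact: hS| | |].
- have sE : (fun y => f (pt c y z0)) = (fun y => f (upd t j y)).
    by apply/funext => y; rewrite /t upd_coord_pointj.
  rewrite sE; apply: (slice_spanning_curve sig1 sf fD ji Bt tc) => u ui.
  rewrite /t upd_coord_pointj; have [[Bs [fs _]] [fjs _]] := eP _ (in_box u z0 ui z0i).
  by split=> //; exact: neq0 fs.
- have sE : (fun z => h (pt c y0 z)) = (fun z => h (upd t k z)).
    by apply/funext => z; rewrite /t upd_coord_pointk.
  rewrite sE; apply: (slice_spanning_curve sig2 sh hD2 ki Bt tc) => u ui.
  rewrite /t upd_coord_pointk; have [[Bs [_ hs]] [_ hks]] := eP _ (in_box y0 u y0i ui).
  by split=> //; exact: neq0 hs.
- move=> y z yi zi; have [Bs fs hs _ _] := Pyz y z yi zi.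
  have sc := coord_pointi c y z; have fs0 := neq0 f _ _ fs; have hs0 := neq0 h _ _ hs.
  have [FE _] := slice_span legendre hD sf sh fD hD2 Bs sc fs0 hs0.
  have [_ f1 _ _ _] := Pyz y z0 yi z0i; have [_ _ h1 _ _] := Pyz y0 z y0i zi.
  have fy0 := neq0 f _ _ f1; have hz0 := neq0 h _ _ h1.
  rewrite FE; apply: span2_eq.
  + rewrite free2P//; apply/negP => /vlineP[r hE]; move/eqP: fy0; apply.
    by apply: (cyclide_disjoint hD (fD _)); rewrite hE memvZ.
  + by have /vlineP[r ->] := fline y z yi zi; rewrite memvZ// memv_span2l.
  + by have /vlineP[r ->] := hline y z yi zi; rewrite memvZ// memv_span2r.
Qed.
End AdaptFrom.
End CoordinatePoints.

(** * Circular trajectories *)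

Section Trajectories.
Variable R : realType.
Local Notation vec := 'rV[R]_6.
Local Notation par := 'rV[R]_3.

Definition subinterval (I J : R * R) : bool := [&& J.1 <= I.1, I.1 < I.2 & I.2 <= J.2].

Lemma subinterval_trans I J K : subinterval I J -> subinterval J K -> subinterval I K.
Proof. by move=> /and3P[? ? ?] /and3P[? ? ?]; apply/and3P; split; lra. Qed.

Lemma nonvanishing_sign (f : R -> R) (l h : R) :
  (forall u, l < u < h -> {for u, continuous f} /\ f u != 0) ->
  (forall u, l < u < h -> 0 < f u) \/ (forall u, l < u < h -> f u < 0).
Proof.
move=> H.
have same u v : u <= v -> l < u < h -> l < v < h -> 0 < f u * f v.
  move=> uv ui vi; rewrite lt_def mulf_neq0 ?(proj2 (H _ _))//=.
  rewrite leNgt; apply/negP => fuv.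
  have fc : {within `[u, v], continuous f}.
    apply: continuous_in_subspaceT => w; rewrite inE/= in_itv/= => wi.
    by have [] : {for w, continuous f} /\ f w != 0 by apply: H; lra.
  have [w wi fw] : exists2 w, w \in `[u, v] & f w = 0.
    apply: (IVT uv fc); rewrite ge_min le_max.
    by have [u0|u0] := lerP (f u) 0; have [v0|v0] := lerP (f v) 0 => //=; nra.
  have : f w != 0 by apply: (proj2 (H w _)); move: wi; rewrite in_itv/=; lra.
  by rewrite fw eqxx.
have same' u v : l < u < h -> l < v < h -> 0 < f u * f v.
  move=> ui vi; have [uv|/ltW vu] := lerP u v; first exact: same.
  by rewrite mulrC same.
have [[u [ui fu]]|none] := pselect (exists u, l < u < h /\ 0 < f u).
  by left=> v vi; have := same' u v ui vi; rewrite pmulr_rgt0.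
right=> v vi; rewrite lt_def eq_sym (proj2 (H v vi)) leNgt.
by apply/negP => fv; apply: none; exists v.
Qed.

Variables (i j k : 'I_3).
Hypotheses (ij : i != j) (ik : i != k) (jk : j != k).
Local Notation pt := (coord_point i j).
Variables (p : vec) (lo hi : par) (F : 'I_3 -> par -> {vspace vec}) (x : par -> vec).
Local Notation B := (box lo hi).
Hypothesis pp : lform p p = -1.
Hypothesis legendre : forall i, legendre_family lo hi i (F i).
Hypothesis hx : point_immersion p lo hi x.
Hypothesis xF : forall i t, B t -> x t \in F i t.
Hypothesis orthF : forall i j t, i != j -> B t ->
  forall s1 s2, s1 \in F i t -> s2 \in F j t -> orthogonal_spheres p s1 s2.
Let oB := @box_open R lo hi.
Let sx := tos_smooth hx.

Let section_projection c D1 D2 t : dupin_cyclide D1 D2 ->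
  dupin_surface D1 D2 lo hi i c (F i) -> B t -> t 0 i = c ->
  exists S, section_of lo hi (F i) S /\ daddv_pi D1 D2 (S t) != 0.
Proof.
move=> hD hS Bt tc; have [S1 [S2 [sS1 sS2 FE]]] := tos_frame_sections legendre i.
apply: contrapT => H.
have z S : section_of lo hi (F i) S -> daddv_pi D1 D2 (S t) = 0.
  by move=> sS; apply/eqP/negP => /negP h; apply: H; exists S.
have [s1 [s2 [s1D _ /andP[s10 _] _ E]]] := hS t Bt tc.
have : s1 \in F i t by rewrite E memv_span2l.
rewrite FE// => /mem_span2P[a [b s1E]]; move/eqP: s10; apply.
rewrite -(daddv_pi_id (cyclide_cap hD) s1D) s1E linearD !linearZ/= !z//.
by rewrite !scaler0 addr0.
Qed.

Lemma adapted_exists c D1 D2 (Y Z : R * R) : lo 0 i < c < hi 0 i ->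
  subinterval Y (lo 0 j, hi 0 j) -> subinterval Z (lo 0 k, hi 0 k) ->
  dupin_cyclide D1 D2 -> dupin_surface D1 D2 lo hi i c (F i) ->
  exists Y' Z' E1 E2 s1 s2, [/\ subinterval Y' Y, subinterval Z' Z &
    adapted lo hi F i j c Y'.1 Y'.2 Z'.1 Z'.2 E1 E2 s1 s2].
Proof.
move=> ci /and3P[/= Y1 Y2 Y3] /and3P[/= Z1 Z2 Z3] hD hS.
pose y0 := (Y.1 + Y.2) / 2; pose z0 := (Z.1 + Z.2) / 2.
have Bt : B (pt c y0 z0) by apply: (coord_point_box ij ik jk) => //; rewrite /y0 /z0; lra.
have tc : pt c y0 z0 0 i = c by exact: coord_pointi.
have hD' := dupin_cyclideC hD.
have hS' : dupin_surface D2 D1 lo hi i c (F i).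
  by move=> t Bt' tc'; apply/cyclide_contact_elementC/hS.
have [S1 [sS1 f0]] := section_projection hD hS Bt tc.
have [S2 [sS2 h0]] := section_projection hD' hS' Bt tc.
pose f t := daddv_pi D1 D2 (S1 t); pose h t := daddv_pi D2 D1 (S2 t).
have sf : slice_section lo hi F i c f by exact: slice_projection.
have sh : slice_section lo hi F i c h by exact: slice_projection.
have fD s : f s \in D1 by exact: memv_pi.
have hD2 s : h s \in D2 by exact: memv_pi.
have ji : j != i by rewrite eq_sym.
suff [E1 [E2 [s1 [s2 [e [e0 A]]]]]] : exists E1 E2 s1 s2, exists e : R, 0 < e /\
    adapted lo hi F i j c (y0 - e) (y0 + e) (z0 - e) (z0 + e) E1 E2 s1 s2.
  pose e' := Num.min e (Num.min ((Y.2 - Y.1) / 2) ((Z.2 - Z.1) / 2)).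
  have e'0 : 0 < e' by rewrite !lt_min e0 !divr_gt0 ?subr_gt0.
  have e1 : e' <= e by rewrite ge_min lexx.
  have e2 : e' <= (Y.2 - Y.1) / 2 by rewrite !ge_min lexx orbT.
  have e3 : e' <= (Z.2 - Z.1) / 2 by rewrite !ge_min lexx !orbT.
  exists (y0 - e', y0 + e'), (z0 - e', z0 + e'), E1, E2, s1, s2; split.
  - by apply/and3P; rewrite /y0 /=; split; lra.
  - by apply/and3P; rewrite /z0 /=; split; lra.
  - by apply: adapted_sub A => /=; lra.
(* If the sphere in [D1] is stationary along [j], the one in [D2] is not, and the two halves of the
   splitting exchange roles. *)
case: (boolP (partial j f (pt c y0 z0) \in <[f (pt c y0 z0)]>%VS)) => fj; last first.
  have [e [e0 A]] := adapted_from ij ik jk pp legendre hx xF orthF Bt hD hS sf sh fD hD2 f0 h0 fj.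
  by exists D1, D2, (fun y => f (pt c y z0)), (fun z => h (pt c y0 z)), e.
have hj : partial j h (pt c y0 z0) \notin <[h (pt c y0 z0)]>%VS.
  apply/negP => hj.
  exact: (slice_not_both pp legendre hx xF orthF hD sf sh fD hD2 Bt tc f0 h0 ji fj hj).
have [e [e0 A]] := adapted_from ij ik jk pp legendre hx xF orthF Bt hD' hS' sh sf hD2 fD h0 f0 hj.
by exists D2, D1, (fun y => h (pt c y z0)), (fun z => f (pt c y0 z)), e.
Qed.

(** A point on the circle is normalized to (u, v, 1) with (u, v) on the unit circle, and the
    oriented sphere normal to the tangent [D] to (-v, u, eps). Orthogonality of [X] and [D] gives
    [(G * lform X e3) ^+ 2 = delta ^+ 2], so the quotient is a sign: the orientation relative to the
    frame. *)
Lemma circle_algebra (e1 e2 e3 X D : vec) (G : R) :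
  lform e1 e1 = 1 -> lform e2 e2 = 1 -> lform e3 e3 = -1 ->
  lform e1 e2 = 0 -> lform e1 e3 = 0 -> lform e2 e3 = 0 ->
  X \in <<[:: e1; e2; e3]>>%VS -> D \in <<[:: e1; e2; e3]>>%VS ->
  X != 0 -> lform X X = 0 -> lform X D = 0 -> 0 < lform D D -> G ^+ 2 = lform D D ->
  let delta := lform X e1 * lform D e2 - lform X e2 * lform D e1 in
  [/\ lform X e3 != 0, delta != 0, G != 0 &
   exists u v eps : R, [/\ u ^+ 2 + v ^+ 2 = 1, eps ^+ 2 = 1,
     0 < - eps * (G * lform X e3 * delta),
     X = (- lform X e3) *: (u *: e1 + v *: e2 + e3) &
     exists r q, (- v) *: e1 + u *: e2 + eps *: p = r *: (D + G *: p) + q *: X]].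
Proof.
move=> h1 h2 h3 h12 h13 h23 Xm Dm X0 XX XD DD GE delta.
have XE := onb_coord h1 h2 h3 h12 h13 h23 Xm.
have DE := onb_coord h1 h2 h3 h12 h13 h23 Dm.
move: (lform X e1) (lform X e2) (lform X e3) (lform D e1) (lform D e2) (lform D e3) XE DE @delta.
move=> y1 y2 y3 d1 d2 d3 XE DE /=; set delta := _ - _.
have form (a1 a2 a3 b1 b2 b3 : R) :
    lform (a1 *: e1 + a2 *: e2 - a3 *: e3) (b1 *: e1 + b2 *: e2 - b3 *: e3) =
    a1 * b1 + a2 * b2 - a3 * b3.
  by rewrite !lformE; lform_sort [:: e1; e2; e3]; rewrite h1 h2 h3 h12 h13 h23; ring.
have yy : y3 ^+ 2 = y1 ^+ 2 + y2 ^+ 2 by move: XX; rewrite XE form => h; lra.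
have yd : y3 * d3 = y1 * d1 + y2 * d2 by move: XD; rewrite XE DE form => h; lra.
have gg : G ^+ 2 = d1 ^+ 2 + d2 ^+ 2 - d3 ^+ 2 by rewrite GE DE form; ring.
have y30 : y3 != 0.
  apply: contraNneq X0 => y30; move: yy; rewrite y30 expr0n /= => /esym/eqP.
  rewrite paddr_eq0 ?sqr_ge0// !sqrf_eq0 => /andP[/eqP y10 /eqP y20].
  by rewrite XE y10 y20 y30 !scale0r subr0 addr0.
have G0 : G != 0 by rewrite -sqrf_eq0 GE gt_eqF.
have key : (G * y3) ^+ 2 = delta ^+ 2.
  have -> : (G * y3) ^+ 2 = (d1 ^+ 2 + d2 ^+ 2) * y3 ^+ 2 - (y3 * d3) ^+ 2 by rewrite exprMn gg; ring.
  by rewrite yy yd /delta; ring.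
have d0 : delta != 0 by rewrite -sqrf_eq0 -key sqrf_eq0 mulf_neq0.
split=> //; exists (- y1 / y3), (- y2 / y3), (- (G * y3 / delta)); split.
- have -> : (- y1 / y3) ^+ 2 + (- y2 / y3) ^+ 2 = (y1 ^+ 2 + y2 ^+ 2) / y3 ^+ 2 by field.
  by rewrite -yy divff// expf_neq0.
- by rewrite sqrrN expr_div_n key divff// expf_neq0.
- have -> : - - (G * y3 / delta) * (G * y3 * delta) = (G * y3) ^+ 2 by field.
  by rewrite exprn_even_gt0//= mulf_neq0.
- by rewrite XE; apply/rowP => l; rewrite !mxE; field.
- exists (- (y3 / delta)), (d3 / delta); rewrite XE DE.
  have c1 : - (- y2 / y3) = - (y3 / delta) * d1 + d3 / delta * y1.
    apply: (mulIf (mulf_neq0 y30 d0)).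
    transitivity (y2 * delta); first by field.
    transitivity (- (d1 * y3 ^+ 2) + y3 * d3 * y1); last by field.
    by rewrite yy yd /delta; ring.
  have c2 : - y1 / y3 = - (y3 / delta) * d2 + d3 / delta * y2.
    apply: (mulIf (mulf_neq0 y30 d0)).
    transitivity (- y1 * delta); first by field.
    transitivity (- (d2 * y3 ^+ 2) + y3 * d3 * y2); last by field.
    by rewrite yy yd /delta; ring.
  rewrite c1 c2; apply/rowP => l; rewrite !mxE; field.
  by rewrite ?d0.
Qed.

(** One ruling of the quadric of the (2,2)-space. With the planes of [e1], [e2] and of [e3], [p]
    identified with the complex numbers, this is the graph of multiplication by u + i v. *)
Definition circle_element (e1 e2 e3 : vec) (u v : R) : {vspace vec} :=
  <<[:: (u *: e1 + v *: e2 + e3)%R; ((- v) *: e1 + u *: e2 + p)%R]>>%VS.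

Definition circle_frame (e1 e2 e3 : vec) : Prop :=
  [/\ lform e1 e1 = 1, lform e2 e2 = 1 & lform e3 e3 = -1] /\
  [/\ lform e1 e2 = 0, lform e1 e3 = 0 & lform e2 e3 = 0] /\
  [/\ lform e1 p = 0, lform e2 p = 0 & lform e3 p = 0].

Lemma circle_element_eq e1 e2 e3 u v (E : {vspace vec}) : circle_frame e1 e2 e3 ->
  \dim E = 2%N -> u *: e1 + v *: e2 + e3 \in E -> (- v) *: e1 + u *: e2 + p \in E ->
  E = circle_element e1 e2 e3 u v.
Proof.
move=> [[h1 h2 h3] [[h12 h13 h23] [p1 p2 p3]]] dE E1 E2.
have w3 : lform (u *: e1 + v *: e2 + e3) e3 = -1.
  by rewrite !lformE h3 h13 h23; ring.
have wp : lform (u *: e1 + v *: e2 + e3) p = 0 by rewrite !lformE p1 p2 p3; ring.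
have np : lform ((- v) *: e1 + u *: e2 + p) p = -1 by rewrite !lformE p1 p2 pp; ring.
have N10 : -1 != 0 :> R by rewrite oppr_eq0 oner_eq0.
apply/esym/eqP; rewrite eqEdim /circle_element span2_subv E1 E2 dE span2C free_dim2//.
  by apply: contraNneq N10 => w0; rewrite -w3 w0 lform0l.
apply: contraNN N10 => /vlineP[r nE]; rewrite -np nE lformZl wp mulr0.
by [].
Qed.

(* The oriented circle picks one of the two rulings of isotropic planes in the
   (2,2)-space spanned by the circle and p; by continuity it is the same one along
   the whole trajectory, and [e2] is chosen to make it the stated one. *)
Lemma circle_normal_form y z : circular_trajectories p lo hi F ->
  (exists c, lo 0 i < c < hi 0 i) -> lo 0 j < y < hi 0 j -> lo 0 k < z < hi 0 k ->
  exists e1 e2 e3, circle_frame e1 e2 e3 /\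
    forall c, lo 0 i < c < hi 0 i -> exists u v, [/\ u ^+ 2 + v ^+ 2 = 1,
      x (pt c y z) \in <[(u *: e1 + v *: e2 + e3)%R]>%VS &
      F i (pt c y z) = circle_element e1 e2 e3 u v].
Proof.
move=> circ [c0 c0i] yi zi.
have Bp c : lo 0 i < c < hi 0 i -> B (pt c y z).
  by move=> ci; exact: (coord_point_box ij ik jk).
have [C [[e1 [e2 [e3 [CE [h1 h2 h3] [h12 h13 h23]]]]] Cp] CX] := circ i _ (Bp c0 c0i).
have XC c : lo 0 i < c < hi 0 i -> x (pt c y z) \in C.
  move=> ci; apply: (CX (pt c y z) (Bp c ci) _ i); last exact: (tos_p hx (Bp c ci)).
    move=> l li; have /or3P[/eqP lE|/eqP->|/eqP->] := ord3_cases l ij ik jk.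
    - by rewrite lE eqxx in li.
    - by rewrite !(coord_pointj ij).
    - by rewrite !(coord_pointk ik jk).
  exact: xF (Bp c ci).
have DC c : lo 0 i < c < hi 0 i -> partial i x (pt c y z) \in C.
  move=> ci; have := smooth_on_derivable (delta_mx 0 i) sx (Bp c ci).
  rewrite -{1}(upd_coord_pointi i j c0 c y z) => dx.
  apply: (derive_mem (is_derive_upd dx)); near=> c'; rewrite upd_coord_pointi; apply: XC.
  by near: c'; exact: near_interval.
have ep : [/\ lform e1 p = 0, lform e2 p = 0 & lform e3 p = 0].
  by split; apply: Cp; rewrite CE memv_span ?inE ?eqxx ?orbT.
have [S1 [S2 [sS1 sS2 FE]]] := tos_frame_sections legendre i.
have sd := smooth_on_derive (delta_mx 0 i) sx.
pose delta t := lform (x t) e1 * lform (partial i x t) e2 - lform (x t) e2 * lform (partial i x t) e1.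
(* The roots [G] and signs [eps] exist only pointwise, so continuity cannot be applied to them.
   Pairing with smooth sections replaces [G]: [ab S] is a multiple of [lform (S t) p ^+ 2] by a
   factor of the sign of [eps]. Adding over a spanning pair gives a nonzero smooth function. *)
pose ab (S : par -> vec) t := lform (S t) (partial i x t) * lform (x t) e3 *
  (delta t * lform (S t) p).
pose phi t := ab S1 t + ab S2 t.
have sphi : smooth_on B phi.
  have sl (f : par -> vec) (e : vec) : smooth_on B f -> smooth_on B (fun t => lform (f t) e).
    by move=> sf; exact: (smooth_lform oB sf (smooth_vcst oB e)).
  have sdelta : smooth_on B delta.
    exact: (smooth_sub oB (smooth_mul oB (sl _ e1 sx) (sl _ e2 sd))
      (smooth_mul oB (sl _ e2 sx) (sl _ e1 sd))).
  have sab S : smooth_on B S -> smooth_on B (ab S).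
    move=> sS; exact: (smooth_mul oB (smooth_mul oB (smooth_lform oB sS sd) (sl _ e3 sx))
      (smooth_mul oB sdelta (sl _ p sS))).
  exact: (smooth_add oB (sab _ (proj1 sS1)) (sab _ (proj1 sS2))).
have main c : lo 0 i < c < hi 0 i -> exists u v eps : R,
    [/\ u ^+ 2 + v ^+ 2 = 1, eps ^+ 2 = 1, 0 < eps * phi (pt c y z),
      x (pt c y z) \in <[(u *: e1 + v *: e2 + e3)%R]>%VS &
      u *: e1 + v *: e2 + e3 \in F i (pt c y z) /\
      (- v) *: e1 + u *: e2 + eps *: p \in F i (pt c y z)].
  move=> ci; have Bt := Bp c ci; have [hf /(_ i)[G [GE GF]]] := tos_frame pp legendre hx xF orthF Bt.
  have [x0 [xx xp] xd dd dp] := hf.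
  have xC := XC c ci; have dC := DC c ci; rewrite CE in xC dC.
  have [y30 d0 G0 [u [v [eps [uv ee pos XE [r [q nE]]]]]]] :=
    circle_algebra h1 h2 h3 h12 h13 h23 xC dC x0 xx (proj1 (xd i)) (dp i) GE.
  exists u, v, eps; split=> //.
  - have sE S : section_of lo hi (F i) S ->
        ab S (pt c y z) = - (G * lform (x (pt c y z)) e3 * delta (pt c y z)) * lform (S (pt c y z)) p ^+ 2.
      move=> [_ SF]; have Fc := proj1 (proj1 (legendre i)) _ Bt.
      have := contact_element_orth Fc (SF _ Bt) GF; rewrite lformDr lformZr => h.
      have -> : ab S (pt c y z) = (- (G * lform (S (pt c y z)) p)) * lform (x (pt c y z)) e3 *
          (delta (pt c y z) * lform (S (pt c y z)) p).
        by rewrite /ab; congr (_ * _ * _); lra.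
      by ring.
    rewrite /phi !sE// -mulrDr mulrA; apply: mulr_gt0.
      by rewrite mulrN -mulNr.
    rewrite lt_def addr_ge0 ?sqr_ge0// andbT paddr_eq0 ?sqr_ge0// !sqrf_eq0 negb_and.
    apply/negPn/negP; rewrite negb_or !negbK => /andP[/eqP p1 /eqP p2].
    have := GF; rewrite FE// => /mem_span2P[a [b nE']].
    have := congr1 (fun w => lform w p) nE'; rewrite /= lformDl lformZl pp.
    rewrite (proj2 (xd i)) lformDl !lformZl p1 p2 !mulr0 addr0 add0r mulrN1 => /eqP.
    by rewrite oppr_eq0 (negbTE G0).
  - by rewrite {1}XE memvZ ?memv_line.
  - split; last by rewrite nE memvD ?memvZ// xF.
    have -> : u *: e1 + v *: e2 + e3 = (- (lform (x (pt c y z)) e3)^-1) *: x (pt c y z).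
      move: (lform _ e3) y30 XE => y3 y30 XE.
      by rewrite [in RHS]XE scalerA mulrNN mulVf// scale1r.
    by rewrite memvZ// xF.
have phi_sign := @nonvanishing_sign (fun c => phi (pt c y z)) (lo 0 i) (hi 0 i).
have [c ci|pos|neg] := phi_sign.
- split.
    have : {for upd (pt c0 y z) i c, continuous phi}.
      by rewrite upd_coord_pointi; exact: (smooth_on_continuous sphi (Bp c ci)).
    have -> : (fun c => phi (pt c y z)) = (fun c => phi (upd (pt c0 y z) i c)).
      by apply/funext => r; rewrite upd_coord_pointi.
    exact: continuous_upd.
  have [u [v [eps [_ _ pos _ _]]]] := main c ci.
  by apply: contraTneq pos => ->; rewrite mulr0 ltxx.
- exists e1, e2, e3; split=> // c ci.
  have [u [v [eps [uv ee ps xl [F1 F2]]]]] := main c ci.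
  have e1' : eps = 1.
    have : 0 < eps by move: ps; rewrite pmulr_lgt0// pos.
    move/eqP: ee; rewrite sqrf_eq1 => /orP[/eqP//|/eqP->]; lra.
  exists u, v; split=> //; rewrite e1' scale1r in F2.
  by apply: circle_element_eq => //; case: (proj1 (proj1 (legendre i)) _ (Bp c ci)).
(* Reversing [e2] and [v] exchanges the two rulings. *)
- have fr : circle_frame e1 (- e2) e3.
    have [p1 p2 p3] := ep; split; [|split]; split; rewrite ?lformNl ?lformNr ?opprK//;
      by rewrite ?h12 ?h23 ?p2 oppr0.
  exists e1, (- e2), e3; split; first exact: fr.
  move=> c ci; have [u [v [eps [uv ee ps xl [F1 F2]]]]] := main c ci.
  have e1' : eps = -1.
    have : eps < 0 by move: ps; rewrite nmulr_lgt0// neg.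
    move/eqP: ee; rewrite sqrf_eq1 => /orP[/eqP->|/eqP//]; lra.
  exists u, (- v); split; first by rewrite sqrrN.
    by rewrite scalerN scaleNr opprK.
  apply: (circle_element_eq fr); first by case: (proj1 (proj1 (legendre i)) _ (Bp c ci)).
    by rewrite scalerN scaleNr opprK.
  have -> : (- - v) *: e1 + u *: (- e2) + p = - ((- v) *: e1 + u *: e2 + eps *: p).
    by rewrite e1'; apply/rowP => l; rewrite !mxE; ring.
  by rewrite memvN.
Unshelve. all: by end_near. Qed.
End Trajectories.

(** * Lines joining curvature spheres *)

Section LineGeometry.
Variable R : realType.
Local Notation vec := 'rV[R]_6.
Implicit Types (I Y Z : R * R) (s : R -> vec) (D W : {vspace vec}).

Lemma near_subinterval I u (P : R -> Prop) : I.1 < u < I.2 -> (\forall v \near u, P v) ->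
  exists J, subinterval J I /\ forall v, J.1 < v < J.2 -> P v.
Proof.
move=> ui uP; have h : \forall v \near u, P v /\ I.1 < v < I.2.
  exact: (filterI uP (near_interval ui)).
have [e e0 eP] : nbhs_ball u (fun v => P v /\ I.1 < v < I.2) by rewrite nbhs_ballE.
move: e0 => /= e0.
 exists (u - e / 2, u + e / 2) => /=.
have e20 : 0 < e / 2 by rewrite divr_gt0.
have inb v : u - e / 2 <= v <= u + e / 2 -> P v /\ I.1 < v < I.2.
  by move=> vi; apply: eP; rewrite /ball/= ltr_norml; lra.
split; last by move=> v vi; apply: (proj1 (inb v _)); lra.
have [_ h1] := inb (u - e / 2) ltac:(lra); have [_ h2] := inb (u + e / 2) ltac:(lra).
by apply/and3P; split=> /=; lra.
Qed.

Lemma continuous_linear n m (L : {linear 'rV[R]_n -> 'rV[R]_m}) (s : R -> 'rV[R]_n) u :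
  {for u, continuous s} -> {for u, continuous (fun v => L (s v))}.
Proof.
move=> sc; apply: continuous_rV => j.
have -> : (fun v => L (s v) 0 j) = \sum_l (fun v => s v 0 l * L (delta_mx 0 l) 0 j).
  apply/funext => v; rewrite fct_sumE row_linear_sum summxE.
  by apply: eq_bigr => l _; rewrite mxE.
elim/big_ind: _ => [|g h gc hc|l _]; [exact: cst_continuous|exact: continuousD|].
apply: continuousM; last exact: cst_continuous.
exact: (continuous_comp sc (@coord_continuous _ _ _ _ _ _)).
Qed.

Lemma near_notin (s : R -> vec) u W : {for u, continuous s} -> s u \notin W ->
  \forall v \near u, s v \notin W.
Proof.
move=> sc su; pose f v := s v - projv W (s v).
have f0 v : (f v == 0) = (s v \in W).
  rewrite subr_eq0; apply/eqP/idP => [->|sv]; first exact: memv_proj.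
  by rewrite projv_id.
have [j fj] : exists j, f u 0 j != 0 by apply: row_coord_neq0; rewrite f0.
have fc : {for u, continuous (fun v => f v 0 j)}.
  have fc : {for u, continuous f} := continuousB sc (continuous_linear (L := projv W) sc).
  exact: (continuous_comp fc (@coord_continuous _ _ _ _ _ _)).
have : \forall v \near u, f v 0 j != 0.
  by move: (fc [set r | r != 0]); apply; exact: (open_nbhs_nbhs (conj (@open_neq _ 0) fj)).
apply: filterS => v fv; rewrite -f0; move: fv; apply: contraNneq => ->.
by rewrite mxE.
Qed.

Lemma near_not_parallel s s' u : {for u, continuous s} -> {for u, continuous s'} ->
  s u != 0 -> s' u \notin <[s u]>%VS -> \forall v \near u, s' v \notin <[s v]>%VS.
Proof.
move=> sc s'c s0 su; have [j sj] := row_coord_neq0 s0.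
have [k hk] : exists k, s' u 0 j * s u 0 k != s' u 0 k * s u 0 j.
  apply: contrapT => H; case/negP: su; apply: (minors_line sj) => k.
  by apply/eqP/negP => /negP h; apply: H; exists k.
have cc (t : R -> vec) l : {for u, continuous t} -> {for u, continuous (fun v => t v 0 l)}.
  by move=> tc; exact: (continuous_comp tc (@coord_continuous _ _ _ _ _ _)).
pose m v := s' v 0 j * s v 0 k - s' v 0 k * s v 0 j.
have mc : {for u, continuous m}.
  exact: (continuousB (continuousM (cc _ j s'c) (cc _ k sc)) (continuousM (cc _ k s'c) (cc _ j sc))).
have mu : m u != 0 by rewrite subr_eq0.
have : \forall v \near u, m v != 0.
  by move: (mc [set r | r != 0]); apply; exact: (open_nbhs_nbhs (conj (@open_neq _ 0) mu)).
apply: filterS => v mv; apply: contra mv => h.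
by rewrite /m (line_minors j k h) subrr.
Qed.

Lemma spanning_escape D I s W : spanning_curve D I.1 I.2 s -> I.1 < I.2 -> ~~ (D <= W)%VS ->
  exists J, subinterval J I /\ forall u, J.1 < u < J.2 -> s u \notin W.
Proof.
move=> [sD sW] Ilt DW.
have [u [ui su]] : exists u, I.1 < u < I.2 /\ s u \notin W.
  apply: contrapT => H; case/negP: DW; apply: (sW I.1 I.2) => // u ui.
  by apply/negP => /negP su; apply: H; exists u.
have [_ _ _ sc] := sD u ui.
exact: near_subinterval ui (near_notin sc su).
Qed.

Lemma dim3_not_sub D W : \dim D = 3%N -> (\dim W <= 2)%N -> ~~ (D <= W)%VS.
Proof. by move=> dD dW; apply/negP => /dimvS; rewrite dD leqNgt ltnS dW. Qed.

Lemma subinterval_mid I J : subinterval I J -> I.1 < (I.1 + I.2) / 2 < I.2.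
Proof. by move=> /and3P[_ h _]; apply/andP; split; lra. Qed.

Section Vertex.
Variables (D1 D2 D1' D2' : {vspace vec}) (s1 s2 s1' s2' : R -> vec) (Y Z : R * R).
Hypotheses (hD : dupin_cyclide D1 D2) (hD' : dupin_cyclide D1' D2').
Hypotheses (Ylt : Y.1 < Y.2) (Zlt : Z.1 < Z.2).
Hypotheses (c1 : spanning_curve D1 Y.1 Y.2 s1) (c1' : spanning_curve D1' Y.1 Y.2 s1').
Hypotheses (c2 : spanning_curve D2 Z.1 Z.2 s2) (c2' : spanning_curve D2' Z.1 Z.2 s2').
Hypothesis meet : forall y z, Y.1 < y < Y.2 -> Z.1 < z < Z.2 -> exists rho : vec,
  [/\ rho != 0, rho \in <<[:: s1 y; s2 z]>>%VS & rho \in <<[:: s1' y; s2' z]>>%VS].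
Hypothesis ind1 : forall y, Y.1 < y < Y.2 -> s1' y \notin <[s1 y]>%VS.
Hypothesis ind2 : forall z, Z.1 < z < Z.2 -> s2' z \notin <[s2 z]>%VS.

Let dim1 : \dim D1 = 3%N. Proof. by apply: signature21_dim; case: hD. Qed.
Let dim2 : \dim D2 = 3%N. Proof. by apply: signature21_dim; case: hD. Qed.
Let dim1' : \dim D1' = 3%N. Proof. by apply: signature21_dim; case: hD'. Qed.
Let dim2' : \dim D2' = 3%N. Proof. by apply: signature21_dim; case: hD'. Qed.

Let span2_dim (u v : vec) : (\dim <<[:: u; v]>> <= 2)%N.
Proof. exact: dim_span_size. Qed.

Let second_in (u v w : vec) : w \in <<[:: u; v]>>%VS -> w \notin <[u]>%VS ->
  v \in <<[:: u; w]>>%VS.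
Proof.
move=> /mem_span2P[a [b wE]] wu; have b0 : b != 0.
  by apply: contraNneq wu => b0; rewrite wE b0 scale0r addr0 memvZ ?memv_line.
apply/mem_span2P; exists (- (b^-1 * a)), b^-1.
by rewrite wE scalerDr !scalerA mulVf// scale1r scaleNr addKr.
Qed.

(* If s1 and s1' were in oriented contact, then s2 or s2' would lie in the line
   through them, for every parameter. *)
Let transversal y : Y.1 < y < Y.2 -> lform (s1 y) (s1' y) != 0.
Proof.
move=> yi; apply/eqP => n12; pose M : {vspace vec} := <<[:: s1 y; s1' y]>>%VS.
have [d1 s10 n1 _] := proj1 c1 y yi; have [d1' s10' n1' _] := proj1 c1' y yi.
have inM z : Z.1 < z < Z.2 -> s2 z \in M \/ s2' z \in M.
  move=> zi; have [rho [r0 rE rE']] := meet yi zi.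
  have [d2 s20 n2 _] := proj1 c2 z zi; have [d2' s20' n2' _] := proj1 c2' z zi.
  have m12 : lform (s1 y) (s2 z) = 0 by have [_ _ h _] := hD; exact: h.
  have m12' : lform (s1' y) (s2' z) = 0 by have [_ _ h _] := hD'; exact: h.
  case: (boolP (s1' y \in <[rho]>%VS)) => sr.
    left; apply: second_in (ind1 yi).
    by have /vlineP[a ->] := sr; rewrite memvZ.
  right; rewrite /M span2C; apply: second_in; last first.
    by apply: contra (ind1 yi) => h; exact: memv_lineC s10 h.
  have hE : contact_element <<[:: s1' y; s2' z]>>%VS.
    apply: null_pair_contact => //; apply/negP => /vlineP[a sE].
    by move/eqP: s20'; apply; apply: (cyclide_disjoint hD' _ d2'); rewrite sE memvZ.
  apply: (contact_element_max hE n1) => w.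
  have -> : <<[:: s1' y; s2' z]>>%VS = <<[:: s1' y; rho]>>%VS.
    by apply: span2_eq; rewrite ?memv_span2l// free2P.
  apply: lform_spanr => //.
  by apply: (null_pair_isotropic n1 n2 m12) rE; exact: memv_span2l.
have [Z' [ZZ out]] := spanning_escape c2 Zlt (dim3_not_sub dim2 (span2_dim (s1 y) (s1' y))).
have [z1 z2 z3] := and3P ZZ.
have h : (D2' <= M)%VS.
  apply: ((proj2 c2') Z'.1 Z'.2) => // z zi; have [|//] := inM z ltac:(lra).
  by rewrite (negbTE (out z zi)).
by have := dim3_not_sub dim2' (span2_dim (s1 y) (s1' y)); rewrite h.
Qed.

Let meet_lines y z : Y.1 < y < Y.2 -> Z.1 < z < Z.2 -> exists r,
  [/\ r != 0, r \in <<[:: s1 y; s1' y]>>%VS & r \in <<[:: s2 z; s2' z]>>%VS].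
Proof.
move=> yi zi; have [rho [r0 /mem_span2P[a [b rE]] /mem_span2P[a' [b' rE']]]] := meet yi zi.
(* Two expressions of the common sphere, a s1 + b s2 = a' s1' + b' s2', are regrouped by family: a
   s1 - a' s1' = b' s2' - b s2. *)
exists (a *: s1 y - a' *: s1' y); split.
- apply/eqP => h; have [d1 s10 _ _] := proj1 c1 y yi.
  have a0 : a' = 0.
    apply/eqP/negP => /negP a0; case/negP: (ind1 yi); apply/vlineP; exists (a'^-1 * a).
    move/eqP: h; rewrite subr_eq0 => /eqP h.
    by rewrite -scalerA h scalerA mulVf// scale1r.
  have a1 : a = 0.
    by move: h; rewrite a0 scale0r subr0 => /eqP; rewrite scaler_eq0 (negbTE s10) orbF => /eqP.
  have [_ s20 _ _] := proj1 c2 z zi.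
  have bb : b *: s2 z = b' *: s2' z by move: rE; rewrite rE' a0 a1 !scale0r !add0r.
  have b0 : b' = 0.
    apply/eqP/negP => /negP b0; case/negP: (ind2 zi); apply/vlineP; exists (b'^-1 * b).
    by rewrite -scalerA bb scalerA mulVf// scale1r.
  by move/eqP: r0; rewrite rE' a0 b0 !scale0r addr0.
- by apply/mem_span2P; exists a, (- a'); rewrite scaleNr.
- apply/mem_span2P; exists (- b), b'; rewrite scaleNr.
  have e : a *: s1 y + b *: s2 z = a' *: s1' y + b' *: s2' z by rewrite -rE.
  by rewrite -[a *: s1 y](addrK (b *: s2 z)) e; apply/rowP => l; rewrite !mxE; ring.
Qed.

(* Every line <s1 y, s1' y> meets every line <s2 z, s2' z>.  If s1 y is outside the
   span of two lines of the second family, then it meets both in their common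
   point b, which therefore does not depend on y. *)
Lemma pencil_vertex : exists Y' b, [/\ subinterval Y' Y, lform b b != 0,
  lie_inversion_image b D1 = D1' /\ lie_inversion_image b D2 = D2' &
  forall y, Y'.1 < y < Y'.2 -> b \in <<[:: s1 y; s1' y]>>%VS /\
    s1' y \in <[lie_inversion b (s1 y)]>%VS].
Proof.
pose L1 y : {vspace vec} := <<[:: s1 y; s1' y]>>%VS.
pose L2 z : {vspace vec} := <<[:: s2 z; s2' z]>>%VS.
pose z0 := (Z.1 + Z.2) / 2; have z0i : Z.1 < z0 < Z.2 by move: Zlt; rewrite /z0 => ?; apply/andP; split; lra.
have [Z' [ZZ Zout]] := spanning_escape c2 Zlt (dim3_not_sub dim2 (span2_dim (s2 z0) (s2' z0))).
pose z1 := (Z'.1 + Z'.2) / 2; have z1i' := subinterval_mid ZZ.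
have z1i : Z.1 < z1 < Z.2 by have /and3P[? ? ?] := ZZ; rewrite /z1; lra.
have z1out : s2 z1 \notin L2 z0 by exact: Zout.
have [d20 s20 _ _] := proj1 c2 z0 z0i; have [d21 s21 _ _] := proj1 c2 z1 z1i.
pose Q := (L2 z0 + L2 z1)%VS.
have Qdim : (\dim Q <= 4)%N.
  by apply: leq_trans (dimv_add_leqif _ _) _; rewrite (leq_add (n1 := 2) (n2 := 2))//; exact: span2_dim.
(* [Q] contains the plane [T] of [D2]; were it to contain [D1] too, its dimension would be at least
   five. *)
have D1Q : ~~ (D1 <= Q)%VS.
  apply/negP => D1Q; pose T : {vspace vec} := <<[:: s2 z1; s2 z0]>>%VS.
  have TD : (T <= D2)%VS by rewrite span2_subv d20 d21.
  have TQ : (T <= Q)%VS.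
    rewrite span2_subv (subvP (addvSr _ _) _ (memv_span2l _ _)).
    by rewrite (subvP (addvSl _ _) _ (memv_span2l _ _)).
  have T2 : \dim T = 2%N.
    apply: free_dim2 => //; apply: contra z1out => /vlineP[a ->].
    by rewrite memvZ// memv_span2l.
  have cap : (D1 :&: T = 0)%VS.
    apply/eqP; rewrite -subv0 -(cyclide_cap hD); apply: capvS => //; exact: subvv.
  have : (D1 + T <= Q)%VS by rewrite subv_add D1Q TQ.
  move=> /dimvS; rewrite (dimv_disjoint_sum cap) dim1 T2 => h.
  by have := leq_trans h Qdim.
have [Y' [YY Yout]] := spanning_escape c1 Ylt D1Q.
have YiY y : Y'.1 < y < Y'.2 -> Y.1 < y < Y.2 by move=> *; have /and3P[? ? ?] := YY; lra.
have meet2 y : Y'.1 < y < Y'.2 -> exists r, [/\ r != 0, r \in L1 y, r \in L2 z0 & r \in L2 z1].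
  move=> yi; have [r [r0 rL rM]] := meet_lines (YiY y yi) z0i.
  have [r' [r0' rL' rM']] := meet_lines (YiY y yi) z1i.
  exists r; split=> //.
  case: (boolP (r' \in <[r]>%VS)) => [rr|rr].
    by have /vlineP[a ->] := memv_lineC r0' rr; rewrite memvZ.
  case/negP: (Yout y yi).
  have fr : free [:: r'; r] by rewrite free2P.
  have : s1 y \in L1 y by exact: memv_span2l.
  rewrite /L1 (span2_eq fr rL' rL) => /mem_span2P[a [b ->]]; rewrite memvD ?memvZ//.
    exact: (subvP (addvSr _ _)).
  exact: (subvP (addvSl _ _)).
pose y0 := (Y'.1 + Y'.2) / 2; have y0i : Y'.1 < y0 < Y'.2 := subinterval_mid YY.
have [b [b0 _ bM0 bM1]] := meet2 y0 y0i.
have bL y : Y'.1 < y < Y'.2 -> b \in L1 y.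
  move=> yi; have [r [r0 rL rM0 rM1]] := meet2 y yi.
  case: (boolP (r \in <[b]>%VS)) => [rb|rb].
    by have /vlineP[a ->] := memv_lineC r0 rb; rewrite memvZ.
  have fr : free [:: r; b] by rewrite free2P.
  case/negP: z1out; rewrite /L2 (span2_eq fr rM0 bM0) -(span2_eq fr rM1 bM1).
  exact: memv_span2l.
have bcoef y : Y'.1 < y < Y'.2 -> exists a a', b = a *: s1 y + a' *: s1' y /\
    lform b b = 2 * (a * a') * lform (s1 y) (s1' y).
  move=> yi; have /mem_span2P[a [a' bE]] := bL y yi; exists a, a'; split=> //.
  have [_ _ n1 _] := proj1 c1 y (YiY y yi); have [_ _ n1' _] := proj1 c1' y (YiY y yi).
  by rewrite bE !lformE n1 n1' (lformC (s1' y)); ring.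
have bb : lform b b != 0.
  apply/eqP => bn.
  (* By [transversal] the line is a hyperbolic plane, whose only null directions are those of [s1 y]
     and [s1' y]. A null [b] would thus confine one of the two curves to a single point over an
     interval. *)
  have par y : Y'.1 < y < Y'.2 -> s1 y \in <[b]>%VS \/ s1' y \in <[b]>%VS.
    move=> yi; have [a [a' [bE bbE]]] := bcoef y yi.
    move: bbE; rewrite bn => /esym/eqP; rewrite mulf_eq0 (negbTE (transversal (YiY y yi))) orbF.
    rewrite mulf_eq0 pnatr_eq0/= mulf_eq0 => /orP[] /eqP a0; [right|left];
      by apply: (memv_lineC b0); rewrite bE a0 scale0r ?add0r ?addr0 memvZ ?memv_line.
  have dim_b : (\dim <[b]> <= 2)%N by rewrite dim_vline; case: (_ != _).
  have c1Y : spanning_curve D1 Y'.1 Y'.2 s1.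
    by have /and3P[? ? ?] := YY; apply: spanning_curve_sub c1.
  have Y'lt : Y'.1 < Y'.2 by have /and3P[] := YY.
  have [J [JY Jout]] := spanning_escape c1Y Y'lt (dim3_not_sub dim1 dim_b).
  have [J1 J2 J3] := and3P JY; have [Y1 Y2 Y3] := and3P YY.
  have h : (D1' <= <[b]>)%VS.
    apply: ((proj2 c1') J.1 J.2); rewrite ?(le_trans _ J1) ?(le_trans J3)//.
    move=> y yi; have [|//] := par y ltac:(lra).
    by rewrite (negbTE (Jout y yi)).
  by have := dim3_not_sub dim1' dim_b; rewrite h.
(* Reflection in a non-null vector of a hyperbolic plane exchanges its two null lines. *)
have refl y : Y'.1 < y < Y'.2 -> s1' y \in <[lie_inversion b (s1 y)]>%VS.
  move=> yi; have [a [a' [bE bbE]]] := bcoef y yi.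
  have [_ s10 n1 _] := proj1 c1 y (YiY y yi); have [_ s10' n1' _] := proj1 c1' y (YiY y yi).
  have a0 : a != 0 by apply: contraNneq bb => a0; rewrite bbE a0 mul0r mulr0 mul0r.
  have a0' : a' != 0 by apply: contraNneq bb => a0'; rewrite bbE a0' !mulr0 mul0r.
  have s0 := transversal (YiY y yi).
  have sb : lform (s1 y) b = a' * lform (s1 y) (s1' y).
    by rewrite bE !lformE n1 mulr0 add0r.
  apply/vlineP; exists (- (a / a')); rewrite /lie_inversion sb bbE.
  move: (lform (s1 y) (s1' y)) s0 => m m0.
  by rewrite bE; apply/rowP => l; rewrite !mxE; field; rewrite m0 a0 a0'.
exists Y', b; split=> //; last by move=> y yi; split; [exact: bL|exact: refl].
have E1 : lie_inversion_image b D1 = D1'.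
  apply/esym/eqP; rewrite eqEdim lie_inversion_dim// dim1 dim1' leqnn andbT.
  have [Y1 Y2 Y3] := and3P YY.
  apply: ((proj2 c1') Y'.1 Y'.2) => // y yi; have /vlineP[a ->] := refl y yi.
  by rewrite memvZ// mem_lie_inversion_image2//; case: (proj1 c1 y (YiY y yi)).
split=> //; apply: lie_inversion_image_eq; rewrite ?dim2 ?dim2'// => v vD.
apply: (cyclide_perp hD') => w; rewrite -E1 mem_lie_inversion_image// => wD.
rewrite -(lform_inversion bb) lie_inversionK//; have [_ _ h _] := hD.
by rewrite lformC; exact: h.
Qed.
End Vertex.

(** Otherwise [Q] has dimension three, and inside the four-dimensional [K] it meets every span of
    [s1 y] and [s2 z]. Fixing one sphere outside [Q] puts the other family into [Q] plus a line, so
    [D1] and [D2] each meet [Q] in at least a plane. Disjoint planes do not fit into dimension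
    three. *)
Lemma plane_unique (p b v : vec) D1 D2 s1 s2 Y Z : dupin_cyclide D1 D2 ->
  Y.1 < Y.2 -> Z.1 < Z.2 ->
  spanning_curve D1 Y.1 Y.2 s1 -> spanning_curve D2 Z.1 Z.2 s2 ->
  p \notin D1 -> p \notin D2 -> p != 0 -> b \notin <[p]>%VS ->
  (forall y z, Y.1 < y < Y.2 -> Z.1 < z < Z.2 -> exists K : {vspace vec},
     (\dim K <= 4)%N /\ [&& s1 y \in K, s2 z \in K, b \in K, p \in K & v \in K]) ->
  v \in <<[:: b; p]>>%VS.
Proof.
move=> hD Ylt Zlt c1 c2 p1 p2 p0 bp hK; apply/negP => /negP vn.
have [sig1 sig2 _ _] := hD; have dim1 := signature21_dim sig1; have dim2 := signature21_dim sig2.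
pose Q : {vspace vec} := <<[:: v; b; p]>>%VS.
have Q3 : \dim Q = 3%N.
  suff /eqP -> : free [:: v; b; p] by [].
  by rewrite free_cons vn free2P.
have pQ : p \in Q by rewrite memv_span ?inE ?eqxx ?orbT.
have nsub D : \dim D = 3%N -> p \notin D -> ~~ (D <= Q)%VS.
  move=> dD pD; apply: contra pD => DQ.
  by have /eqP -> : D == Q by rewrite eqEdim DQ Q3 dD.
have dep y z : Y.1 < y < Y.2 -> Z.1 < z < Z.2 -> exists a c,
    [/\ (a != 0) || (c != 0) & a *: s1 y + c *: s2 z \in Q].
  move=> yi zi; have [d1 s10 _ _] := proj1 c1 y yi; have [d2 s20 _ _] := proj1 c2 z zi.
  have [K [K4 /and5P[K1 K2 Kb Kp Kv]]] := hK y z yi zi.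
  pose T : {vspace vec} := <<[:: s2 z; s1 y]>>%VS.
  have T2 : \dim T = 2%N.
    apply: free_dim2 => //; apply/negP => /vlineP[a sE]; move/eqP: s20; apply.
    by apply: (cyclide_disjoint hD _ d2); rewrite sE memvZ.
  have : (\dim (T + Q) <= 4)%N.
    by apply: leq_trans (dimvS _) K4; rewrite subv_add span2_subv K1 K2 span3_subv Kb Kp Kv.
  have := dimv_sum_cap T Q; rewrite T2 Q3 => e h.
  have cap0 : (T :&: Q)%VS != 0%VS.
    by apply: contraTneq h => c0; move: e; rewrite c0 dimv0 addn0 => ->.
  have := vpick0 (T :&: Q)%VS; rewrite (negbTE cap0) => w0.
  have := memv_pick (T :&: Q)%VS; rewrite memv_cap => /andP[/mem_span2P[c [a wE]] wQ].
  exists a, c; rewrite addrC -wE; split=> //.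
  apply/negPn/negP; rewrite negb_or !negbK => /andP[/eqP a0 /eqP c0].
  by move: w0; rewrite wE a0 c0 !scale0r addr0 eqxx.
have big D s (w : vec) (I : R * R) : \dim D = 3%N -> spanning_curve D I.1 I.2 s -> I.1 < I.2 ->
    (forall u, I.1 < u < I.2 -> exists a c, [/\ (a != 0) || (c != 0) & a *: s u + c *: w \in Q]) ->
    w \notin Q -> (2 <= \dim (D :&: Q))%N.
  move=> dD [_ sW] Ilt H wQ.
  have : (D <= Q + <[w]>)%VS.
    apply: (sW I.1 I.2) => // u ui; have [a [c [ac mQ]]] := H u ui.
    have a0 : a != 0.
      apply: contraNneq wQ => a0; move: ac mQ; rewrite a0 eqxx/= scale0r add0r => c0 mQ.
      by rewrite -[w]scale1r -(mulVf c0) -scalerA memvZ.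
    have -> : s u = a^-1 *: (a *: s u + c *: w) - (a^-1 * c) *: w.
      by rewrite scalerDr !scalerA mulVf// scale1r addrK.
    apply/memv_addP; exists (a^-1 *: (a *: s u + c *: w)); first by rewrite memvZ.
    by exists (- (a^-1 * c) *: w); rewrite ?memvZ ?memv_line// scaleNr.
  move=> DQ; have : (\dim (D + Q) <= 4)%N.
    have /dimvS : (D + Q <= Q + <[w]>)%VS by rewrite subv_add DQ addvSl.
    move=> /leq_trans; apply; apply: leq_trans (dimv_add_leqif _ _) _.
    by rewrite Q3 dim_vline; case: (_ != _).
  have := dimv_sum_cap D Q; rewrite dD Q3 => e h.
  by move: e h; clear; lia.
have [Y' [YY Yout]] := spanning_escape c1 Ylt (nsub _ dim1 p1).
have [Z' [ZZ Zout]] := spanning_escape c2 Zlt (nsub _ dim2 p2).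
have y0i := subinterval_mid YY; have z0i := subinterval_mid ZZ.
set y0 := _ / 2 in y0i; set z0 := _ / 2 in z0i.
have y0Y : Y.1 < y0 < Y.2 by move=> *; have /and3P[? ? ?] := YY; lra.
have z0Z : Z.1 < z0 < Z.2 by have /and3P[? ? ?] := ZZ; lra.
have b1 := big D1 s1 (s2 z0) Y dim1 c1 Ylt (fun y yi => dep y z0 yi z0Z) (Zout z0 z0i).
have b2 : (2 <= \dim (D2 :&: Q))%N.
  apply: (big D2 s2 (s1 y0) Z dim2 c2 Zlt _ (Yout y0 y0i)) => z zi.
  have [a [c [ac mQ]]] := dep y0 z y0Y zi.
  by exists c, a; rewrite orbC addrC.
have cap : ((D1 :&: Q) :&: (D2 :&: Q) = 0)%VS.
  apply/eqP; rewrite -subv0 -(cyclide_cap hD); apply: capvS; exact: capvSl.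
have : ((D1 :&: Q) + (D2 :&: Q) <= Q)%VS by rewrite subv_add !capvSr.
move=> /dimvS; rewrite (dimv_disjoint_sum cap) Q3 => h.
by have := leq_trans (leq_add b1 b2) h.
Qed.
End LineGeometry.

(** * The two rulings attached to an oriented circle *)

Section Fibers.
Variable R : realType.
Local Notation vec := 'rV[R]_6.
Variable p : vec.
Hypothesis pp : lform p p = -1.

Lemma lie_inversion_perp (a v : vec) : lform v a = 0 -> lie_inversion a v = v.
Proof. by move=> va; rewrite /lie_inversion va mulr0 mul0r scale0r subr0. Qed.

Lemma lie_inversion_self : lie_inversion p p = - p.
Proof.
rewrite /lie_inversion pp (_ : 2 * -1 / -1 = 2 :> R); last by field.
by rewrite scaler_nat mulr2n opprD addNKr.
Qed.

Variables (e1 e2 e3 : vec).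
Hypothesis fr : circle_frame p e1 e2 e3.

Lemma circle_frame_coef a b c d : a *: e1 + b *: e2 + c *: e3 + d *: p = 0 ->
  [/\ a = 0, b = 0, c = 0 & d = 0].
Proof.
have [[h1 h2 h3] [[h12 h13 h23] [p1 p2 p3]]] := fr => E.
have L w : lform (a *: e1 + b *: e2 + c *: e3 + d *: p) w = 0 by rewrite E lform0l.
have := L e1; have := L e2; have := L e3; have := L p.
rewrite !lformE (lformC e2 e1) (lformC e3 e1) (lformC e3 e2) (lformC p e1) (lformC p e2).
rewrite (lformC p e3) h1 h2 h3 h12 h13 h23 p1 p2 p3 pp.
by move=> *; split; lra.
Qed.

(** Graphs of two complex multiplications share a nonzero vector only if the multipliers agree;
    cancelling the complex number a + i b is multiplying by its conjugate and dividing by a^2 +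
    b^2. *)
Lemma circle_element_meet u v u' v' w : w != 0 -> w \in circle_element p e1 e2 e3 u v ->
  w \in circle_element p e1 e2 e3 u' v' -> u = u' /\ v = v'.
Proof.
move=> w0 /mem_span2P[a [b wE]] /mem_span2P[a' [b' wE']].
have [] := @circle_frame_coef ((a * u - b * v) - (a' * u' - b' * v'))
  ((a * v + b * u) - (a' * v' + b' * u')) (a - a') (b - b').
  transitivity (w - w); last by rewrite subrr.
  by rewrite {1}wE wE'; apply/rowP => l; rewrite !mxE; ring.
move=> h1 h2 /eqP; rewrite subr_eq0 => /eqP aE /eqP; rewrite subr_eq0 => /eqP bE.
rewrite -{}aE -{}bE in h1 h2.
have n0 : a ^+ 2 + b ^+ 2 != 0.
  rewrite paddr_eq0 ?sqr_ge0// !sqrf_eq0; apply: contra w0 => /andP[/eqP a0 /eqP b0].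
  by rewrite wE a0 b0 !scale0r addr0.
split; apply: (mulIf n0); apply/eqP; rewrite -subr_eq0; apply/eqP.
  have -> : u * (a ^+ 2 + b ^+ 2) - u' * (a ^+ 2 + b ^+ 2) =
    a * (a * u - b * v - (a * u' - b * v')) + b * (a * v + b * u - (a * v' + b * u')) by ring.
  by rewrite h1 h2 !mulr0 addr0.
have -> : v * (a ^+ 2 + b ^+ 2) - v' * (a ^+ 2 + b ^+ 2) =
  a * (a * v + b * u - (a * v' + b * u')) - b * (a * u - b * v - (a * u' - b * v')) by ring.
by rewrite h1 h2 !mulr0 subrr.
Qed.

(** The inversion in [p] conjugates the argument of the graph. A common sphere is therefore a
    nonzero solution of z (u' + i v') = conj(z) (u + i v) with z = a - i b, which exists because
    both multipliers have modulus one. *)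
Lemma circle_element_reflect u v u' v' : u ^+ 2 + v ^+ 2 = 1 -> u' ^+ 2 + v' ^+ 2 = 1 ->
  exists rho : vec, [/\ rho != 0, lie_inversion p rho \in circle_element p e1 e2 e3 u v &
    rho \in circle_element p e1 e2 e3 u' v'].
Proof.
move=> uv uv'; have [_ [_ [p1 p2 p3]]] := fr.
have [a [b [ab h1 h2]]] : exists a b, [/\ (a != 0) || (b != 0),
    a * (u - u') = b * (v + v') & a * (v - v') = - (b * (u + u'))].
  case: (boolP ((v + v' != 0) || (u - u' != 0))) => [h|].
    exists (v + v'), (u - u'); split; [exact: h|by rewrite mulrC|].
    apply/eqP; rewrite -subr_eq0 opprK.
    have -> : (v + v') * (v - v') + (u - u') * (u + u') =
      (u ^+ 2 + v ^+ 2) - (u' ^+ 2 + v' ^+ 2) by ring.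
    by rewrite uv uv' subrr.
  rewrite negb_or !negbK => /andP[/eqP v0 /eqP u0]; exists u, (- v); split; last 2 first.
  - by rewrite v0 u0 !mulr0.
  - have -> : v' = - v by lra.
    have -> : u' = u by lra.
    by ring.
  rewrite oppr_eq0; apply/negPn/negP; rewrite negb_or !negbK => /andP[/eqP u1 /eqP v1].
  by move: uv; rewrite u1 v1 expr0n/= addr0 => /eqP; rewrite eq_sym oner_eq0.
pose w' := u' *: e1 + v' *: e2 + e3; pose n' := (- v') *: e1 + u' *: e2 + p.
exists (a *: w' - b *: n'); split.
- apply/eqP => E; have [] := @circle_frame_coef (a * u' + b * v') (a * v' - b * u') a (- b).
    by rewrite -E /w' /n'; apply/rowP => l; rewrite !mxE; ring.
  move=> _ _ a0 /eqP; rewrite oppr_eq0 => b0.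
  by move: ab; rewrite a0 b0 eqxx.
- apply/mem_span2P; exists a, b.
  rewrite (_ : a *: w' - b *: n' =
      ((a * u' + b * v') *: e1 + (a * v' - b * u') *: e2 + a *: e3) - b *: p); last first.
    by rewrite /w' /n'; apply/rowP => l; rewrite !mxE; ring.
  have L c (w : vec) : lie_inversion p (w - c *: p) = lie_inversion p w - c *: lie_inversion p p.
    by rewrite linearB linearZ.
  rewrite L lie_inversion_self lie_inversion_perp; last first.
    by rewrite !lformE p1 p2 p3; ring.
  have E1 : a * u' + b * v' = a * u - b * v by lra.
  have E2 : a * v' - b * u' = a * v + b * u by lra.
  by rewrite E1 E2; apply/rowP => l; rewrite !mxE; ring.
- by apply/mem_span2P; exists a, (- b); rewrite scaleNr.
Qed.

Lemma circle_element_sub u v :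
  (circle_element p e1 e2 e3 u v <= <<[:: e1; e2; e3; p]>>)%VS.
Proof.
rewrite /circle_element span2_subv; apply/andP; split; apply/mem_span4P.
  by exists u, v, 1, 0; rewrite scale1r scale0r addr0.
by exists (- v), u, 0, 1; rewrite scale1r scale0r addr0.
Qed.
End Fibers.

Lemma lie_inversion_scale (R : realType) (p v : 'rV[R]_6) r : r != 0 ->
  lie_inversion (r *: p) v = lie_inversion p v.
Proof.
move=> r0; rewrite /lie_inversion !lformE scalerA; congr (_ - _ *: _).
have [p0|p0] := eqVneq (lform p p) 0; first by rewrite p0 !mulr0 invr0 !mulr0 mul0r.
by field; rewrite p0 r0.
Qed.

Lemma lie_inversion_conj (R : realType) (p b v : 'rV[R]_6) :
  lform p p != 0 ->
  lie_inversion (lie_inversion p b) (lie_inversion p v) = lie_inversion p (lie_inversion b v).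
Proof.
move=> p0; have L c (w : 'rV[R]_6) : lie_inversion p (v - c *: w) = lie_inversion p v - c *: lie_inversion p w.
  by rewrite linearB linearZ.
rewrite -[lie_inversion b v]/(v - _ *: _) L.
by rewrite -(lform_inversion p0 v b) -(lform_inversion p0 b b).
Qed.

(** * Reconstruction of the pencil *)

Section Reconstruction.
Variable R : realType.
Local Notation vec := 'rV[R]_6.
Local Notation par := 'rV[R]_3.
Variables (i j k : 'I_3).
Hypotheses (ij : i != j) (ik : i != k) (jk : j != k).
Local Notation pt := (coord_point i j).
Variables (p : vec) (lo hi : par) (F : 'I_3 -> par -> {vspace vec}) (x : par -> vec).
Local Notation B := (box lo hi).
Hypothesis pp : lform p p = -1.
Hypothesis legendre : forall i, legendre_family lo hi i (F i).
Hypothesis hx : point_immersion p lo hi x.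
Hypothesis xF : forall i t, B t -> x t \in F i t.
Hypothesis orthF : forall i j t, i != j -> B t ->
  forall s1 s2, s1 \in F i t -> s2 \in F j t -> orthogonal_spheres p s1 s2.
Hypothesis circ : circular_trajectories p lo hi F.
Hypothesis lohi : lo 0 i < hi 0 i.
Let oB := @box_open R lo hi.
Let sx := tos_smooth hx.
Let p0 : lform p p != 0. Proof. by rewrite pp oppr_eq0 oner_eq0. Qed.
Let np : p != 0. Proof. by apply: contraNneq p0 => ->; rewrite lform0l. Qed.
Let mid : exists c, lo 0 i < c < hi 0 i.
Proof. by move: lohi => h; exists ((lo 0 i + hi 0 i) / 2); apply/andP; split; lra. Qed.

Lemma fiber_space y z : lo 0 j < y < hi 0 j -> lo 0 k < z < hi 0 k ->
  exists K : {vspace vec}, [/\ (\dim K <= 4)%N, p \in K &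
    forall c, lo 0 i < c < hi 0 i -> (F i (pt c y z) <= K)%VS].
Proof.
move=> yi zi.
have [e1 [e2 [e3 [fr H]]]] := circle_normal_form ij ik jk pp legendre hx xF orthF circ mid yi zi.
exists <<[:: e1; e2; e3; p]>>%VS; split; first exact: dim_span_size.
  by rewrite memv_span ?inE ?eqxx ?orbT.
move=> c ci; have [u [v [_ _ ->]]] := H c ci; exact: circle_element_sub.
Qed.

Lemma fiber_meet c c' y z w : lo 0 i < c < hi 0 i -> lo 0 i < c' < hi 0 i ->
  lo 0 j < y < hi 0 j -> lo 0 k < z < hi 0 k ->
  w != 0 -> w \in F i (pt c y z) -> w \in F i (pt c' y z) ->
  x (pt c' y z) \in <[x (pt c y z)]>%VS.
Proof.
move=> ci ci' yi zi w0.
have [e1 [e2 [e3 [fr H]]]] := circle_normal_form ij ik jk pp legendre hx xF orthF circ mid yi zi.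
have [u [v [_ xE ->]]] := H c ci; have [u' [v' [_ xE' ->]]] := H c' ci' => w1 w2.
have [uE vE] := circle_element_meet pp fr w0 w1 w2.
have x0 : x (pt c y z) != 0.
  by have [] := immersion_partial i hx (coord_point_box ij ik jk ci yi zi).
by have /vlineP[r ->] := xE'; rewrite -uE -vE memvZ//; apply: memv_lineC.
Qed.

Lemma fiber_reflect c c' y z : lo 0 i < c < hi 0 i -> lo 0 i < c' < hi 0 i ->
  lo 0 j < y < hi 0 j -> lo 0 k < z < hi 0 k ->
  exists rho : vec, [/\ rho != 0, lie_inversion p rho \in F i (pt c y z) & rho \in F i (pt c' y z)].
Proof.
move=> ci ci' yi zi.
have [e1 [e2 [e3 [fr H]]]] := circle_normal_form ij ik jk pp legendre hx xF orthF circ mid yi zi.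
have [u [v [uv _ ->]]] := H c ci; have [u' [v' [uv' _ ->]]] := H c' ci'.
exact: (circle_element_reflect pp fr uv uv').
Qed.

(** A quotient of two coordinates of [x] has nonzero derivative along the trajectory, by immersion
    and after shrinking. Only local injectivity is claimed: an arc may run around its circle
    repeatedly. *)
Lemma trajectory_locally_injective c0 y0 z0 :
  lo 0 i < c0 < hi 0 i -> lo 0 j < y0 < hi 0 j -> lo 0 k < z0 < hi 0 k ->
  exists I Y Z, [/\ subinterval I (lo 0 i, hi 0 i), subinterval Y (lo 0 j, hi 0 j),
    subinterval Z (lo 0 k, hi 0 k) &
    forall c c' y z, I.1 < c < I.2 -> I.1 < c' < I.2 -> Y.1 < y < Y.2 -> Z.1 < z < Z.2 ->
      c != c' -> x (pt c y z) \notin <[x (pt c' y z)]>%VS].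
Proof.
move=> ci yi zi; set t := pt c0 y0 z0.
have Bt : B t := coord_point_box ij ik jk ci yi zi.
have [x0 dx] := immersion_partial i hx Bt.
have [a xa] := row_coord_neq0 x0; have sd := smooth_on_derive (delta_mx 0 i) sx.
have [b hb] : exists b, partial i x t 0 a * x t 0 b - partial i x t 0 b * x t 0 a != 0.
  apply: contrapT => H; case/negP: dx; apply: (minors_line xa) => l.
  by apply/eqP; rewrite -subr_eq0; apply/negP => /negP h; apply: H; exists l.
pose m (s : par) := partial i x s 0 a * x s 0 b - partial i x s 0 b * x s 0 a.
have sm : smooth_on B m.
  apply: (smooth_sub oB); apply: (smooth_mul oB).
  - exact: (smooth_coord oB a sd).
  - exact: (smooth_coord oB b sx).
  - exact: (smooth_coord oB b sd).
  - exact: (smooth_coord oB a sx).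
have nxa := smooth_near_neq0 (smooth_coord oB a sx) Bt xa.
have nm := smooth_near_neq0 sm Bt hb.
have [e [e0 eP]] := near_small_box (filterI (near_box Bt) (filterI nxa nm)).
have in_box c y z : c0 - e < c < c0 + e -> y0 - e < y < y0 + e -> z0 - e < z < z0 + e ->
    [/\ B (pt c y z), x (pt c y z) 0 a != 0 & m (pt c y z) != 0].
  move=> c1 y1 z1.
  have lE n : (t - const_mx e) 0 n = t 0 n - e by move: (t) => s; rewrite !mxE.
  have hE n : (t + const_mx e) 0 n = t 0 n + e by move: (t) => s; rewrite !mxE.
  suff Bs : box (t - const_mx e) (t + const_mx e) (pt c y z) by have [? [? ?]] := eP _ Bs.
  apply: (coord_point_box ij ik jk); rewrite !lE !hE /t.
  - by rewrite coord_pointi.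
  - by rewrite (coord_pointj ij).
  - by rewrite (coord_pointk ik jk).
pose J (r : R) : R * R := (r - e / 2, r + e / 2).
have Jin r s : (J r).1 <= s <= (J r).2 -> r - e < s < r + e by rewrite /J /=; lra.
have Jsub r s : (J r).1 < s < (J r).2 -> r - e < s < r + e by rewrite /J /=; lra.
have [B1 _ _] := in_box _ _ _ (Jin c0 (J c0).1 ltac:(rewrite /J /=; lra))
  (Jin y0 (J y0).1 ltac:(rewrite /J /=; lra)) (Jin z0 (J z0).1 ltac:(rewrite /J /=; lra)).
have [B2 _ _] := in_box _ _ _ (Jin c0 (J c0).2 ltac:(rewrite /J /=; lra))
  (Jin y0 (J y0).2 ltac:(rewrite /J /=; lra)) (Jin z0 (J z0).2 ltac:(rewrite /J /=; lra)).
exists (J c0), (J y0), (J z0); split.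
- have := B1 i; have := B2 i; rewrite !coord_pointi /J /= => h1 h2.
  by apply/and3P; split=> /=; lra.
- have := B1 j; have := B2 j; rewrite !(coord_pointj ij) /J /= => h1 h2.
  by apply/and3P; split=> /=; lra.
- have := B1 k; have := B2 k; rewrite !(coord_pointk ik jk) /J /= => h1 h2.
  by apply/and3P; split=> /=; lra.
move=> c c' y z c1 c1' y1 z1 cc; apply/negP => xx.
have q : x (pt c y z) 0 b / x (pt c y z) 0 a = x (pt c' y z) 0 b / x (pt c' y z) 0 a.
  have [_ xc _] := in_box _ _ _ (Jsub _ _ c1) (Jsub _ _ y1) (Jsub _ _ z1).
  have [_ xc' _] := in_box _ _ _ (Jsub _ _ c1') (Jsub _ _ y1) (Jsub _ _ z1).
  by apply/eqP; rewrite eqr_div// (line_minors b a xx) mulrC.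
pose f u := x (pt u y z) 0 b / x (pt u y z) 0 a.
pose df u := - m (pt u y z) / x (pt u y z) 0 a ^+ 2.
have fd u : (J c0).1 < u < (J c0).2 -> is_derive u (1 : R) f (df u).
  move=> ui; have [Bu xu _] := in_box _ _ _ (Jsub _ _ ui) (Jsub _ _ y1) (Jsub _ _ z1).
  have dxu : is_derive u (1 : R) (fun u => x (pt u y z)) (partial i x (pt u y z)).
    have := smooth_on_derivable (delta_mx 0 i) sx Bu.
    rewrite -{1}(upd_coord_pointi i j u u y z) => h.
    by apply: is_derive_ext (is_derive_upd h) => // v; rewrite upd_coord_pointi.
  have /is_derive_mxP dX := dxu; have da := dX 0 a; have db := dX 0 b.
  have iv : is_derive u (1 : R) (fun u => (x (pt u y z) 0 a)^-1)
      (- (x (pt u y z) 0 a) ^- 2 *: partial i x (pt u y z) 0 a).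
    have [dd <-] := da; apply: DeriveDef; first exact: derivableV.
    by rewrite deriveV.
  have := der_mul db iv; apply: is_derive_ext => //.
  by rewrite /df /m -[_ *: _]/(_ * _); field.
have main v1 v2 : (J c0).1 < v1 < (J c0).2 -> (J c0).1 < v2 < (J c0).2 -> v1 < v2 ->
    f v1 != f v2.
  move=> i1 i2 c12; apply/eqP => e12.
  have ui u : v1 <= u <= v2 -> (J c0).1 < u < (J c0).2 by lra.
  have gd (u : R) : u \in `]v1, v2[ -> is_derive u (1 : R) f (df u).
    by rewrite in_itv/= => uu; apply/fd/ui; lra.
  have gc : {within `[v1, v2], continuous f}.
    by apply: derivable_within_continuous => u; rewrite in_itv/= => /ui/fd[].
  have [u uu] := MVT_segment (ltW c12) gd gc.
  rewrite e12 subrr => /esym/eqP; rewrite mulf_eq0 subr_eq0 (gt_eqF c12) orbF.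
  have [_ xu mu] := in_box _ _ _ (Jsub _ _ (ui u uu)) (Jsub _ _ y1) (Jsub _ _ z1).
  by rewrite /df mulf_eq0 invr_eq0 expf_eq0/= (negbTE xu) oppr_eq0 (negbTE mu).
by case: (ltgtP c c') cc => // h _; [have := main c c' c1 c1' h|have := main c' c c1' c1 h];
  rewrite /f q eqxx.
Qed.

Lemma point_map_moves m t (v : vec) : B t ->
  ~ \forall u \near t 0 m, x (upd t m u) \in <[v]>%VS.
Proof.
move=> Bt H; have [x0 /negP] := immersion_partial m hx Bt; apply.
have xv : x t \in <[v]>%VS by have := nbhs_singleton H; rewrite upd_id.
have : partial m x t \in <[v]>%VS.
  have h := smooth_on_derivable (delta_mx 0 m) sx Bt; rewrite -{1}(upd_id t m) in h.
  exact: (derive_mem (is_derive_upd h) H).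
by move/vlineP => [r ->]; rewrite memvZ// memv_lineC.
Qed.

Hypothesis slices : forall c, lo 0 i < c < hi 0 i ->
  exists D1 D2, dupin_cyclide D1 D2 /\ dupin_surface D1 D2 lo hi i c (F i).

Definition chart (c : R) (Y Z : R * R) (D : {vspace vec} * {vspace vec})
    (s : (R -> vec) * (R -> vec)) : Prop :=
  [/\ lo 0 i < c < hi 0 i, subinterval Y (lo 0 j, hi 0 j), subinterval Z (lo 0 k, hi 0 k) &
   adapted lo hi F i j c Y.1 Y.2 Z.1 Z.2 D.1 D.2 s.1 s.2].

Lemma chart_sub c Y Z Y' Z' D s : subinterval Y' Y -> subinterval Z' Z ->
  chart c Y Z D s -> chart c Y' Z' D s.
Proof.
move=> YY ZZ [ci Yi Zi A]; split=> //.
- exact: subinterval_trans YY Yi.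
- exact: subinterval_trans ZZ Zi.
by have /and3P[? ? ?] := YY; have /and3P[? ? ?] := ZZ; apply: adapted_sub A.
Qed.

Lemma charts_exist (cs : seq R) Y Z : {in cs, forall c, lo 0 i < c < hi 0 i} ->
  subinterval Y (lo 0 j, hi 0 j) -> subinterval Z (lo 0 k, hi 0 k) ->
  exists Y' Z', [/\ subinterval Y' Y, subinterval Z' Z &
    {in cs, forall c, exists D s, chart c Y' Z' D s}].
Proof.
elim: cs Y Z => [|c cs IH] Y Z csi Yi Zi.
  exists Y, Z; split=> //; first by have /and3P[_ ? _] := Yi; apply/and3P; split.
  by have /and3P[_ ? _] := Zi; apply/and3P; split.
have ci : lo 0 i < c < hi 0 i by apply: csi; rewrite inE eqxx.
have [D1 [D2 [hD hS]]] := slices ci.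
have [Y1 [Z1 [E1 [E2 [s1 [s2 [YY ZZ A]]]]]]] :=
  adapted_exists ij ik jk pp legendre hx xF orthF ci Yi Zi hD hS.
have Y1i := subinterval_trans YY Yi; have Z1i := subinterval_trans ZZ Zi.
have C1 : chart c Y1 Z1 (E1, E2) (s1, s2) by [].
have [|Y2 [Z2 [YY2 ZZ2 H]]] := IH Y1 Z1 _ Y1i Z1i.
  by move=> d dcs; apply: csi; rewrite inE dcs orbT.
exists Y2, Z2; split; [exact: subinterval_trans YY2 YY|exact: subinterval_trans ZZ2 ZZ|].
move=> d; rewrite inE => /orP[/eqP ->|/H//].
by exists (E1, E2), (s1, s2); exact: chart_sub C1.
Qed.

Let in_sub (I J : R * R) u : subinterval J I -> J.1 < u < J.2 -> I.1 < u < I.2.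
Proof. by move=> /and3P[? ? ?] ui; lra. Qed.

Let chart_box c Y Z D s y z : chart c Y Z D s -> Y.1 < y < Y.2 -> Z.1 < z < Z.2 ->
  B (pt c y z).
Proof.
move=> [ci Yi Zi _] yi zi; apply: (coord_point_box ij ik jk) => //.
  exact: in_sub Yi yi.
exact: in_sub Zi zi.
Qed.

(** If [p] were in one half of the splitting, every sphere of the other half would be a point
    sphere; the point map would then be constant along one coordinate direction. *)
Lemma chart_p_notin c Y Z D s : chart c Y Z D s -> p \notin D.1 /\ p \notin D.2.
Proof.
move=> C; have [ci Yi Zi [[sD1 sD2 D12 D12f] _ [c1 _] [c2 _] FE]] := C.
have Ym := subinterval_mid Yi; have Zm := subinterval_mid Zi.
set y := _ / 2 in Ym; set z := _ / 2 in Zm.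
have Bt := chart_box C Ym Zm.
have line y' z' v : Y.1 < y' < Y.2 -> Z.1 < z' < Z.2 -> v != 0 -> lform v v = 0 ->
    lform v p = 0 -> v \in F i (pt c y' z') -> x (pt c y' z') \in <[v]>%VS.
  move=> yi zi v0 vv vp vF; have Bs := chart_box C yi zi.
  apply: (@timelike_perp_line R p v) => //.
  - by rewrite pp oppr_lt0 ltr01.
  - exact: (tos_p hx Bs).
  - by apply: contact_element_orth (proj1 (proj1 (legendre i)) _ Bs) vF (xF i Bs).
  - by rewrite (tos_null hx Bs).
split; apply/negP => pD.
- have [d2 s20 n2 _] := c2 z Zm.
  apply: (@point_map_moves j (pt c y z) (s.2 z) Bt).
  rewrite (coord_pointj ij); move: (near_interval Ym); apply: filterS => u ui.
  rewrite (upd_coord_pointj ij); apply: line => //; first by rewrite lformC; exact: D12.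
  by rewrite FE// memv_span2r.
- have [d1 s10 n1 _] := c1 y Ym.
  apply: (@point_map_moves k (pt c y z) (s.1 y) Bt).
  rewrite (coord_pointk ik jk); move: (near_interval Zm); apply: filterS => u ui.
  rewrite (upd_coord_pointk ij ik jk); apply: line => //; first exact: D12.
  by rewrite FE// memv_span2l.
Qed.

Lemma spanning_curve_reflect D l h (s : R -> vec) : spanning_curve D l h s ->
  spanning_curve (lie_inversion_image p D) l h (fun u => lie_inversion p (s u)).
Proof.
move=> [sD sW]; split=> [u ui|l' h' W ll lh hh sWp].
  have [su s0 n0 sc] := sD u ui; split.
  - by rewrite mem_lie_inversion_image2.
  - by apply: contraNneq s0 => E; rewrite -(lie_inversionK p0 (s u)) E linear0.
  - by rewrite lform_inversion.
  - exact: (continuous_linear (L := lie_inversion p) sc).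
have DW : (D <= lie_inversion_image p W)%VS.
  by apply: (sW l' h') => // u ui; rewrite mem_lie_inversion_image// sWp.
apply/subvP => v; rewrite mem_lie_inversion_image// => /(subvP DW).
by rewrite mem_lie_inversion_image2.
Qed.

(** [b] lies in the span of [p] and all contact elements along each trajectory over the rectangle.
    Quantifying over the spaces [K] avoids forming a span over a continuum of parameters. *)
Definition spans_fibers (b : vec) (Y Z : R * R) : Prop :=
  forall y z (K : {vspace vec}), Y.1 < y < Y.2 -> Z.1 < z < Z.2 -> p \in K ->
    (forall c, lo 0 i < c < hi 0 i -> (F i (pt c y z) <= K)%VS) -> b \in K.

Lemma spans_fibers_sub b Y Z Y' Z' : subinterval Y' Y -> subinterval Z' Z ->
  spans_fibers b Y Z -> spans_fibers b Y' Z'.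
Proof.
by move=> YY ZZ H y z K yi zi; apply: H; [exact: in_sub YY yi|exact: in_sub ZZ zi].
Qed.

Lemma spans_fibers_plane a v c Y Z D s : chart c Y Z D s -> spans_fibers a Y Z ->
  spans_fibers v Y Z -> a \notin <[p]>%VS -> v \in <<[:: a; p]>>%VS.
Proof.
move=> C ha hv ap; have [p1 p2] := chart_p_notin C.
have [ci Yi Zi [hD _ c1 c2 FE]] := C.
have Ylt : Y.1 < Y.2 by have /and3P[] := Yi. have Zlt : Z.1 < Z.2 by have /and3P[] := Zi.
apply: (plane_unique hD Ylt Zlt c1 c2 p1 p2 np ap) => y z yi zi.
have [K [K4 pK FK]] := fiber_space (in_sub Yi yi) (in_sub Zi zi).
exists K; split=> //; rewrite pK (ha y z K)// (hv y z K)//= !andbT.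
by have := FK c ci; rewrite FE// span2_subv => /andP[-> ->].
Qed.

(** [pencil_vertex] is applied to the chart of [c] reflected in [p] and the chart of [c'];
    [fiber_reflect] supplies the meeting spheres. If [b] is parallel to [p], the two inversions
    cancel, the charts share a sphere, and by [fiber_meet] also the point. *)
Lemma chart_link c c' Y Z D s D' s' y0 z0 : chart c Y Z D s -> chart c' Y Z D' s' ->
  Y.1 < y0 < Y.2 -> Z.1 < z0 < Z.2 ->
  s'.1 y0 \notin <[lie_inversion p (s.1 y0)]>%VS ->
  s'.2 z0 \notin <[lie_inversion p (s.2 z0)]>%VS ->
  exists Y' Z' b,
    [/\ subinterval Y' Y /\ subinterval Z' Z, lform b b != 0, spans_fibers b Y' Z',
      lie_inversion_image b (lie_inversion_image p D.1) = D'.1 /\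
      lie_inversion_image b (lie_inversion_image p D.2) = D'.2 &
      forall y z, Y'.1 < y < Y'.2 -> Z'.1 < z < Z'.2 -> b \in <[p]>%VS ->
        x (pt c' y z) \in <[x (pt c y z)]>%VS].
Proof.
move=> C C' yi zi ny nz.
have [ci Yi Zi [hD _ c1 c2 FE]] := C; have [ci' _ _ [hD' _ c1' c2' FE']] := C'.
have r1 := spanning_curve_reflect c1; have r2 := spanning_curve_reflect c2.
have [Y1 [YY Yout]] : exists J, subinterval J Y /\ forall u, J.1 < u < J.2 ->
    s'.1 u \notin <[lie_inversion p (s.1 u)]>%VS.
  have [_ q0 _ qc] := proj1 r1 y0 yi; have [_ _ _ qc'] := proj1 c1' y0 yi.
  exact: (near_subinterval yi (near_not_parallel qc qc' q0 ny)).
have [Z1 [ZZ Zout]] : exists J, subinterval J Z /\ forall u, J.1 < u < J.2 ->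
    s'.2 u \notin <[lie_inversion p (s.2 u)]>%VS.
  have [_ q0 _ qc] := proj1 r2 z0 zi; have [_ _ _ qc'] := proj1 c2' z0 zi.
  exact: (near_subinterval zi (near_not_parallel qc qc' q0 nz)).
have restrict (I J : R * R) E q : subinterval J I -> spanning_curve E I.1 I.2 q ->
    spanning_curve E J.1 J.2 q.
  by move=> /and3P[? ? ?]; exact: spanning_curve_sub.
have [Y2 [b [YY2 bb DD bL]]] : exists Y' b, [/\ subinterval Y' Y1, lform b b != 0,
    lie_inversion_image b (lie_inversion_image p D.1) = D'.1 /\
    lie_inversion_image b (lie_inversion_image p D.2) = D'.2 &
    forall y, Y'.1 < y < Y'.2 -> b \in <<[:: lie_inversion p (s.1 y); s'.1 y]>>%VS /\
      s'.1 y \in <[lie_inversion b (lie_inversion p (s.1 y))]>%VS].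
  have Ylt : Y1.1 < Y1.2 by have /and3P[] := YY.
  have Zlt : Z1.1 < Z1.2 by have /and3P[] := ZZ.
  apply: (pencil_vertex (lie_inversion_cyclide p0 hD) hD' Ylt Zlt (restrict _ _ _ _ YY r1)
    (restrict _ _ _ _ YY c1') (restrict _ _ _ _ ZZ r2) (restrict _ _ _ _ ZZ c2') _ Yout Zout).
  move=> y z /(in_sub YY) yY /(in_sub ZZ) zZ.
  have [rho [rho0 rF rF']] := fiber_reflect ci ci' (in_sub Yi yY) (in_sub Zi zZ).
  exists rho; split=> //; last by rewrite -FE'.
  by move: rF; rewrite FE// -mem_lie_inversion_image// lie_inversion_span.
exists Y2, Z1, b; split=> //; first by split=> //; exact: subinterval_trans YY2 YY.
- move=> y z K y2 z1 pK FK; have yY := in_sub YY (in_sub YY2 y2); have zZ := in_sub ZZ z1.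
  have [/mem_span2P[r [r' ->]] _] := bL y y2.
  have := FK c ci; rewrite FE// span2_subv => /andP[sK _].
  have := FK c' ci'; rewrite FE'// span2_subv => /andP[sK' _].
  by rewrite memvD ?memvZ// /lie_inversion memvB ?memvZ.
- move=> y z y2 z1 /vlineP[r bE]; have yY := in_sub YY (in_sub YY2 y2); have zZ := in_sub ZZ z1.
  have r0 : r != 0 by apply: contraNneq bb => r0; rewrite bE r0 scale0r lform0l.
  have [_ ] := bL y y2; rewrite bE lie_inversion_scale// lie_inversionK// => sl.
  have [_ s0' _ _] := proj1 c1' y yY.
  apply: (fiber_meet ci ci' (in_sub Yi yY) (in_sub Zi zZ) s0').
    by rewrite FE//; have /vlineP[q ->] := sl; rewrite memvZ ?memv_span2l.
  by rewrite FE' ?memv_span2l.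
Qed.

Definition separated (cs : seq R) (Y Z : R * R) : Prop :=
  forall c c' y z, c \in cs -> c' \in cs -> Y.1 < y < Y.2 -> Z.1 < z < Z.2 -> c != c' ->
    x (pt c y z) \notin <[x (pt c' y z)]>%VS.

(* A chart can be parallel to the reflection of at most one of three separated
   charts along each of the two families of curvature spheres. *)
Lemma pool_link (Q : R -> {vspace vec} * {vspace vec} -> Prop) cs c' Y Z D' s' :
  separated cs Y Z -> uniq cs -> (3 <= size cs)%N -> chart c' Y Z D' s' ->
  {in cs, forall c, exists D s, chart c Y Z D s /\ Q c D} ->
  exists c Y' Z' D b, [/\ c \in cs /\ Q c D,
    subinterval Y' Y /\ subinterval Z' Z, lform b b != 0 /\ spans_fibers b Y' Z',
      lie_inversion_image b (lie_inversion_image p D.1) = D'.1 /\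
      lie_inversion_image b (lie_inversion_image p D.2) = D'.2 &
      forall y z, Y'.1 < y < Y'.2 -> Z'.1 < z < Z'.2 -> b \in <[p]>%VS ->
        x (pt c' y z) \in <[x (pt c y z)]>%VS].
Proof.
move=> sep ucs size3 C' charts.
have [ci' Yi Zi [hD' _ c1' c2' FE']] := C'.
have ym := subinterval_mid Yi; have zm := subinterval_mid Zi.
set y := _ / 2 in ym; set z := _ / 2 in zm.
have common c d w : c \in cs -> d \in cs -> w != 0 -> w \in F i (pt c y z) ->
    w \in F i (pt d y z) -> c = d.
  move=> cc dd w0 wc wd; apply/eqP/negP => /negP cd.
  have [_ [_ [[ci _ _ _] _]]] := charts c cc; have [_ [_ [[di _ _ _] _]]] := charts d dd.
  case/negP: (sep c d y z cc dd ym zm cd).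
  exact: (fiber_meet di ci (in_sub Yi ym) (in_sub Zi zm) w0).
have reflect (v w : vec) (E : {vspace vec}) : v != 0 -> v \in <[lie_inversion p w]>%VS -> w \in E ->
    lie_inversion p v != 0 /\ lie_inversion p v \in E.
  move=> v0 /vlineP[r vE] wE; split.
    by apply: contraNneq v0 => E0; rewrite -(lie_inversionK p0 v) E0 linear0.
  by rewrite vE linearZ /= lie_inversionK// memvZ.
(* Degeneracy of [c] in a family puts one fixed reflected sphere into its contact element. Two
   slices containing the same sphere would have the same point, against separation. *)
pose deg1 c := lie_inversion p (s'.1 y) \in F i (pt c y z).
pose deg2 c := lie_inversion p (s'.2 z) \in F i (pt c y z).
have [_ s10 _ _] := proj1 c1' y ym; have [_ s20 _ _] := proj1 c2' z zm.
have n1 : lie_inversion p (s'.1 y) != 0.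
  by apply: contraNneq s10 => E0; rewrite -(lie_inversionK p0 (s'.1 y)) E0 linear0.
have n2 : lie_inversion p (s'.2 z) != 0.
  by apply: contraNneq s20 => E0; rewrite -(lie_inversionK p0 (s'.2 z)) E0 linear0.
have [c [cc [g1 g2]]] : exists c, c \in cs /\ ~~ deg1 c /\ ~~ deg2 c.
  apply: contrapT => H.
  have deg c : c \in cs -> deg1 c \/ deg2 c.
    move=> cc; case: (boolP (deg1 c)) => h1; first by left.
    by right; apply/negPn/negP => h2; apply: H; exists c.
  have u1 c d : c \in cs -> d \in cs -> deg1 c -> deg1 d -> c = d.
    by move=> cc dd; exact: common.
  have u2 c d : c \in cs -> d \in cs -> deg2 c -> deg2 d -> c = d.
    by move=> cc dd; exact: common.
  case: (cs) ucs size3 deg u1 u2 => [|d1 [|d2 [|d3 ds]]]//=.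
  move=> /and4P[+ + _ _] _ deg u1 u2.
  rewrite !inE !negb_or => /and3P[d12 d13 _] /andP[d23 _].
  have m1 : d1 \in [:: d1, d2, d3 & ds] by rewrite !inE eqxx.
  have m2 : d2 \in [:: d1, d2, d3 & ds] by rewrite !inE eqxx !orbT.
  have m3 : d3 \in [:: d1, d2, d3 & ds] by rewrite !inE eqxx !orbT.
  have [h1|h1] := deg _ m1; have [h2|h2] := deg _ m2; have [h3|h3] := deg _ m3;
    first [by case/eqP: d12; auto | by case/eqP: d13; auto | by case/eqP: d23; auto].
have [D [s [C QD]]] := charts c cc; have [_ _ _ [_ _ _ _ FE]] := C.
have [] := @chart_link c c' Y Z D s D' s' y z C C' ym zm.
- apply: contra g1 => h; apply: (proj2 (reflect _ (s.1 y) _ s10 h _)).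
  by rewrite FE ?memv_span2l.
- apply: contra g2 => h; apply: (proj2 (reflect _ (s.2 z) _ s20 h _)).
  by rewrite FE ?memv_span2r.
by move=> Y' [Z' [b [YZ bb bF DD bp]]]; exists c, Y', Z', D, b.
Qed.

(** A base slice [c0] is linked to three reference slices, which determines the plane of [a] and
    [p]. Any other slice is then linked to one of the references, and the two links compose to a
    single inversion of the reflected base cyclide. *)
Lemma dc_family_inversions : lo 0 j < hi 0 j -> lo 0 k < hi 0 k ->
  exists (D1 D2 : {vspace vec}) (a : vec),
    [/\ dupin_cyclide D1 D2, lform a a != 0, a \notin <[p]>%VS &
      forall c, lo 0 i < c < hi 0 i -> exists b, [/\ b \in <<[:: a; p]>>%VS, lform b b != 0 &
        dupin_surface (lie_inversion_image b D1) (lie_inversion_image b D2) lo hi i c (F i)]].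
Proof.
move=> ltj ltk; have [c0' c0i'] := mid.
have ymid : lo 0 j < (lo 0 j + hi 0 j) / 2 < hi 0 j by apply/andP; split; lra.
have zmid : lo 0 k < (lo 0 k + hi 0 k) / 2 < hi 0 k by apply/andP; split; lra.
have [I [Y0 [Z0 [Ii Y0i Z0i inj]]]] := trajectory_locally_injective c0i' ymid zmid.
have Ilt : I.1 < I.2 by have /and3P[] := Ii.
pose pts (n : nat) := I.1 + (I.2 - I.1) / n.+2%:R.
have ptsI n : I.1 < pts n < I.2.
  have d0 : 0 < I.2 - I.1 by rewrite subr_gt0.
  have h1 : 0 < (I.2 - I.1) / n.+2%:R by rewrite divr_gt0.
  have h2 : (I.2 - I.1) / n.+2%:R < I.2 - I.1.
    by rewrite ltr_pdivrMr// ltr_pMr// ltr1n.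
  by rewrite /pts; move: (_ / _) h1 h2 => q *; apply/andP; split; lra.
have pts_inj : injective pts.
  move=> m n /addrI /(mulfI _) h; have /invr_inj/eqP : (m.+2%:R : R)^-1 = n.+2%:R^-1.
    by apply: h; rewrite subr_eq0 gt_eqF.
  by rewrite eqr_nat => /eqP [].
(* Five candidates: every link needs three and uses up one, and three links are made. *)
pose c0 := pts 0%N; pose cs := [seq pts n | n <- iota 1 5].
have ucs : uniq cs by rewrite map_inj_uniq// iota_uniq.
have csI c : c \in c0 :: cs -> I.1 < c < I.2.
  by rewrite inE => /orP[/eqP ->|/mapP[n _ ->]]; exact: ptsI.
have c0cs : c0 \notin cs by apply/mapP => -[n nn /pts_inj n0]; rewrite -n0 in nn.
have size_cs : size cs = 5%N by [].
have size3 : (3 <= size cs)%N by [].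
clearbody cs.
have sep Y Z (ds : seq R) : subinterval Y Y0 -> subinterval Z Z0 -> {subset ds <= c0 :: cs} ->
    separated ds Y Z.
  move=> YY ZZ sub c c' y z cd cd' yi zi.
  by apply: inj; [exact: csI (sub _ cd)|exact: csI (sub _ cd')|exact: in_sub YY yi|exact: in_sub ZZ zi].
have [Y1 [Z1 [Y1i Z1i H1]]] := @charts_exist (c0 :: cs) Y0 Z0
  (fun c cc => in_sub Ii (csI c cc)) Y0i Z0i.
have [D0 [s0 C0]] := H1 c0 (mem_head _ _).
have [hD0 _ _ _ _] : adapted lo hi F i j c0 Y1.1 Y1.2 Z1.1 Z1.2 D0.1 D0.2 s0.1 s0.2 by case: C0.
have cs_sub : {subset cs <= c0 :: cs} by move=> c cc; rewrite inE cc orbT.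
have link ds Y Z : subinterval Y Y1 -> subinterval Z Z1 ->
    uniq ds -> {subset ds <= cs} -> (3 <= size ds)%N ->
    exists c Y' Z' D b, [/\ c \in ds, [/\ subinterval Y' Y, subinterval Z' Z & exists s, chart c Y' Z' D s],
      lform b b != 0 /\ spans_fibers b Y' Z',
      lie_inversion_image b (lie_inversion_image p D.1) = D0.1 /\
      lie_inversion_image b (lie_inversion_image p D.2) = D0.2 & b \notin <[p]>%VS].
  move=> YY ZZ uds dcs sds.
  have [||c [Y' [Z' [D [b [[cc [s Cs]] [YY' ZZ'] [bb bF] DD bp]]]]]] :=
    @pool_link (fun c D => exists s, chart c Y Z D s) ds c0 Y Z D0 s0 _ uds sds (chart_sub YY ZZ C0).
  - apply: sep; [exact: subinterval_trans YY Y1i|exact: subinterval_trans ZZ Z1i|].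
    by move=> c /dcs; exact: cs_sub.
  - move=> c /dcs/cs_sub/H1[D [s C]]; exists D, s.
    by split; [|exists s]; exact: chart_sub C.
  exists c, Y', Z', D, b; split=> //.
    by split=> //; exists s; exact: chart_sub Cs.
  apply/negP => bp'; have ym := subinterval_mid YY'; have zm := subinterval_mid ZZ'.
  set y := _ / 2 in ym; set z := _ / 2 in zm.
  have YY0 := subinterval_trans YY' (subinterval_trans YY Y1i).
  have ZZ0 := subinterval_trans ZZ' (subinterval_trans ZZ Z1i).
  have c0c : c0 != c by apply: contraNneq c0cs => ->; exact: dcs.
  have := inj c0 c y z (ptsI 0%N) (csI c (cs_sub _ (dcs _ cc))) (in_sub YY0 ym) (in_sub ZZ0 zm) c0c.
  by rewrite bp.
have refl1 : subinterval Y1 Y1 /\ subinterval Z1 Z1.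
  by have /and3P[_ ? _] := Y1i; have /and3P[_ ? _] := Z1i; split; apply/and3P; split.
have [c1 [Y2 [Z2 [D1 [a [c1cs [YY2 ZZ2 [s1 C1]] [aa aF] DD1 ap]]]]]] :=
  link cs Y1 Z1 (proj1 refl1) (proj2 refl1) ucs (fun c cc => cc) size3.
have plane v Y Z : subinterval Y Y2 -> subinterval Z Z2 -> spans_fibers v Y Z ->
    v \in <<[:: a; p]>>%VS.
  move=> YY ZZ vF; have YY1 := subinterval_trans YY YY2; have ZZ1 := subinterval_trans ZZ ZZ2.
  exact: (spans_fibers_plane (chart_sub YY1 ZZ1 C0) (spans_fibers_sub YY ZZ aF) vF ap).
pose cs2 := rem c1 cs.
have [ucs2 sub2 size2] : [/\ uniq cs2, {subset cs2 <= cs} & (3 <= size cs2)%N].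
  by split; [exact: rem_uniq|exact: mem_rem|rewrite size_rem// size_cs].
have [c2 [Y3 [Z3 [D2 [b2 [c2cs [YY3 ZZ3 [s2 C2]] [bb2 bF2] DD2 _]]]]]] :=
  link cs2 Y2 Z2 YY2 ZZ2 ucs2 sub2 size2.
pose cs3 := rem c2 cs2.
have [ucs3 sub3 size3'] : [/\ uniq cs3, {subset cs3 <= cs2} & (3 <= size cs3)%N].
  by split; [exact: rem_uniq|exact: mem_rem|rewrite !size_rem// size_cs].
have YY31 := subinterval_trans YY3 YY2; have ZZ31 := subinterval_trans ZZ3 ZZ2.
have [c3 [Y4 [Z4 [D3 [b3 [c3cs [YY4 ZZ4 [s3 C3]] [bb3 bF3] DD3 _]]]]]] :=
  link cs3 Y3 Z3 YY31 ZZ31 ucs3 (fun c cc => sub2 c (sub3 c cc)) size3'.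
have YY42 := subinterval_trans YY4 YY3; have ZZ42 := subinterval_trans ZZ4 ZZ3.
have b2P := plane b2 Y3 Z3 YY3 ZZ3 bF2; have b3P := plane b3 Y4 Z4 YY42 ZZ42 bF3.
pose pool := [:: c1; c2; c3].
have upool : uniq pool.
  have c12 : c1 != c2 by move: c2cs; rewrite (mem_rem_uniq _ ucs) inE eq_sym => /andP[].
  have c23 : c2 != c3 by move: c3cs; rewrite (mem_rem_uniq _ ucs2) inE eq_sym => /andP[].
  have c13 : c1 != c3.
    by move: (sub3 _ c3cs); rewrite (mem_rem_uniq _ ucs) inE eq_sym => /andP[].
  by rewrite /= !inE negb_or c12 c13 c23.
have pool_cs : {subset pool <= cs}.
  move=> c; rewrite !inE => /or3P[] /eqP->; [exact: c1cs|exact: sub2|exact: sub2 (sub3 _ c3cs)].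
pose Q (c : R) (D : {vspace vec} * {vspace vec}) := exists b,
  [/\ b \in <<[:: a; p]>>%VS, lform b b != 0,
    lie_inversion_image b (lie_inversion_image p D.1) = D0.1 &
    lie_inversion_image b (lie_inversion_image p D.2) = D0.2].
have poolQ c : c \in pool -> exists D s, chart c Y4 Z4 D s /\ Q c D.
  rewrite !inE => /or3P[] /eqP->.
  - exists D1, s1; split; last by case: DD1 => ? ?; exists a; split=> //; exact: memv_span2l.
    exact: chart_sub YY42 ZZ42 C1.
  - exists D2, s2; split; last by case: DD2 => ? ?; exists b2.
    exact: chart_sub YY4 ZZ4 C2.
  - by exists D3, s3; split; last by case: DD3 => ? ?; exists b3.
have Ep := lie_inversion_cyclide p0 hD0.
(* A link is an inversion preceded by the one in [p]; starting from the base cyclide reflected in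
   [p] absorbs the latter. *)
exists (lie_inversion_image p D0.1), (lie_inversion_image p D0.2), a; split=> // c ci.
have YY41 := subinterval_trans YY42 YY2; have ZZ41 := subinterval_trans ZZ42 ZZ2.
have YY40 := subinterval_trans YY41 Y1i; have ZZ40 := subinterval_trans ZZ41 Z1i.
have [|Y5 [Z5 [YY5 ZZ5 H5]]] := @charts_exist [:: c] Y4 Z4 _
    (subinterval_trans YY40 Y0i) (subinterval_trans ZZ40 Z0i).
  by move=> d; rewrite inE => /eqP ->.
have [D [s C]] := H5 c (mem_head _ _).
have sepp : separated pool Y5 Z5.
  apply: sep; [exact: subinterval_trans YY5 YY40|exact: subinterval_trans ZZ5 ZZ40|].
  by move=> d /pool_cs/cs_sub.
have [|d [Y6 [Z6 [Dd [b [[dp [e [eP ee Q1 Q2]]] [YY6 ZZ6] [bb bF] [E1 E2] _]]]]]] :=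
    @pool_link Q pool c Y5 Z5 D s sepp upool isT C.
  move=> d /poolQ[Dd [sd [Cd Qd]]]; exists Dd, sd; split=> //; exact: chart_sub Cd.
have bP : b \in <<[:: a; p]>>%VS.
  apply: (plane b Y6 Z6) => //.
    exact: subinterval_trans YY6 (subinterval_trans YY5 YY42).
  exact: subinterval_trans ZZ6 (subinterval_trans ZZ5 ZZ42).
(* Through the reference, sigma_b sigma_e carries the base cyclide to the slice of [c]. With sigma_e
   sigma_p = sigma_p sigma_e', its action on the reflected base cyclide is sigma_b sigma_p sigma_e',
   a product of three inversions in the plane. *)
pose e' := lie_inversion p e.
have ee' : lform e' e' != 0 by rewrite lform_inversion.
have e'P : e' \in <<[:: a; p]>>%VS by rewrite /e' /lie_inversion memvB// memvZ// memv_span2r.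
have [b' [b'P bb' b'E]] := lie_inversion3 pp bb ee' bP e'P.
have image_eq (E0 Ed E : {vspace vec}) : \dim E0 = 3%N -> \dim E = 3%N ->
    lie_inversion_image e (lie_inversion_image p Ed) = E0 ->
    lie_inversion_image b (lie_inversion_image p Ed) = E ->
    lie_inversion_image b' (lie_inversion_image p E0) = E.
  move=> d0 dE h0 hE; apply: lie_inversion_image_eq => //.
    by rewrite lie_inversion_dim// d0 dE.
  move=> v; rewrite mem_lie_inversion_image// -h0 mem_lie_inversion_image// => vE.
  rewrite -b'E -{1}(lie_inversionK p0 v) /e' lie_inversion_conj// lie_inversionK// -hE.
  by rewrite mem_lie_inversion_image2.
have [_ _ _ [[sg1 sg2 _ _] hS _ _ _]] := C; have [sg01 sg02 _ _] := hD0.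
exists b'; split=> //.
rewrite (image_eq _ _ D.1 _ _ Q1 E1) ?(image_eq _ _ D.2 _ _ Q2 E2)//; exact: signature21_dim.
Qed.
End Reconstruction.

Lemma other_indices (i : 'I_3) : exists j k : 'I_3, [/\ i != j, i != k & j != k].
Proof.
by move: i; apply: ord3_split; [exists 1, 2|exists 0, 2|exists 0, 1].
Qed.

Theorem theorem20 (R : realType) (p : 'rV[R]_6) (hp : lform p p = -1) :
  (forall (D1 D2 : {vspace 'rV[R]_6}) (a : 'rV[R]_6),
     dupin_cyclide D1 D2 -> lform a a != 0 -> <[a]>%VS != <[p]>%VS ->
     [/\ (* wherever the point sphere maps are regular, the family is a Lame
            family of a DC-system; lightlike members of span{a,p} are totally
            umbilic members of it *)
         forall lo hi b s1 s2 x,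
           regular_pencil p D1 D2 a lo hi b s1 s2 x ->
           exists F : 'I_3 -> 'rV[R]_3 -> {vspace 'rV[R]_6},
             dc_system p lo hi F /\
             forall t, box lo hi t ->
               (lform (b (t 0 0)) (b (t 0 0)) != 0 ->
                  F 0 t = lie_inversion_image (b (t 0 0))
                            <<[:: s1 (t 0 1)%R; s2 (t 0 2)%R]>>%VS) /\
               (lform (b (t 0 0)) (b (t 0 0)) = 0 -> b (t 0 0) \in F 0 t),
         (* every sigma_b(Delta) whose point sphere map is not singular
            everywhere occurs *)
         forall b0, b0 \in <<[:: a; p]>>%VS -> lform b0 b0 != 0 ->
           p \notin lie_inversion_image b0 D1 ->
           p \notin lie_inversion_image b0 D2 ->
           exists lo hi b s1 s2 x u,
             [/\ regular_pencil p D1 D2 a lo hi b s1 s2 x,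
                 lo 0 0 < u < hi 0 0 & b u = b0] &
         (* every sphere in span{a,p} which is neither a point sphere nor a
            curvature sphere of Delta occurs *)
         forall b0, b0 \in <<[:: a; p]>>%VS -> b0 != 0 -> lform b0 b0 = 0 ->
           lform b0 p != 0 -> b0 \notin D1 -> b0 \notin D2 ->
           exists lo hi b s1 s2 x u,
             [/\ regular_pencil p D1 D2 a lo hi b s1 s2 x,
                 lo 0 0 < u < hi 0 0 & b u = b0]]) /\
  (forall (lo hi : 'rV[R]_3) (F : 'I_3 -> 'rV[R]_3 -> {vspace 'rV[R]_6}) (i : 'I_3),
     dc_system p lo hi F ->
     (forall c, lo 0 i < c < hi 0 i ->
        exists D1 D2, dupin_cyclide D1 D2 /\ dupin_surface D1 D2 lo hi i c (F i)) ->
     exists (D1 D2 : {vspace 'rV[R]_6}) (a : 'rV[R]_6),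
       [/\ dupin_cyclide D1 D2, lform a a != 0, <[a]>%VS != <[p]>%VS &
           forall c, lo 0 i < c < hi 0 i ->
             exists b, [/\ b \in <<[:: a; p]>>%VS, lform b b != 0 &
               dupin_surface (lie_inversion_image b D1) (lie_inversion_image b D2)
                 lo hi i c (F i)]]).
Proof.
have p0 : lform p p != 0 by rewrite hp oppr_eq0 oner_eq0.
split=> [D1 D2 a hD aa ap|lo hi F i [[lohi legendre [x hx xF] orthF] circ _] slices].
  have anp : a \notin <[p]>%VS.
    apply: contra ap => al; have a0 : a != 0 by apply: contraNneq aa => ->; rewrite lform0l.
    by rewrite eqEsubv -!memvE al memv_lineC.
  split=> [lo hi b s1 s2 x|b0 b0m bb p1 p2|b0 b0m b00 bb bp b1 b2].
  - exact: (regular_pencil_dc_system hp hD).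
  - have b00 : b0 != 0 by apply: contraNneq bb => ->; rewrite lform0l.
    have qE : lform b0 b0 *: p - (2 * lform p b0) *: b0 = lform b0 b0 *: lie_inversion b0 p.
      by rewrite /lie_inversion scalerBr scalerA mulrCA divff// mulr1.
    have q (D : {vspace _}) : p \notin lie_inversion_image b0 D ->
        lform b0 b0 *: p - (2 * lform p b0) *: b0 \notin D.
      rewrite qE mem_lie_inversion_image//; apply: contra => h.
      by rewrite -[lie_inversion b0 p]scale1r -(mulVf bb) -scalerA memvZ.
    exact: (pencil_construction hp hD anp b0m b00 (q _ p1) (q _ p2)).
  - have q (D : {vspace _}) : b0 \notin D -> lform b0 b0 *: p - (2 * lform p b0) *: b0 \notin D.
      apply: contra; rewrite bb scale0r sub0r -scaleNr => h.
      have n0 : - (2 * lform p b0) != 0 by rewrite oppr_eq0 mulf_neq0 ?pnatr_eq0// lformC.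
      by rewrite -[b0]scale1r -(mulVf n0) -scalerA memvZ.
    exact: (pencil_construction hp hD anp b0m b00 (q _ b1) (q _ b2)).
have [j [k [ij ik jk]]] := other_indices i.
have [D1 [D2 [a [hD aa ap H]]]] := dc_family_inversions ij ik jk hp legendre hx xF orthF circ
  (lohi i) slices (lohi j) (lohi k).
by exists D1, D2, a; split=> //; apply: contraNneq ap => <-; exact: memv_line.
Qed.
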